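(* Fix an admissible optimization--oracle instance. Let $\mathsf{T}_\varepsilon^{\mathrm{Tree\text{-}RGT}}(\mathsf{G}_{n,\hat D},B)$ denote the worst-case $\varepsilon$-round complexity of $B$-sample Tree-RGT over $\mathsf{G}_{n,\hat D}$, where the algorithm outputs $\widehat x=x_1^{(\widehat t)}$ and $\widehat t$ is uniformly distributed over $\{0,\dots,T-1\}$, $T$ being the iteration budget; the fixed problem instance and all associated problem-dependent quantities are suppressed from the notation. Then $$\mathsf{T}_\varepsilon^{\mathrm{Tree\text{-}RGT}}(\mathsf{G}_{n,\hat D},B)=\mathcal{O}\left(\frac{1}{nB\varepsilon^4}+\frac{\hat D}{\varepsilon^2}\right).$$ This bound is uniform over $\mathsf{G}_{n,\hat D}$ and matches the powers of $n$ and $\hat D$ in the diameter-based minimax benchmark $\Theta\left(\frac{\Delta L\sigma^2}{nB\varepsilon^4}+\frac{\Delta L\hat D}{\varepsilon^2}\right)$. Hence Tree-RGT has uniformly optimal network dependence over $\mathsf{G}_{n,\hat D}$.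
   Context: Graph class: $\mathsf{G}_{n,\hat D}$ ($n\ge2$, $1\le\hat D\le n-1$) is the class of connected undirected graphs $\mathcal{G}$ on $\mathcal{N}=\{1,\dots,n\}$ with diameter exactly $\hat D$. Problem and assumptions (admissible instance): $f=\frac1n\sum_{i=1}^nf_i$, each $f_i:\mathbb{R}^p\to\mathbb{R}$ continuously differentiable with $L$-Lipschitz gradient, $f^\star:=\inf f>-\infty$. All agents start from a common point $x^{(0)}$; $\Delta_f:=f(x^{(0)})-f^\star>0$ with $\Delta_f\le\Delta$, and $H_0:=\frac1n\sum_i\|\nabla f_i(x^{(0)})\|^2$. Oracles: all samples are mutually independent, agent $i$'s distributed as $\mathcal{D}_i$, with $\mathbb{E}[g_i(x,\xi_i)]=\nabla f_i(x)$ and $\mathbb{E}\|g_i(x,\xi_i)-\nabla f_i(x)\|^2\le\sigma^2$, $\sigma^2>0$, for all $i,x$. The problem-dependent quantities, treated as fixed, are $\Delta_f,L,\sigma^2,H_0$. Complexity: the $\varepsilon$-round complexity of a method on a graph is the least number of synchronous one-hop communication rounds after which its output $\widehat x$ satisfies $\mathbb{E}\|\nabla f(\widehat x)\|\le\varepsilon$. For the fixed instance, the worst case is taken over $\mathcal{G}\in\mathsf{G}_{n,\hat D}$. Each Tree-RGT iteration is one synchronous round. The minimax benchmark is the infimum, over synchronous zero-respecting first-order methods in which each agent makes at most $B$ local oracle queries per round and communicates only with one-hop neighbors, of the supremum of the $\varepsilon$-round complexity over all graphs in $\mathsf{G}_{n,\hat D}$ and all admissible instances with parameters $\Delta,L,\sigma^2$.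 (Zero-respecting: an oracle query may be nonzero only in coordinates previously present in the agent's own or a neighbor's state, and the next local state may additionally activate only coordinates revealed by the agent's current oracle responses.) A method in this class has uniformly optimal network dependence over $\mathsf{G}_{n,\hat D}$ if it admits an upper bound on its $\varepsilon$-round complexity that is uniform over the class (for each fixed admissible instance, the same bound with the same numerical constants and the same dependence on the class parameters holds for every graph in the class) and matches the minimax powers of $n$ and $\hat D$; with $\Delta,L,\sigma^2$ fixed, the two benchmark terms scale as $n^{-1}B^{-1}\varepsilon^{-4}$ and $\hat D\varepsilon^{-2}$. Tree construction: node $1$ is the root. Level-synchronous breadth-first search: $h_1=0$, $p(1)=1$; for $\ell=0,\dots,n-2$, every node with $h_i=\ell$ messages all its neighbors, and every undiscovered node $j$ receiving a message takes the smallest-index sender as parent $p(j)$ and sets $h_j=\ell+1$. $\mathrm{Ch}(i)=\{j:p(j)=i\}$ (so $1\in\mathrm{Ch}(1)$), and $D:=\max_ih_i$, which satisfies $D\le\hat D$ for graphs in $\mathsf{G}_{n,\hat D}$. Tree-RGT ($B$-sample, integer $B\ge1$, integer budget $T\ge1$): each gradient evaluation uses $g_{i,B}(x,\boldsymbol\xi_i)=\frac1B\sum_{b=1}^Bg_i(x,\xi_{i,b})$ with fresh independent $\xi_{i,b}$. The stepsize is $\gamma=\gamma_B:=\min\left\{\frac{\sqrt{B\Delta_f}}{\sqrt{nTL\sigma^2}},\frac1{40nDL}\right\}$. Writing $g_i^{(t)}:=g_{i,B}(x_i^{(t)},\boldsymbol\xi_i^{(t)})$, initialize $x_i^{(0)}=x^{(0)}$,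 $y_i^{(0)}=g_i^{(0)}$, and iterate $x_1^{(t+1)}=x_1^{(t)}-\gamma y_1^{(t)}$, $x_i^{(t+1)}=x_{p(i)}^{(t)}$ for $i\ne1$, and $y_i^{(t+1)}=\sum_{j\in\mathrm{Ch}(i)}y_j^{(t)}+g_i^{(t+1)}-g_i^{(t)}$ for all $i$. *)

(* Defs.v *)
From HB Require Import structures.
From mathcomp Require Import all_boot all_order all_algebra.
From mathcomp Require Import all_classical all_reals all_analysis.

Set Implicit Arguments.
Unset Strict Implicit.
Unset Printing Implicit Defensive.

Import Order.TTheory GRing.Theory Num.Theory.
Import numFieldNormedType.Exports.

Local Open Scope classical_set_scope.
Local Open Scope ring_scope.

(* The sigma-algebra on matrices generated by the entries, i.e. the Borel
   sigma-algebra of the finite-dimensional space of matrices.  It makes row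
   vectors and agent states usable as arguments of measurable functions. *)
Definition matrix_display : measure_display -> measure_display.
Proof. exact. Qed.

Section measurable_matrix.
Context {d} {T : measurableType d} (m n : nat).

Definition matrix_sigma : set (set 'M[T]_(m, n)) :=
  <<s \bigcup_(ij in [set: 'I_m * 'I_n])
        preimage_set_system setT (fun A : 'M[T]_(m, n) => A ij.1 ij.2)
          measurable >>.

Let matrix_sigma0 : matrix_sigma set0.
Proof. exact: sigma_algebra0. Qed.

Let matrix_sigmaC A : matrix_sigma A -> matrix_sigma (~` A).
Proof. exact: sigma_algebraC. Qed.

Let matrix_sigma_bigcup (F : _^nat) : (forall i, matrix_sigma (F i)) ->
  matrix_sigma (\bigcup_i (F i)).
Proof. exact: sigma_algebra_bigcup. Qed.

HB.instance Definition _ := @isMeasurable.Build (matrix_display d)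
  'M[T]_(m, n) matrix_sigma matrix_sigma0 matrix_sigmaC matrix_sigma_bigcup.

End measurable_matrix.


Section euclidean.
Context {R : realType}.

(* The Euclidean norm; the library norm on matrices is the max norm. *)
Definition enorm p (v : 'rV[R]_p) : R := Num.sqrt (\sum_j v 0 j ^+ 2).

Definition grad p (f : 'rV[R]_p -> R) (x : 'rV[R]_p) : 'rV[R]_p :=
  \row_j 'D_(delta_mx 0 j) f x.

End euclidean.

Section graphs.
Context {n : nat}.
Implicit Types (G : rel 'I_n) (i j : 'I_n).

(* The least length of a walk from i to j; a shortest walk has fewer than n
   edges, and the value is n when there is none. *)
Definition gdist G i j : nat :=
  find (fun k => [exists s : k.-tuple 'I_n, path G i s && (last i s == j)])
       (iota 0 n).

Definition diameter G : nat := \max_i \max_j gdist G i j.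

Definition graph_class (Dh : nat) G : Prop :=
  [/\ symmetric G, irreflexive G, forall i j, connect G i j
    & diameter G = Dh].

End graphs.

(* Agents are numbered from 0: the root, node 1, is the ordinal 0. *)
Definition root n (hn : (1 < n)%N) : 'I_n := Ordinal (ltnW hn).

Section breadth_first_search.
Context {n : nat} (G : rel 'I_n) (r : 'I_n).

(* The nodes discovered after the rounds 0, ..., k.-1, with level and parent. *)
Fixpoint bfs (k : nat) : 'I_n -> option (nat * 'I_n) :=
  match k with
  | 0 => fun j => if j == r then Some (0%N, r) else None
  | l.+1 => fun j =>
      match bfs l j with
      | Some v => Some v
      | None =>
          (* enum 'I_n is increasing: the head is the smallest-index sender *)
          if [seq i <- enum 'I_n | (omap fst (bfs l i) == Some l) && G i j]
             is i :: _ then Some (l.+1, i) else None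
      end
  end.

Definition level (i : 'I_n) : nat := odflt 0%N (omap fst (bfs n.-1 i)).
Definition parent (i : 'I_n) : 'I_n := odflt r (omap snd (bfs n.-1 i)).
Definition tree_depth : nat := \max_i level i.

End breadth_first_search.

Section problems.
Context {R : realType}.

(* An optimization-oracle instance for n agents.  The sample xi i t b is the
   b-th one used by agent i in round t. *)
Record problem (n : nat) := Problem {
  dim : nat;
  obj : 'I_n -> 'rV[R]_dim -> R;
  start : 'rV[R]_dim;
  smp_disp : measure_display;
  smp : 'I_n -> measurableType smp_disp;
  law : forall i, probability (smp i) R;
  oracle : forall i, 'rV[R]_dim -> smp i -> 'rV[R]_dim;
  omega_disp : measure_display;
  omega : measurableType omega_disp;
  prob : probability omega R;
  xi : forall (i : 'I_n) (t b : nat), {RV prob >-> smp i}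
}.
#[global] Arguments obj {n} p i x.
#[global] Arguments law {n} p i.
#[global] Arguments oracle {n} p i x z.
#[global] Arguments xi {n} p i t b.

Section quantities.
Context {n : nat} (I : problem n).

Definition avg_obj (x : 'rV[R]_(dim I)) : R := n%:R^-1 * \sum_i obj I i x.

Definition gap : R := avg_obj (start I) - inf (range avg_obj).

Definition grad_energy : R :=
  n%:R^-1 * \sum_i enorm (grad (obj I i) (start I)) ^+ 2.

Definition smooth (L : R) : Prop :=
  forall i, [/\ forall x, differentiable (obj I i) x,
    continuous (grad (obj I i))
  & forall x y, enorm (grad (obj I i) x - grad (obj I i) y)
                <= L * enorm (x - y)].

Definition unbiased : Prop :=
  forall i x j, 'E_(law I i)[(fun z => oracle I i x z 0 j)%R]%E =
                  (grad (obj I i) x 0 j)%:E.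

Definition variance_le (sigma2 : R) : Prop :=
  forall i x, ('E_(law I i)[(fun z =>
      enorm (oracle I i x z - grad (obj I i) x) ^+ 2)%R] <= sigma2%:E)%E.

Definition same_law : Prop :=
  forall i t b (A : set (smp I i)), measurable A ->
    distribution (prob I) (xi I i t b) A = law I i A.

(* The index k is the triple (agent, round, sample). *)
Definition mutually_independent : Prop :=
  forall (J : seq ('I_n * nat * nat))
         (A : forall k : 'I_n * nat * nat, set (smp I k.1.1)),
    uniq J -> (forall k, measurable (A k)) ->
    (prob I (\bigcap_(k in [set` J]) (xi I k.1.1 k.1.2 k.2 @^-1` A k)) =
     \prod_(k <- J) prob I (xi I k.1.1 k.1.2 k.2 @^-1` A k))%E.

(* The oracle is jointly measurable, so that it can be evaluated at random
   points. *)
Definition admissible (L sigma2 : R) : Prop :=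
  [/\ smooth L, has_lbound (range avg_obj) & 0 < gap] /\
  [/\ forall i, measurable_fun setT
        (fun z : 'rV[R]_(dim I) * smp I i => oracle I i z.1 z.2),
      unbiased, variance_le sigma2, same_law & mutually_independent].

End quantities.
End problems.

Arguments problem : clear implicits.
#[global] Arguments avg_obj {R n} I x.

Section methods.
Context {R : realType}.

(* A synchronous protocol for n agents and vectors in R^p, with B oracle
   queries per agent and round (unneeded answers can be ignored).  The state of
   an agent consists of mem.+1 vectors, the rows of a matrix; the states of all
   agents form a tuple.  A round t is as follows: agent i makes the queries
   b = 0, ..., B.-1, where query b may use the answers to the earlier ones (the
   rows of the last argument, 0 for the queries not yet made), and it then
   updates its state.  The seed carries the internal randomness. *)
Record protocol (n p B : nat) := Protocol {
  seed_disp : measure_display;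
  seed : measurableType seed_disp;
  seed_law : probability seed R;
  mem : nat;
  query : nat -> 'I_n -> 'I_B -> seed -> n.-tuple 'M[R]_(mem.+1, p) ->
    'M[R]_(B, p) -> 'rV[R]_p;
  update : nat -> 'I_n -> seed -> n.-tuple 'M[R]_(mem.+1, p) ->
    'M[R]_(B, p) -> 'M[R]_(mem.+1, p);
  output : seed -> n.-tuple 'M[R]_(mem.+1, p) -> 'rV[R]_p
}.
#[global] Arguments query {n p B} p0 t i b s S Y : rename.
#[global] Arguments update {n p B} p0 t i s S Y : rename.
#[global] Arguments output {n p B} p0 s S : rename.

Section zero_respecting.
Context {n p B : nat} (G : rel 'I_n) (A : protocol n p B).

Definition active m (M : 'M[R]_(m, p)) (c : 'I_p) : bool :=
  [exists r, M r c != 0].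

Definition nbhd_active m (S : n.-tuple 'M[R]_(m, p)) (i : 'I_n) (c : 'I_p) :=
  [exists j, ((j == i) || G i j) && active (tnth S j) c].

Definition one_hop : Prop :=
  forall t i s (S S' : n.-tuple 'M[R]_((mem A).+1, p)) Y,
    (forall j, (j == i) || G i j -> tnth S j = tnth S' j) ->
    (forall b, query A t i b s S Y = query A t i b s S' Y) /\
    update A t i s S Y = update A t i s S' Y.

Definition zero_respecting : Prop :=
  [/\ forall t i b (s : seed A) S Y c,
        query A t i b s S Y 0 c != 0 -> nbhd_active S i c,
      forall t i (s : seed A) S Y r c,
        update A t i s S Y r c != 0 -> nbhd_active S i c || active Y c
    & forall (s : seed A) S c,
        output A s S 0 c != 0 -> [exists j, active (tnth S j) c]].

Definition measurable_protocol : Prop :=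
  [/\ forall t i b, measurable_fun setT
        (fun z : seed A * n.-tuple 'M[R]_((mem A).+1, p) * 'M[R]_(B, p) =>
           query A t i b z.1.1 z.1.2 z.2),
      forall t i, measurable_fun setT
        (fun z : seed A * n.-tuple 'M[R]_((mem A).+1, p) * 'M[R]_(B, p) =>
           update A t i z.1.1 z.1.2 z.2)
    & measurable_fun setT
        (fun z : seed A * n.-tuple 'M[R]_((mem A).+1, p) => output A z.1 z.2)].

End zero_respecting.

Section execution.
Context {n B : nat} (I : problem R n) (A : protocol n (dim I) B).
Notation state := 'M[R]_((mem A).+1, dim I).

(* The answers to the first k queries of agent i in round t. *)
Fixpoint answers t i (s : seed A) (S : n.-tuple state) (w : omega I) (k : nat) :
    'M[R]_(B, dim I) :=
  match k with
  | 0 => 0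
  | l.+1 =>
      let Y := answers t i s S w l in
      \matrix_(b < B)
        (if b == l :> nat then oracle I i (query A t i b s S Y) (xi I i t b w)
         else row b Y)
  end.

Definition init_state : state := \matrix_(r < (mem A).+1)
  (if r == ord0 then start I else 0).

Fixpoint states (s : seed A) (w : omega I) (t : nat) : n.-tuple state :=
  match t with
  | 0 => [tuple init_state | _ < n]
  | u.+1 =>
      let S := states s w u in
      [tuple update A u i s S (answers u i s S w B) | i < n]
  end.

(* The expected norm of the gradient of the average objective at the output
   after T rounds, the seed being independent of the samples. *)
Definition expected_grad (T : nat) : \bar R :=
  (\int[prob I \x seed_law A]_z
     (enorm (grad (avg_obj I) (output A z.2 (states z.2 z.1 T))))%:E)%E.

End execution.

#[global] Arguments answers {n B I} A t i s S w k.
#[global] Arguments states {n B I} A s w t.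

(* A method provides a protocol for every graph, dimension, and budget T of
   rounds. *)
Definition method (n B : nat) :=
  rel 'I_n -> forall p : nat, nat -> protocol n p B.

Definition in_method_class n B (Dh : nat) (M : method n B) : Prop :=
  forall G, graph_class Dh G -> forall p T,
    [/\ one_hop G (M G p T), zero_respecting G (M G p T)
      & measurable_protocol (M G p T)].

(* The least number T of rounds, T >= 1, for which the output is
   eps-stationary in expectation; +oo if there is none. *)
Definition round_complexity n B (M : method n B) (G : rel 'I_n)
    (I : problem R n) (eps : R) : \bar R :=
  ereal_inf [set (T%:R)%:E | T in
    [set T : nat | (0 < T)%N /\ (expected_grad (M G (dim I) T) T <= eps%:E)%E]].

Definition worst_case n B (M : method n B) (Dh : nat) (I : problem R n)
    (eps : R) : \bar R :=
  ereal_sup [set round_complexity M G I eps | G in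
    [set G : rel 'I_n | graph_class Dh G]].

Definition minimax (n Dh B : nat) (Delta L sigma2 eps : R) : \bar R :=
  ereal_inf [set v | exists2 M : method n B, in_method_class Dh M &
    v = ereal_sup [set u | exists2 I : problem R n,
          admissible I L sigma2 /\ gap I <= Delta
        & u = worst_case M Dh I eps]].

End methods.

Arguments protocol : clear implicits.
Arguments method : clear implicits.

Section tree_rgt.
Context {R : realType}.

Definition stepsize (n D B T : nat) (Df L sigma2 : R) : R :=
  Num.min (Num.sqrt (B%:R * Df) / Num.sqrt (n%:R * T%:R * L * sigma2))
          (40 * n%:R * D%:R * L)^-1.

Section recursion.
Context {n : nat} (I : problem R n) (G : rel 'I_n) (r : 'I_n) (B : nat).
Variables (gamma : R) (w : omega I).
Notation vec := 'rV[R]_(dim I).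

Definition minibatch (i : 'I_n) (t : nat) (x : vec) : vec :=
  B%:R^-1 *: \sum_(b < B) oracle I i x (xi I i t b w).

(* The pair of families (x_i^(t))_i, (y_i^(t))_i. *)
Fixpoint tree_iter (t : nat) : ('I_n -> vec) * ('I_n -> vec) :=
  match t with
  | 0 => (fun=> start I, fun i => minibatch i 0 (start I))
  | u.+1 =>
      let (x, y) := tree_iter u in
      let x' i := if i == r then x r - gamma *: y r else x (parent G r i) in
      (x', fun i => \sum_(j | parent G r j == i) y j
                    + minibatch i u.+1 (x' i) - minibatch i u (x i))
  end.

End recursion.

Definition row_x : 'I_4 := inord 0.
Definition row_y : 'I_4 := inord 1.
Definition row_g : 'I_4 := inord 2.
Definition row_out : 'I_4 := inord 3.

(* Tree-RGT as a protocol.  After round t, the state of agent i consists of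
   x_i^(t), y_i^(t), g_i^(t), and of x_i^(that) if that <= t, where that is the
   seed; see treeRGT_outputE. *)
Section as_protocol.
Context {n : nat} (G : rel 'I_n) (r : 'I_n) (B p : nat) (gamma : R).
Notation state := 'M[R]_(4, p).

Definition tree_x (t : nat) (i : 'I_n) (S : n.-tuple state) : 'rV[R]_p :=
  if t == 0%N then row row_x (tnth S i)
  else if i == r then row row_x (tnth S r) - gamma *: row row_y (tnth S r)
  else row row_x (tnth S (parent G r i)).

Definition tree_update (t : nat) (i : 'I_n) (that : nat) (S : n.-tuple state)
    (Y : 'M[R]_(B, p)) : state :=
  let x := tree_x t i S in
  let g := B%:R^-1 *: \sum_b row b Y in
  let y := if t == 0%N then g
    else \sum_(j | parent G r j == i) row row_y (tnth S j)
         + g - row row_g (tnth S i) in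
  \matrix_(k < 4)
    [:: x; y; g; if t == that then x else row row_out (tnth S i)]`_k.

(* Uniform on 0, ..., T.-1; the fallback law is irrelevant for T >= 1. *)
Definition uniform_below (T : nat) : probability nat R :=
  mnormalize (msum (fun k => dirac k : {measure set nat -> \bar R}) T)
             (dirac 0%N).

Definition tree_protocol (T : nat) : protocol R n p B :=
  @Protocol R n p B _ nat (uniform_below T) 3
    (fun t i _ _ S _ => tree_x t i S) tree_update
    (fun _ S => row row_out (tnth S r)).

End as_protocol.

Definition treeRGT n (hn : (1 < n)%N) (B : nat) (Df L sigma2 : R) :
    method R n B :=
  fun G p T => tree_protocol G (root hn) B p
    (stepsize n (tree_depth G (root hn)) B T Df L sigma2) T.

(* For that < T, the output after T rounds is x_1^(that). *)
Section output_of_treeRGT.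
Context {n : nat} (hn : (1 < n)%N) (I : problem R n) (B : nat).
Context (Df L sigma2 : R) (G : rel 'I_n) (T : nat) (w : omega I).
Let A := treeRGT hn B Df L sigma2 G (dim I) T.
Let r := root hn.
Let iter := tree_iter G r B
  (stepsize n (tree_depth G r) B T Df L sigma2) w.

Let answers_row t i s S k (b : 'I_B) :
  row b (answers A t i s S w k) =
  if (b < k)%N then oracle I i (query A t i b s S 0) (xi I i t b w) else 0.
Proof.
elim: k => [|k IH]; first by rewrite /= row0.
rewrite /= rowK ltnS leq_eqVlt; case: eqP => //= _; exact: IH.
Qed.

Let stateS t that i (S := tnth (states A that w t.+1) i) :
  [/\ row row_x S = (iter t).1 i, row row_y S = (iter t).2 i,
      row row_g S = minibatch B w i t ((iter t).1 i)
    & row row_out S = if (that <= t)%N then (iter that).1 i else 0].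
Proof.
pose gamma := stepsize n (tree_depth G r) B T Df L sigma2.
have gE u k (S' : n.-tuple 'M[R]_(4, dim I)) :
    B%:R^-1 *: (\sum_b row b (answers A u k that S' w B))
    = minibatch B w k u (tree_x G r gamma u k S').
  by congr (_ *: _); apply: eq_bigr => b _; rewrite answers_row ltn_ord.
have rowE u k (S' : n.-tuple 'M[R]_(4, dim I)) (Y : 'M[R]_(B, dim I)) :
    let x := tree_x G r gamma u k S' in
    let g := B%:R^-1 *: \sum_b row b Y in
    let U := tree_update G r gamma u k that S' Y in
    [/\ row row_x U = x,
        row row_y U = if u == 0%N then g
          else \sum_(j | parent G r j == k) row row_y (tnth S' j)
               + g - row row_g (tnth S' k),
        row row_g U = g
      & row row_out U = if u == that then x else row row_out (tnth S' k)].
  by rewrite /=; split; rewrite /tree_update rowK /row_x /row_y /row_g /row_out inordK.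
rewrite {}/S; elim: t i => [|t IH] i; rewrite /= tnth_mktuple.
- set S' := [tuple _ | _ < n]; set Y := answers _ _ _ _ _ _ _.
  have [-> -> -> ->] := rowE 0%N i S' Y.
  have xE : tree_x G r gamma 0 i S' = start I.
    by rewrite /tree_x /= tnth_mktuple rowK -val_eqE /= inordK.
  rewrite gE xE leqn0 eq_sym; split=> //; case: eqP => [->//|_].
  by rewrite tnth_mktuple rowK -val_eqE /= inordK.
set S' := [tuple _ | _ < n]; set Y := answers _ _ _ _ _ _ _.
have [-> -> -> ->] := rowE t.+1 i S' Y.
have IHx j := let: And4 H _ _ _ := IH j in H.
have IHy j := let: And4 _ H _ _ := IH j in H.
have IHg j := let: And4 _ _ H _ := IH j in H.
have IHo j := let: And4 _ _ _ H := IH j in H.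
have xE : tree_x G r gamma t.+1 i S' = (iter t.+1).1 i.
  rewrite /tree_x /= -!/(states A that w t.+1) !IHx !IHy /iter /=.
  by case: tree_iter.
rewrite gE xE -/(states A that w t.+1) IHg IHo; split=> //.
- under eq_bigr do rewrite IHy.
  by rewrite /iter /=; case: tree_iter.
- rewrite [(that <= t.+1)%N]leq_eqVlt ltnS eq_sym.
  by case: eqP => [->|].
Qed.

Lemma treeRGT_outputE that : (that < T)%N ->
  output A that (states A that w T) = (iter that).1 r.
Proof.
suff out u : (that < u)%N -> output A that (states A that w u) = (iter that).1 r.
  exact: out.
case: u => // t; rewrite ltnS => le_t.
by have [_ _ _ outE] := stateS t that r; rewrite [LHS]outE le_t.
Qed.

End output_of_treeRGT.

End tree_rgt.

Section optimality.
Context {R : realType}.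

(* A method tuned with the gap Df, the smoothness constant L and the noise
   level sigma2 of the instance has uniformly optimal network dependence if it
   belongs to the method class and if, all problem-dependent quantities being
   fixed, its round complexity has an upper bound U that depends on n, Dh, B and
   eps only, is common to all graphs of the class, and has the order of the
   minimax complexity with constants that do not depend on n, Dh, B and eps. *)
Definition uniformly_optimal
    (M : forall n, (1 < n)%N -> forall B : nat, R -> R -> R -> method R n B) :
    Prop :=
  (forall n (hn : (1 < n)%N) (Dh B : nat) (Df L sigma2 : R),
     (1 <= Dh <= n.-1)%N -> (0 < B)%N -> 0 < Df -> 0 < L -> 0 < sigma2 ->
     in_method_class Dh (M n hn B Df L sigma2)) /\
  (forall Df Delta L sigma2 H : R,
     0 < Df <= Delta -> 0 < L -> 0 < sigma2 -> 0 <= H ->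
     exists (U : nat -> nat -> nat -> R -> R) (c C eps0 : R),
     [/\ 0 < c, 0 < C, 0 < eps0 &
     forall n (hn : (1 < n)%N) (Dh B : nat) (eps : R),
       (1 <= Dh <= n.-1)%N -> (0 < B)%N -> 0 < eps <= eps0 ->
       (forall (I : problem R n) (G : rel 'I_n),
          admissible I L sigma2 -> gap I = Df -> grad_energy I = H ->
          graph_class Dh G ->
          (round_complexity (M n hn B Df L sigma2) G I eps
             <= (U n Dh B eps)%:E)%E) /\
       ((c * U n Dh B eps)%:E <= minimax n Dh B Delta L sigma2 eps
          <= (C * U n Dh B eps)%:E)%E]).

End optimality.

(* Main.v *)
Require Import Defs.
From HB Require Import structures.
From mathcomp Require Import all_boot all_order all_algebra.
From mathcomp Require Import all_classical all_reals all_analysis.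
From mathcomp Require Import measurable_realfun.
From mathcomp Require Import zify lra.
Import Defs.

Set Implicit Arguments.
Unset Strict Implicit.
Unset Printing Implicit Defensive.

Import Order.TTheory GRing.Theory Num.Theory.
Import numFieldNormedType.Exports.

Local Open Scope classical_set_scope.
Local Open Scope ring_scope.

(** The upper bounds. In the breadth-first tree, an agent at level h holds the root
    iterate of h rounds ago, and the tracking recursion delivers its gradients to
    the root h rounds after their computation ([unroll_x], [unroll_y]). Tree-RGT is
    thus a delayed recursion of the root alone ([root_step]),
      z(t+1) = z(t) - gamma (V(t) + N(t)),
    where V(t) is the sum of the gradients of f_i at z(t - 2 h_i) over the agents i
    with h_i <= t, and N(t) is the noise of the samples that reach the root in
    round t. A sample has no influence on the root before it arrives; since it can
    be integrated out with the other samples frozen ([freezing],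
    [noise_orthogonal]), the noises are uncorrelated among themselves and with the
    current gradient, and their sum over T rounds has a second moment of order T
    ([noise_sum_le]). V(t) differs from n times the gradient of f at z(t) by the
    displacement of z over at most 2 D rounds, which the cap 1 / (40 n D L) on the
    stepsize makes negligible, and in the first D rounds by gradients that have not
    arrived yet, at a total cost proportional to D H_0. Summing the descent
    inequality gives [grad_sum_le]. The stepsize balances the descent and noise
    terms ([stepsize_balance]), the depth D is at most the diameter, and
    [treeRGT_round_complexity] follows, which is the first claim. When the root
    waits D rounds before it moves, no gradient is missing and H_0 disappears: this
    method bounds the minimax complexity from above ([minimax_le]).

    The lower bound. The objectives are parts of a chain function ([chain]) whose
    gradient reveals the coordinates one after the other ([dchain_reveal]) and is
    large as long as the last coordinate has not been found ([dchain_front]); the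
    parameters leave room for a number of coordinates of order Delta L / eps ^ 2.
    In a first instance every agent has the whole chain, but its oracle sends the
    entry that reveals a new coordinate with probability 1 / Q only, amplified by
    Q, where Q is of order sigma2 / eps ^ 2: with n B queries per round, Q / (n B)
    rounds are needed per coordinate ([active_heads], [prob_heads_lt],
    [sampling_bound]). In a second instance the oracle is exact, but the even and
    the odd links belong to two groups of agents at a distance of at least a third
    of the diameter ([band_class]), so that each coordinate costs as many rounds
    ([active_travel], [communication_bound]). Either group has a fixed fraction of
    the agents, hence no link is amplified by more than a constant. The better of
    the two bounds is of the order of their sum ([minimax_ge]).

    Since both bounds consist of the same powers of n, B, Dh and eps, Tree-RGT is
    uniformly optimal ([treeRGT_uniformly_optimal]). *)

(** * Expectations of real random variables *)

Section expectation.
Context {d} {T : measurableType d} {R : realType} (P : probability T R).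
Implicit Types X Y : T -> R.

Definition ex X : R := Rintegral P setT X.

Definition intb X := P.-integrable setT (EFin \o X).

Lemma intbD X Y : intb X -> intb Y -> intb (fun w => X w + Y w).
Proof. by move=> iX iY; have := integrableD measurableT iX iY. Qed.

Lemma intbZ (k : R) X : intb X -> intb (fun w => k * X w).
Proof. by move=> iX; have := integrableZl measurableT k iX. Qed.

Lemma intb_sum I (s : seq I) (Q : pred I) (X : I -> T -> R) :
  (forall i, Q i -> intb (X i)) -> intb (fun w => \sum_(i <- s | Q i) X i w).
Proof.
move=> iX; have := @integrable_sum _ _ _ P setT measurableT _ s Q _ iX.
apply: eq_integrable => //= w _.
by rewrite sumEFin.
Qed.

Lemma intb_cst (k : R) : intb (fun=> k).
Proof. exact: finite_measure_integrable_cst. Qed.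

Lemma intb_le X Y : measurable_fun setT X -> (forall w, `|X w| <= Y w) ->
  intb Y -> intb X.
Proof.
move=> mX le_XY iY; apply: le_integrable iY => //; first exact/measurable_EFinP.
move=> w _ /=; rewrite lee_fin; exact: le_trans (le_XY w) (ler_norm _).
Qed.

Lemma eq_ex X Y : X =1 Y -> ex X = ex Y.
Proof. by move=> XY; congr ex; apply/funext. Qed.

Lemma exD X Y : intb X -> intb Y -> ex (fun w => X w + Y w) = ex X + ex Y.
Proof. exact: RintegralD. Qed.

Lemma exZ (k : R) X : intb X -> ex (fun w => k * X w) = k * ex X.
Proof. exact: RintegralZl. Qed.

Lemma ex_cst (k : R) : ex (fun=> k) = k.
Proof. by rewrite /ex Rintegral_cst//= probability_setT/= mulr1. Qed.

Lemma ex_sum I (s : seq I) (Q : pred I) (X : I -> T -> R) :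
  (forall i, Q i -> intb (X i)) ->
  ex (fun w => \sum_(i <- s | Q i) X i w) = \sum_(i <- s | Q i) ex (X i).
Proof.
move=> iX; elim: s => [|i s IH].
  rewrite big_nil -[RHS](ex_cst 0); apply: eq_ex => w; by rewrite big_nil.
rewrite big_cons -IH; case: ifPn => Qi.
  rewrite -exD; [|exact: iX|exact: intb_sum].
  by apply: eq_ex => w; rewrite big_cons Qi.
by apply: eq_ex => w; rewrite big_cons (negbTE Qi).
Qed.

Lemma ex_ge0 X : (forall w, 0 <= X w) -> 0 <= ex X.
Proof. by move=> X0; apply: Rintegral_ge0 => w _. Qed.

Lemma ex_le X Y : intb X -> intb Y -> (forall w, X w <= Y w) -> ex X <= ex Y.
Proof. by move=> iX iY XY; apply: le_Rintegral => // w _. Qed.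

Lemma exE X : intb X -> ((ex X)%:E = \int[P]_w (X w)%:E)%E.
Proof.
move=> iX; rewrite /ex /Rintegral fineK//.
exact: integrable_fin_num.
Qed.

Definition sqint X := measurable_fun setT X /\ intb (fun w => X w ^+ 2).

Lemma sqintM X Y : sqint X -> sqint Y -> intb (fun w => X w * Y w).
Proof.
move=> [mX iX] [mY iY]; have := intbD iX iY; apply: intb_le.
  exact: measurable_funM.
by move=> w; rewrite ler_norml; apply/andP; split; nra.
Qed.

Lemma sqint_intb X : sqint X -> intb X.
Proof.
move=> [mX iX]; have := intbD iX (intb_cst 1); apply: intb_le => //.
by move=> w; rewrite ler_norml; apply/andP; split; nra.
Qed.

Lemma sqintD X Y : sqint X -> sqint Y -> sqint (fun w => X w + Y w).
Proof.
move=> hX hY; have [mX iX] := hX; have [mY iY] := hY; split.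
  exact: measurable_funD.
have := intbD (intbD iX iY) (intbZ 2 (sqintM hX hY)).
congr (intb _); apply/funext => w; lra.
Qed.

Lemma sqintZ (k : R) X : sqint X -> sqint (fun w => k * X w).
Proof.
move=> [mX iX]; split; first exact: measurable_funM.
have := intbZ (k ^+ 2) iX; congr (intb _); apply/funext => w.
by rewrite exprMn.
Qed.

Lemma sqint_cst (k : R) : sqint (fun=> k).
Proof. by split => //; exact: intb_cst. Qed.

Lemma sqint_sum I (s : seq I) (Q : pred I) (X : I -> T -> R) :
  (forall i, Q i -> sqint (X i)) -> sqint (fun w => \sum_(i <- s | Q i) X i w).
Proof.
move=> iX; elim: s => [|i s IH].
  rewrite (_ : (fun _ => _) = fun=> 0); first exact: sqint_cst.
  by apply/funext => w; rewrite big_nil.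
case Qi: (Q i).
  have := sqintD (iX _ Qi) IH; congr sqint.
  by apply/funext => w; rewrite big_cons Qi.
by move: IH; congr sqint; apply/funext => w; rewrite big_cons Qi.
Qed.

(** A second moment of at most e^2 bounds the first absolute moment by e: take
    expectations in |x| <= (x^2 / e + e) / 2. *)
Lemma ex_le_of_sq X (e : R) : 0 < e -> (forall w, 0 <= X w) ->
  measurable_fun setT X -> intb (fun w => X w ^+ 2) ->
  intb X /\ ex X <= (ex (fun w => X w ^+ 2) / e + e) / 2.
Proof.
move=> e0 X0 mX iX; have hX : sqint X by [].
split; first exact: sqint_intb.
have i1 := intbZ (2 * e)^-1 iX.
have := ex_le (sqint_intb hX) (intbD i1 (intb_cst (e / 2))).
rewrite exD ?ex_cst//; last exact: intb_cst.
rewrite exZ// => h; apply: (@le_trans _ _ ((2 * e)^-1 * ex (fun w => X w ^+ 2) + e / 2)).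
  apply: h => w.
  rewrite -subr_ge0.
  have -> : (2 * e)^-1 * X w ^+ 2 + e / 2 - X w = (2 * e)^-1 * (X w - e) ^+ 2.
    have ee : (2 * e)^-1 * (2 * e) = 1 by rewrite mulVf// lt0r_neq0// mulr_gt0.
    have -> : (2 * e)^-1 * (X w - e) ^+ 2 = (2 * e)^-1 * X w ^+ 2 -
       ((2 * e)^-1 * (2 * e)) * X w + ((2 * e)^-1 * (2 * e)) * (e / 2) by lra.
    rewrite ee; lra.
  by rewrite mulr_ge0 ?sqr_ge0// invr_ge0; lra.
by rewrite invfM; lra.
Qed.

End expectation.

(** * Integrating out one of several independent variables *)

Section freezing.
Context {d d' : measure_display} {T : measurableType d} {R : realType}.
Variable P : probability T R.
Context {K : eqType} (S : K -> measurableType d').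
Variable X : forall k, {mfun T >-> S k}.

Definition independent_family :=
  forall (J : seq K) (A : forall k, set (S k)), uniq J ->
    (forall k, measurable (A k)) ->
    (P (\bigcap_(k in [set` J]) (X k @^-1` A k)) =
     \prod_(k <- J) P (X k @^-1` A k))%E.

(** The pi-system of the events that depend on finitely many variables other
    than the one of index k0; the space sigma_others k0 is T with the
    sigma-algebra that it generates. *)
Definition others (k0 : K) : set (set T) :=
  [set E | exists (J : seq K) (A : forall k, set (S k)),
    [/\ uniq J, k0 \notin J, forall k, measurable (A k)
      & E = \bigcap_(k in [set` J]) (X k @^-1` A k)]].

Definition sigma_others k0 := g_sigma_algebraType (others k0).

Lemma others_measurable k0 : others k0 `<=` measurable.
Proof.
move=> _ [J [A [_ _ mA ->]]]; apply: fin_bigcap_measurable => // k _.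
exact: measurable_funPTI.
Qed.

Lemma others_setI k0 : setI_closed (others k0).
Proof.
move=> _ _ [J1 [A1 [u1 k1 m1 ->]]] [J2 [A2 [u2 k2 m2 ->]]].
exists (undup (J1 ++ J2)).
exists (fun k => (if k \in J1 then A1 k else setT) `&`
                 (if k \in J2 then A2 k else setT)); split.
- exact: undup_uniq.
- by rewrite mem_undup mem_cat negb_or k1.
- by move=> k; apply: measurableI; case: ifP.
apply/seteqP; split=> w /=.
  move=> [h1 h2] k /=; rewrite mem_undup mem_cat => _; split.
    by case: ifPn => // kJ; exact: h1.
  by case: ifPn => // kJ; exact: h2.
move=> h; split=> k /= kJ.
  by have := h k; rewrite /= mem_undup mem_cat kJ /= => /(_ isT)[].
by have := h k; rewrite /= mem_undup mem_cat kJ /= orbT => /(_ isT)[].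
Qed.

Lemma sigma_others_id k0 :
  measurable_fun setT (idfun : T -> sigma_others k0).
Proof.
move=> _ E mE; rewrite setTI.
exact: (smallest_sub (@sigma_algebra_measurable _ T) (@others_measurable k0)).
Qed.

Lemma sigma_others_measurable_fun d2 (T2 : measurableType d2) k0
    (f : T -> T2) :
  measurable_fun [set: sigma_others k0] f -> measurable_fun [set: T] f.
Proof.
move=> mf _ B mB; rewrite setTI.
apply: (smallest_sub (@sigma_algebra_measurable _ T) (@others_measurable k0)).
by have := mf measurableT B mB; rewrite setTI.
Qed.

Lemma sigma_others_measurable k0 k : k != k0 ->
  measurable_fun [set: sigma_others k0] (X k).
Proof.
move=> kk0 _ B mB; rewrite setTI; apply: sub_sigma_algebra.
exists [:: k], (fun j => if pselect (k = j) is left e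
  then eq_rect k (fun j => set (S j)) B j e else setT); split => //.
- by rewrite inE eq_sym.
- by move=> j; case: pselect => // e; case: j / e.
apply/seteqP; split=> w /=.
  move=> Bw j /=; rewrite inE => /eqP ->.
  by case: pselect => // e; rewrite (Prop_irrelevance e erefl).
move=> /(_ k); rewrite /= inE => /(_ (eqxx _)).
by case: pselect => // e; rewrite (Prop_irrelevance e erefl).
Qed.

Hypothesis indep : independent_family.

(** Both sides are finite measures of E that agree on the pi-system [others k0]. *)
Lemma indep_others k0 (E : set T) (B : set (S k0)) :
  <<s others k0 >> E -> measurable B ->
  (P (E `&` X k0 @^-1` B) = P E * P (X k0 @^-1` B))%E.
Proof.
move=> sE mB.
have mXB : measurable (X k0 @^-1` B).
  exact: measurable_funPTI.
have pfin : P (X k0 @^-1` B) \is a fin_num by exact: fin_num_measure.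
have r0 : 0 <= fine (P (X k0 @^-1` B)) by exact: fine_ge0.
pose m1 : {measure set T -> \bar R} := mrestr P mXB.
pose m2 : {measure set T -> \bar R} := mscale (NngNum r0) P.
suff : m1 E = m2 E by rewrite muleC -[X in (X * _)%E](fineK pfin).
apply: (g_sigma_algebra_measure_unique (others k0) (@others_measurable k0)
  (fun=> setT)) => //.
- move=> _; exists [::], (fun=> setT); split => //.
  by apply/seteqP; split => // w _ k.
- by apply/seteqP; split => // w _; exists 0%N.
- exact: others_setI.
- move=> _ [J [A [uJ kJ mA ->]]].
  suff : P (\bigcap_(k in [set` J]) X k @^-1` A k `&` X k0 @^-1` B) =
      (P (X k0 @^-1` B) * P (\bigcap_(k in [set` J]) X k @^-1` A k))%E.
    by rewrite -[X in (X * _)%E](fineK pfin).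
  (* The events of J, together with the event B of index k0. *)
  pose A' k := if pselect (k0 = k) is left e
    then eq_rect k0 (fun j => set (S j)) B k e else A k.
  have A'k0 : A' k0 = B.
    by rewrite /A'; case: pselect => // e; rewrite (Prop_irrelevance e erefl).
  have A'k k : k \in J -> A' k = A k.
    move=> kJ'; rewrite /A'; case: pselect => // e; exfalso.
    by move: kJ; rewrite e kJ'.
  have mA' k : measurable (A' k).
    rewrite /A'; case: pselect => // e.
    by case: k / e.
  have := indep (J := k0 :: J) (A := A').
  rewrite /= kJ uJ => /(_ isT mA'); rewrite big_cons A'k0.
  rewrite (eq_big_seq (fun k => P (X k @^-1` A k))); last first.
    by move=> k kJ'; rewrite A'k.
  rewrite -indep// => <-; congr (P _); apply/seteqP; split=> w /=.
    move=> [h1 h2] k /=; rewrite inE => /orP[/eqP ->|kJ'].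
      by rewrite A'k0.
    by rewrite A'k//; exact: h1.
  move=> h; split; last by have := h k0; rewrite /= mem_head A'k0; apply.
  move=> k /= kJ'; have := h k; rewrite /= inE kJ' orbT A'k//; exact.
- move=> _; rewrite (_ : m1 setT = P (X k0 @^-1` B)) ?ltey_eq ?pfin//.
  by rewrite /m1 /= /mrestr setTI.
Qed.

(** The variable of index k0 can be integrated out first, the quantities that
    depend on the other variables being frozen. *)
Lemma freezing k0 (phi : sigma_others k0 * S k0 -> \bar R) :
  measurable_fun setT phi -> (forall z, 0 <= phi z)%E ->
  (\int[P]_w phi (w, X k0 w) =
   \int[P]_w \int[distribution P (X k0)]_z phi (w, z))%E.
Proof.
move=> mphi phi0.
pose idm : {mfun T >-> sigma_others k0} := mfun_Sub (mem_set (@sigma_others_id k0)).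
pose P' := distribution P idm.
have mg : measurable_fun setT (fun w : T => ((w : sigma_others k0), X k0 w)).
  apply/measurable_fun_pairP; split.
    exact: sigma_others_id.
  exact: measurable_funPT.
pose g : {mfun T >-> (sigma_others k0 * S k0)%type} := mfun_Sub (mem_set mg).
pose m' := distribution P g.
have m'E : forall Z, measurable Z ->
    ((P' \x distribution P (X k0)) Z = m' Z)%E.
  apply: product_measure_unique => A B mA mB.
  exact: indep_others.
transitivity (\int[m']_z phi z)%E.
  by rewrite ge0_integral_distribution.
transitivity (\int[P' \x distribution P (X k0)]_z phi z)%E.
  by apply: eq_measure_integral => Z mZ _; have := m'E Z mZ.
rewrite fubini_tonelli1//.
rewrite ge0_integral_distribution//.
- exact: measurable_fun_fubini_tonelli_F.
- by move=> w; apply: integral_ge0.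
Qed.

End freezing.

(** * Euclidean geometry and measurability of vectors *)

Section squared_norm.
Context {R : realType}.

Lemma sum_sqr_le I (s : seq I) (a : I -> R) :
  (\sum_(i <- s) a i) ^+ 2 <= (size s)%:R * \sum_(i <- s) a i ^+ 2.
Proof.
elim: s => [|i s IH]; first by rewrite !big_nil expr0n mul0r.
rewrite !big_cons /= -natr1.
have : 0 <= \sum_(j <- s) (a i - a j) ^+ 2 by apply: sumr_ge0 => j _; exact: sqr_ge0.
have -> : \sum_(j <- s) (a i - a j) ^+ 2 = (size s)%:R * a i ^+ 2 -
    2 * a i * \sum_(j <- s) a j + \sum_(j <- s) a j ^+ 2.
  elim: s {IH} => [|j s IH]; first by rewrite !big_nil /=; lra.
  by rewrite !big_cons IH /= -natr1; lra.
nra.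
Qed.

Definition dotp p (u v : 'rV[R]_p) : R := \sum_j u 0 j * v 0 j.

Definition sqn p (v : 'rV[R]_p) : R := \sum_j v 0 j ^+ 2.

Lemma sqn_ge0 p (v : 'rV[R]_p) : 0 <= sqn v.
Proof. by apply: sumr_ge0 => j _; exact: sqr_ge0. Qed.

Lemma enorm_ge0 p (v : 'rV[R]_p) : 0 <= enorm v.
Proof. exact: sqrtr_ge0. Qed.

Lemma enorm_sq p (v : 'rV[R]_p) : enorm v ^+ 2 = sqn v.
Proof. by rewrite sqr_sqrtr// sqn_ge0. Qed.

Lemma dotpDl p (u v w : 'rV[R]_p) : dotp (u + v) w = dotp u w + dotp v w.
Proof. by rewrite /dotp -big_split /=; apply: eq_bigr => j _; rewrite mxE mulrDl. Qed.

Lemma dotpC p (u v : 'rV[R]_p) : dotp u v = dotp v u.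
Proof. by apply: eq_bigr => j _; rewrite mulrC. Qed.

Lemma dotpDr p (u v w : 'rV[R]_p) : dotp u (v + w) = dotp u v + dotp u w.
Proof. by rewrite dotpC dotpDl !(dotpC u). Qed.

Lemma dotpZl p a (u v : 'rV[R]_p) : dotp (a *: u) v = a * dotp u v.
Proof. by rewrite /dotp mulr_sumr; apply: eq_bigr => j _; rewrite mxE mulrA. Qed.

Lemma dotpZr p a (u v : 'rV[R]_p) : dotp u (a *: v) = a * dotp u v.
Proof. by rewrite dotpC dotpZl dotpC. Qed.

Lemma dotp_sumr p I (s : seq I) (Q : pred I) (u : 'rV[R]_p) (v : I -> 'rV[R]_p) :
  dotp u (\sum_(i <- s | Q i) v i) = \sum_(i <- s | Q i) dotp u (v i).
Proof.
elim/big_rec2: _ => [|i a b _ <-]; last by rewrite dotpDr.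
by apply: big1 => j _; rewrite mxE mulr0.
Qed.

Lemma dotpp p (u : 'rV[R]_p) : dotp u u = sqn u.
Proof. by apply: eq_bigr => j _; rewrite expr2. Qed.

Lemma sqnZ p a (v : 'rV[R]_p) : sqn (a *: v) = a ^+ 2 * sqn v.
Proof. by rewrite -!dotpp dotpZl dotpZr; lra. Qed.

Lemma sqnN p (v : 'rV[R]_p) : sqn (- v) = sqn v.
Proof. by rewrite -scaleN1r sqnZ; lra. Qed.

Lemma sqnD p (u v : 'rV[R]_p) : sqn (u + v) = sqn u + 2 * dotp u v + sqn v.
Proof. by rewrite -!dotpp dotpDl !dotpDr (dotpC v u); lra. Qed.

Lemma dotp_le p (u v : 'rV[R]_p) : 2 * dotp u v <= sqn u + sqn v.
Proof.
by have := sqn_ge0 (u - v); rewrite sqnD -scaleN1r dotpZr sqnZ; lra.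
Qed.

Lemma sqnD_le p (u v : 'rV[R]_p) : sqn (u + v) <= 2 * sqn u + 2 * sqn v.
Proof. by have := dotp_le u v; rewrite sqnD; lra. Qed.

Lemma sqn_sum_le p I (s : seq I) (v : I -> 'rV[R]_p) :
  sqn (\sum_(i <- s) v i) <= (size s)%:R * \sum_(i <- s) sqn (v i).
Proof.
rewrite exchange_big /= mulr_sumr; apply: ler_sum => j _.
by rewrite summxE; exact: sum_sqr_le.
Qed.

Lemma coord_le_enorm p (v : 'rV[R]_p) j : `|v 0 j| <= enorm v.
Proof.
rewrite -(ler_pXn2r (n := 2))// ?nnegrE ?enorm_ge0// enorm_sq.
rewrite real_normK ?num_real// /sqn (bigD1 j)//= lerDl.
by apply: sumr_ge0 => i _; exact: sqr_ge0.
Qed.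

Lemma enorm_le p (v : 'rV[R]_p) (e : R) : 0 <= e -> sqn v <= e ^+ 2 -> enorm v <= e.
Proof.
by move=> e0 h; rewrite -(ler_pXn2r (n := 2))// ?nnegrE ?enorm_ge0// enorm_sq.
Qed.

Lemma sqn0 p : sqn (0 : 'rV[R]_p) = 0.
Proof. by apply: big1 => j _; rewrite mxE expr0n. Qed.

End squared_norm.

Section matrix_measurability.
Context {d d' : measure_display} {T : measurableType d} {U : measurableType d'}.

Lemma measurable_entry m n (i : 'I_m) (j : 'I_n) :
  measurable_fun setT (fun A : 'M[U]_(m, n) => A i j).
Proof.
move=> _ B mB; rewrite setTI; apply: sub_sigma_algebra.
by exists (i, j) => //; exists B => //; rewrite setTI.
Qed.

(** The sigma-algebra of matrices is the initial one for the entries. *)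
Lemma measurable_fun_matrixP m n (f : T -> 'M[U]_(m, n)) :
  measurable_fun setT f <-> forall i j, measurable_fun setT (fun w => f w i j).
Proof.
split=> [mf i j|mf].
  exact: (measurableT_comp (measurable_entry i j) mf).
apply: (measurability (\bigcup_(ij in [set: 'I_m * 'I_n])
  preimage_set_system setT (fun A : 'M[U]_(m, n) => A ij.1 ij.2) measurable)) => //.
move=> _ [_ [[i j] _] [B mB <-] <-].
rewrite !setTI; have := mf i j measurableT B mB.
by rewrite setTI.
Qed.

End matrix_measurability.

Section vector_measurability.
Context {d : measure_display} {T : measurableType d} {R : realType}.

Lemma measurable_sqn p (f : T -> 'rV[R]_p) :
  measurable_fun setT f -> measurable_fun setT (fun w => sqn (f w)).
Proof.
move=> /measurable_fun_matrixP mf; apply: measurable_sum => j.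
exact: measurable_funX.
Qed.

Lemma measurable_enorm p (f : T -> 'rV[R]_p) :
  measurable_fun setT f -> measurable_fun setT (fun w => enorm (f w)).
Proof.
move=> mf; have := measurable_sqn mf; rewrite /enorm /sqn => mg.
have ms : measurable_fun setT (@Num.sqrt R).
  apply: continuous_measurable_fun; exact: sqrt_continuous.
exact: (measurableT_comp ms mg).
Qed.

Lemma measurable_mxD m p (f g : T -> 'M[R]_(m, p)) :
  measurable_fun setT f -> measurable_fun setT g ->
  measurable_fun setT (fun w => f w + g w).
Proof.
move=> /measurable_fun_matrixP mf /measurable_fun_matrixP mg.
apply/measurable_fun_matrixP => i j.
under eq_fun do rewrite mxE.
exact: measurable_funD.
Qed.

Lemma measurable_mxZ m p (a : R) (f : T -> 'M[R]_(m, p)) :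
  measurable_fun setT f -> measurable_fun setT (fun w => a *: f w).
Proof.
move=> /measurable_fun_matrixP mf.
apply/measurable_fun_matrixP => i j.
under eq_fun do rewrite mxE.
exact: measurable_funM.
Qed.

Lemma measurable_mxB m p (f g : T -> 'M[R]_(m, p)) :
  measurable_fun setT f -> measurable_fun setT g ->
  measurable_fun setT (fun w => f w - g w).
Proof.
move=> mf mg; apply: measurable_mxD => //.
have := measurable_mxZ (-1) mg.
by under eq_fun do rewrite scaleN1r.
Qed.

Lemma measurable_mx_sum m p I (s : seq I) (Q : pred I) (f : I -> T -> 'M[R]_(m, p)) :
  (forall i, Q i -> measurable_fun setT (f i)) ->
  measurable_fun setT (fun w => \sum_(i <- s | Q i) f i w).
Proof.
move=> mf; elim: s => [|i s IH].
  by under eq_fun do rewrite big_nil; exact: measurable_cst.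
case Qi : (Q i); under eq_fun do rewrite big_cons Qi; last exact: IH.
by apply: measurable_mxD => //; exact: mf.
Qed.

Lemma measurable_row m p (f : T -> 'M[R]_(m, p)) i :
  measurable_fun setT f -> measurable_fun setT (fun w => row i (f w)).
Proof.
move=> /measurable_fun_matrixP mf; apply/measurable_fun_matrixP => k j.
under eq_fun do rewrite mxE.
exact: mf.
Qed.

End vector_measurability.

(** * Noise of the oracle *)

Section oracle_noise.
Context {R : realType} {n : nat} (I : problem R n) (L sigma2 : R).
Hypothesis adm : admissible I L sigma2.
Let p := dim I.
Let P := prob I.
Let index := ('I_n * nat * nat)%type.

Definition sample (k : index) : {mfun omega I >-> smp I k.1.1} :=
  xi I k.1.1 k.1.2 k.2.

Definition agent_grad i (x : 'rV[R]_p) := grad (obj I i) x.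

Definition noise (k : index) (Y : omega I -> 'rV[R]_p) (w : omega I) :=
  oracle I k.1.1 (Y w) (sample k w) - agent_grad k.1.1 (Y w).

(** The space of the outcomes with the sigma-algebra of the samples other than
    the one of index k. *)
Definition without (k : index) := sigma_others sample k.

Let indep : independent_family P sample.
Proof. by case: adm => _ [_ _ _ _ ind]; exact: ind. Qed.

Let moracle i : measurable_fun setT
  (fun z : 'rV[R]_p * smp I i => oracle I i z.1 z.2).
Proof. by case: adm => _ [mo _ _ _ _]; exact: mo. Qed.

Let unb i x j :
  (\int[law I i]_z (oracle I i x z 0 j)%:E = (agent_grad i x 0 j)%:E)%E.
Proof. by case: adm => _ [_ ub _ _ _]; rewrite -ub unlock. Qed.

Lemma oracle_measurable_comp d' (T' : measurableType d') i (Y : T' -> 'rV[R]_p)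
    (Z : T' -> smp I i) :
  measurable_fun setT Y -> measurable_fun setT Z ->
  measurable_fun setT (fun w => oracle I i (Y w) (Z w)).
Proof.
move=> mY mZ.
have h : measurable_fun setT (fun w => (Y w, Z w)) by apply/measurable_fun_pairP.
exact: (measurableT_comp (@moracle i) h).
Qed.

Let moracle_at i x j : measurable_fun setT (fun z => oracle I i x z 0 j).
Proof.
have h := @oracle_measurable_comp _ (smp I i) i (cst x) id
  (measurable_cst x) (@measurable_id _ _ _).
by have /measurable_fun_matrixP := h; apply.
Qed.

(** The gradient is the expectation of the jointly measurable oracle, hence
    measurable by the Fubini-Tonelli theorem. *)
Lemma agent_grad_measurable i : measurable_fun setT (agent_grad i).
Proof.
apply/measurable_fun_matrixP => i0 j; rewrite ord1.
apply/measurable_EFinP.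
pose f (z : 'rV[R]_p * smp I i) := (oracle I i z.1 z.2 0 j)%:E.
have mf : measurable_fun setT f.
  by apply/measurable_EFinP; have /measurable_fun_matrixP := @moracle i; apply.
rewrite (_ : _ \o _ = fun x =>
  (\int[law I i]_z f^\+ (x, z) - \int[law I i]_z f^\- (x, z))%E).
  apply: emeasurable_funB.
    by apply: measurable_fun_fubini_tonelli_F => //; exact: measurable_funepos.
  by apply: measurable_fun_fubini_tonelli_F => //; exact: measurable_funeneg.
apply/funext => x /=; rewrite -unb integralE.
by congr (_ - _)%E; apply: eq_integral => z _; rewrite ?funeposE ?funenegE.
Qed.

Let var_le i x :
  (\int[law I i]_z (sqn (oracle I i x z - agent_grad i x))%:E <= sigma2%:E)%E.
Proof.
case: adm => _ [_ _ va _ _]; apply: le_trans (va i x); rewrite unlock.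
rewrite le_eqVlt; apply/orP; left; apply/eqP; apply: eq_integral => z _.
by rewrite enorm_sq.
Qed.

Let mdiff i x : measurable_fun setT (fun z => oracle I i x z - agent_grad i x).
Proof.
apply: measurable_mxB => //; apply/measurable_fun_matrixP => i0 j.
rewrite ord1; exact: moracle_at.
Qed.

Let diff_sq i x : intb (law I i) (fun z => sqn (oracle I i x z - agent_grad i x)).
Proof.
apply/integrableP; split; first exact/measurable_EFinP/measurable_sqn.
apply: le_lt_trans (_ : (_ <= sigma2%:E)%E) (ltry _).
apply: le_trans (var_le i x); rewrite le_eqVlt; apply/orP; left; apply/eqP.
by apply: eq_integral => z _ /=; rewrite ger0_norm// sqn_ge0.
Qed.

Let diff_sqint i x j :
  sqint (law I i) (fun z => (oracle I i x z - agent_grad i x) 0 j).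
Proof.
have mj : measurable_fun setT (fun z => (oracle I i x z - agent_grad i x) 0 j).
  by have /measurable_fun_matrixP := @mdiff i x; apply.
split => //; apply: intb_le (diff_sq i x); first exact: measurable_funX.
move=> z; rewrite -enorm_sq normrX.
by rewrite lerXn2r ?nnegrE ?enorm_ge0 ?normr_ge0// coord_le_enorm.
Qed.

Let diff_mean i x j : ex (law I i) (fun z => (oracle I i x z - agent_grad i x) 0 j) = 0.
Proof.
have iD := sqint_intb (diff_sqint i x j).
have io : intb (law I i) (fun z => oracle I i x z 0 j).
  have := intbD iD (intb_cst (law I i) (agent_grad i x 0 j)).
  by congr intb; apply/funext => z; rewrite !mxE; lra.
rewrite (@eq_ex _ _ _ _ _ (fun z => oracle I i x z 0 j + - agent_grad i x 0 j)).
  rewrite exD//; last exact: intb_cst.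
  have eo : ex (law I i) (fun z => oracle I i x z 0 j) = agent_grad i x 0 j.
    by apply: EFin_inj; rewrite exE// unb.
  by rewrite ex_cst eo subrr.
by move=> z; rewrite !mxE.
Qed.

Let law_eq k (phi : smp I k.1.1 -> \bar R) :
  (\int[distribution P (sample k)]_z phi z = \int[law I k.1.1]_z phi z)%E.
Proof.
apply: eq_measure_integral => A mA _.
by case: adm => _ [_ _ _ sl _]; have := sl _ k.1.2 k.2 A mA.
Qed.

Section at_random_point.
Variables (k : index) (Y : omega I -> 'rV[R]_p).
Hypothesis mY : measurable_fun [set: without k] Y.

Let D (wz : without k * smp I k.1.1) : 'rV[R]_p :=
  oracle I k.1.1 (Y wz.1) wz.2 - agent_grad k.1.1 (Y wz.1).

Let mD : measurable_fun setT D.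
Proof.
have mY1 : measurable_fun setT (fun wz : without k * smp I k.1.1 => Y wz.1).
  exact: (measurableT_comp mY measurable_fst).
apply: measurable_mxB.
  exact: oracle_measurable_comp mY1 measurable_snd.
exact: (measurableT_comp (@agent_grad_measurable k.1.1) mY1).
Qed.

Let mg : measurable_fun [set: omega I]
  (fun w => ((w : without k), sample k w)).
Proof.
apply/measurable_fun_pairP; split; first exact: sigma_others_id.
exact: measurable_funPT.
Qed.

Let mN : measurable_fun setT (noise k Y).
Proof. exact: (measurableT_comp mD mg). Qed.

Lemma noise_sqn : intb P (fun w => sqn (noise k Y w)) /\
  ex P (fun w => sqn (noise k Y w)) <= sigma2.
Proof.
have le : (\int[P]_w (sqn (noise k Y w))%:E <= sigma2%:E)%E.
  have := freezing indep (k0 := k) (phi := fun wz => (sqn (D wz))%:E).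
  rewrite /noise /= => ->.
  - apply: (@le_trans _ _ (\int[P]_w sigma2%:E)%E).
      apply: ge0_le_integral => //.
      + by move=> w _; apply: integral_ge0 => z _; rewrite lee_fin sqn_ge0.
      + have h : measurable_fun [set: without k] (fun w =>
          (\int[distribution P (sample k)]_z (sqn (D (w, z)))%:E)%E).
          apply: (measurable_fun_fubini_tonelli_F (m2 := distribution P (sample k))
            (fun wz => (sqn (D wz))%:E)).
            apply/measurable_EFinP; exact: (measurable_sqn mD).
          by move=> z; rewrite lee_fin sqn_ge0.
        exact: (sigma_others_measurable_fun h).
      + by move=> w _; rewrite (law_eq (fun z => (sqn (D (w, z)))%:E));
           exact: (var_le k.1.1 (Y w)).
    by rewrite integral_cst//= probability_setT mule1.
  - apply/measurable_EFinP; exact: (measurable_sqn mD).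
  - by move=> z; rewrite lee_fin sqn_ge0.
have i1 : intb P (fun w => sqn (noise k Y w)).
  apply/integrableP; split.
    apply/measurable_EFinP; exact: (measurable_sqn mN).
  apply: le_lt_trans (_ : (_ <= sigma2%:E)%E) (ltry _).
  apply: le_trans le; rewrite le_eqVlt; apply/orP; left; apply/eqP.
  by apply: eq_integral => z _ /=; rewrite ger0_norm// sqn_ge0.
by split => //; rewrite -lee_fin exE.
Qed.

Lemma noise_sqint j : sqint P (fun w => noise k Y w 0 j).
Proof.
have mj : measurable_fun setT (fun w => noise k Y w 0 j).
  by have /measurable_fun_matrixP := mN; apply.
split => //; apply: intb_le noise_sqn.1; first exact: measurable_funX.
move=> w; rewrite -enorm_sq normrX.
by rewrite lerXn2r ?nnegrE ?enorm_ge0 ?normr_ge0// coord_le_enorm.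
Qed.

(** The noise of a sample has mean zero whatever the other samples are. *)
Lemma noise_orthogonal j (Z : omega I -> R) :
  measurable_fun [set: without k] Z -> sqint P Z ->
  ex P (fun w => noise k Y w 0 j * Z w) = 0.
Proof.
move=> mZ sZ.
pose phi (wz : without k * smp I k.1.1) := (D wz 0 j * Z wz.1)%:E.
have mphi : measurable_fun setT phi.
  apply/measurable_EFinP; apply: measurable_funM.
    by have /measurable_fun_matrixP := mD; apply.
  exact: (measurableT_comp mZ measurable_fst).
have ii : intb P (fun w => noise k Y w 0 j * Z w) by exact: sqintM (noise_sqint j) sZ.
apply: EFin_inj; rewrite exE//.
rewrite integralE.
suff -> : (\int[P]_w ((fun w => (noise k Y w 0 j * Z w)%:E)^\+ w) =
   \int[P]_w ((fun w => (noise k Y w 0 j * Z w)%:E)^\- w))%E.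
  rewrite subee//; apply: integrable_fin_num => //.
  exact: integrable_funeneg.
have e1 := freezing indep (phi := (phi^\+)%E) (measurable_funepos mphi) (fun z => funepos_ge0 phi z).
have e2 := freezing indep (phi := (phi^\-)%E) (measurable_funeneg mphi) (fun z => funeneg_ge0 phi z).
transitivity (\int[P]_w phi^\+ (w, sample k w))%E.
  by apply: eq_integral => w _; rewrite !funeposE.
rewrite e1; transitivity (\int[P]_w phi^\- (w, sample k w))%E; last first.
  by apply: eq_integral => w _; rewrite !funenegE.
rewrite e2; apply: eq_integral => w _; rewrite !law_eq.
pose h z := ((oracle I k.1.1 (Y w) z - agent_grad k.1.1 (Y w)) 0 j * Z w).
have ih : intb (law I k.1.1) h.
  have := intbZ (Z w) (sqint_intb (diff_sqint k.1.1 (Y w) j)).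
  by congr intb; apply/funext => z; rewrite /h mulrC.
have eh : ex (law I k.1.1) h = 0.
  rewrite (@eq_ex _ _ _ _ _ (fun z => Z w * (oracle I k.1.1 (Y w) z - agent_grad k.1.1 (Y w)) 0 j)).
    by rewrite exZ ?diff_mean ?mulr0//; exact: sqint_intb (diff_sqint _ _ _).
  by move=> z; rewrite /h mulrC.
have : (\int[law I k.1.1]_z (h z)%:E = 0)%E by rewrite -exE// eh.
rewrite integralE => /eqP; rewrite sube_eq ?add0e.
- move=> /eqP e.
  transitivity (\int[law I k.1.1]_z ((fun z => (h z)%:E)^\+ z))%E.
    by apply: eq_integral => z _; rewrite !funeposE.
  by rewrite e; apply: eq_integral => z _; rewrite !funenegE.
- by apply: integrable_fin_num => //; exact: integrable_funepos.
- exact: fin_num_adde_defr.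
Qed.

End at_random_point.

(** A sample can influence neither the noise of another sample nor the answer to
    it except through the point of the query. *)
Lemma noise_measurable_without k k' Y : k != k' ->
  measurable_fun [set: without k'] Y -> measurable_fun [set: without k'] (noise k Y).
Proof.
move=> kk' mY.
apply: measurable_mxB.
  apply: oracle_measurable_comp => //; exact: sigma_others_measurable.
exact: (measurableT_comp (@agent_grad_measurable k.1.1) mY).
Qed.

Lemma oracle_measurable_without k k' Y : k != k' ->
  measurable_fun [set: without k'] Y ->
  measurable_fun [set: without k'] (fun w => oracle I k.1.1 (Y w) (sample k w)).
Proof.
move=> kk' mY.
apply: oracle_measurable_comp => //; exact: sigma_others_measurable.
Qed.

End oracle_noise.

(** * Descent for smooth objectives *)

Section descent.
Context {R : realType}.

Lemma derive_dotp p (f : 'rV[R]_p -> R) (x v : 'rV[R]_p) :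
  differentiable f x -> 'D_v f x = dotp (grad f x) v.
Proof.
move=> df; rewrite deriveE// {1}(row_sum_delta v) linear_sum /=.
apply: eq_bigr => j _; rewrite linearZ /= mxE deriveE//.
by rewrite mulrC.
Qed.

Lemma mean_value_grad p (f : 'rV[R]_p -> R) (x v : 'rV[R]_p) :
  (forall y, differentiable f y) ->
  exists2 c : R, 0 < c < 1 & f (x + v) - f x = dotp (grad f (x + c *: v)) v.
Proof.
move=> df; pose phi (t : R) := f (x + t *: v).
have dphi (t : R) : is_derive t (1 : R) phi (dotp (grad f (x + t *: v)) v).
  have [/= h1 h2] : derivable f (x + t *: v) v /\ 'D_v f (x + t *: v) = dotp (grad f (x + t *: v)) v.
    by split; [exact: diff_derivable|exact: derive_dotp].
  have e : (fun h : R => h^-1 *: ((phi \o shift t) (h *: 1) - phi t)) =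
      (fun h : R => h^-1 *: ((f \o shift (x + t *: v)) (h *: v) - f (x + t *: v))).
    apply/funext => h; rewrite /phi /=; congr (_ *: (f _ - _)).
    by rewrite scalerDl addrCA [h *: 1]mulr1.
  split; first by rewrite /derivable e.
  by rewrite -h2 /derive e.
have cphi : {within `[0, 1], continuous phi}.
  apply: continuous_subspaceT => t.
  by apply: differentiable_continuous; apply/derivable1_diffP; have [] := dphi t.
have [c] := MVT (f := phi) ltr01 (fun t _ => dphi t) cphi.
rewrite in_itv /= => c01; rewrite subr0 mulr1 /phi scale1r scale0r addr0 => e.
by exists c.
Qed.

(** An L-smooth function lies below a parabola of curvature 2 L, by the mean
    value theorem. *)
Lemma descent_bound p (f : 'rV[R]_p -> R) (L : R) (x v : 'rV[R]_p) : 0 < L ->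
  (forall y, differentiable f y) ->
  (forall y z, enorm (grad f y - grad f z) <= L * enorm (y - z)) ->
  f (x + v) <= f x + dotp (grad f x) v + L * sqn v.
Proof.
move=> L0 df lip; have [c /andP[c0 c1] e] := mean_value_grad x v df.
pose u := grad f (x + c *: v) - grad f x.
have su : sqn u <= L ^+ 2 * sqn v.
  rewrite -!enorm_sq -exprMn lerXn2r ?nnegrE ?enorm_ge0 ?mulr_ge0 ?enorm_ge0 ?(ltW L0)//.
  apply: le_trans (lip _ _) _; rewrite ler_pM2l// addrC addKr.
  apply: enorm_le (enorm_ge0 _) _; rewrite sqnZ enorm_sq.
  by rewrite ler_piMl ?sqn_ge0//; nra.
have := dotp_le (L^-1 *: u) v; rewrite dotpZl sqnZ => h.
have h1 : L^-1 ^+ 2 * sqn u <= sqn v.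
  rewrite -(ler_pM2l (x := L ^+ 2)) ?exprn_gt0// mulrA -exprMn divff ?lt0r_neq0//.
  by rewrite expr1n mul1r.
have h2 : L^-1 * dotp u v <= sqn v by lra.
have h3 : dotp u v <= L * sqn v.
  by rewrite -(ler_pM2l (x := L^-1)) ?invr_gt0// mulrA mulVf ?mul1r ?lt0r_neq0.
have -> : f (x + v) = f x + dotp (grad f (x + c *: v)) v by rewrite -e; lra.
have -> : grad f (x + c *: v) = grad f x + u by rewrite /u [in RHS]addrC subrK.
rewrite dotpDl; lra.
Qed.

End descent.

Section average_objective.
Context {R : realType} {n : nat} (I : problem R n) (L : R).
Hypothesis n0 : (0 < n)%N.
Hypothesis L0 : 0 < L.
Hypothesis smI : smooth I L.

Let nR : 0 < n%:R :> R. Proof. by rewrite ltr0n. Qed.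

Let dobj i x : differentiable (obj I i) x.
Proof. by have [h _ _] := smI i. Qed.

Lemma agent_grad_lip i x y :
  sqn (agent_grad i x - agent_grad i y : 'rV[R]_(dim I)) <= L ^+ 2 * sqn (x - y).
Proof.
have [_ _ h] := smI i; rewrite -!enorm_sq -exprMn.
by rewrite lerXn2r ?nnegrE ?mulr_ge0 ?enorm_ge0 ?(ltW L0)//; exact: h.
Qed.

Lemma grad_avg x :
  grad (avg_obj I) x = n%:R^-1 *: \sum_i agent_grad i x :> 'rV[R]_(dim I).
Proof.
apply/rowP => j; rewrite !mxE summxE.
have -> : avg_obj I = n%:R^-1 *: (\sum_i obj I i).
  by apply/funext => y; rewrite /avg_obj fct_sumE.
rewrite deriveZ; last first.
  by apply: derivable_sum => i; exact: diff_derivable.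
rewrite derive_sum; last by move=> i; exact: diff_derivable.
by congr (_ *: _); apply: eq_bigr => i _; rewrite mxE.
Qed.

Lemma avg_descent x v :
  avg_obj I (x + v) <= avg_obj I x + dotp (grad (avg_obj I) x) v + L * sqn v.
Proof.
have h : \sum_i obj I i (x + v) <=
    \sum_i (obj I i x + dotp (agent_grad i x) v + L * sqn v).
  by apply: ler_sum => i _; apply: descent_bound => //; have [_ _ h] := smI i.
rewrite -(ler_pM2l (x := n%:R^-1)) ?invr_gt0// in h.
apply: le_trans h _.
rewrite !big_split /= sumr_const card_ord !mulrDr grad_avg dotpZl.
have -> : n%:R^-1 * (L * sqn v *+ n) = L * sqn v.
  by rewrite -[X in _ * X]mulr_natl mulKf// lt0r_neq0.
rewrite [dotp _ v]dotpC dotp_sumr.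
by rewrite lerD2r lerD2l; rewrite (eq_bigr (fun i => dotp v (agent_grad i x))) // => i _; rewrite dotpC.
Qed.

Hypothesis lbI : has_lbound (range (avg_obj I)).

Lemma avg_ge_inf x : inf (range (avg_obj I)) <= avg_obj I x.
Proof. by apply: ge_inf => //; exists x. Qed.

(** A gradient step of length 1 / (2 L) would decrease the objective by
    |grad| ^ 2 / (4 L), which cannot exceed the gap. *)
Lemma grad_start_le : sqn (grad (avg_obj I) (start I)) <= 4 * L * gap I.
Proof.
pose G := grad (avg_obj I) (start I).
have := avg_descent (start I) (- (2 * L)^-1 *: G).
have := avg_ge_inf (start I + - (2 * L)^-1 *: G).
rewrite dotpZr dotpp sqnZ -/G /gap => h1 h2.
have e : L * ((- (2 * L)^-1) ^+ 2 * sqn G) = (4 * L)^-1 * sqn G.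
  rewrite mulrA; congr (_ * _).
  have LL : L * L^-1 = 1 by rewrite divff// lt0r_neq0.
  rewrite !invfM; transitivity (4^-1 * L^-1 * (L * L^-1)); last by rewrite LL mulr1.
  lra.
have e2 : (2 * L)^-1 = 2 * (4 * L)^-1 by rewrite !invfM; lra.
have e3 : - (2 * L)^-1 * sqn G = - 2 * ((4 * L)^-1 * sqn G) by rewrite e2; lra.
rewrite e e3 in h2.
have : (4 * L)^-1 * sqn G <= gap I by rewrite /gap; lra.
by rewrite mulrC ler_pdivrMr ?mulr_gt0// mulrC.
Qed.

End average_objective.

(** * The breadth-first tree and the unrolled recursion *)

Section breadth_first_tree.
Context {n : nat} (G : rel 'I_n) (r : 'I_n).

Lemma bfs_mono l l' j v : (l <= l')%N -> bfs G r l j = Some v -> bfs G r l' j = Some v.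
Proof.
move=> /subnK <-; elim: (l' - l)%N => [//|k IH] h.
by rewrite addSn /= IH.
Qed.

Lemma bfs_root l : bfs G r l r = Some (0%N, r).
Proof. by apply: (@bfs_mono 0) => //=; rewrite eqxx. Qed.

Lemma bfsP l j m q : bfs G r l j = Some (m, q) ->
  [/\ (m <= l)%N, bfs G r m j = Some (m, q) &
      if m is k.+1 then [/\ j != r, G q j & omap fst (bfs G r k q) = Some k]
      else j = r /\ q = r].
Proof.
elim: l m q => [|l IH] m q.
  by rewrite /=; case: eqP => // -> [<- <-]; split; rewrite //= eqxx.
move=> /[dup] e; rewrite /=; case E : (bfs G r l j) => [[m' q']|].
  by move=> [<- <-]; have [h1 h2 h3] := IH _ _ E; split => //; exact: leqW.
case F : [seq _ <- _ | _] => [//|i s] [? ?]; subst m q; split => //.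
have : i \in [seq i <- enum 'I_n | (omap fst (bfs G r l i) == Some l) && G i j].
  by rewrite F mem_head.
rewrite mem_filter => /andP[/andP[/eqP h1 h2] _]; split => //.
by apply/eqP => jr; move: E; rewrite jr bfs_root.
Qed.

Lemma bfs_discovers s : path G r s -> exists m q,
  (m <= size s)%N /\ bfs G r (size s) (last r s) = Some (m, q).
Proof.
elim/last_ind: s => [_|s j IH].
  by exists 0%N, r; rewrite bfs_root.
rewrite rcons_path last_rcons size_rcons => /andP[/IH[m [q [ms E]]] Gj].
case Ej : (bfs G r (size s).+1 j) => [[m' q']|].
  by exists m', q'; split => //; have [] := bfsP Ej.
exfalso; have [_ Em _] := bfsP E.
suff : bfs G r m.+1 j <> None.
  case Ek : (bfs G r m.+1 j) => [v|] // _.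
  by have := bfs_mono (l' := (size s).+1) (ms : (m.+1 <= (size s).+1)%N) Ek; rewrite Ej.
rewrite /=; case: (bfs G r m j) => [//|].
case F : [seq _ <- _ | _] => [|//].
have : last r s \in [seq i <- enum 'I_n | (omap fst (bfs G r m i) == Some m) && G i j].
  by rewrite mem_filter Em /= eqxx Gj mem_enum.
by rewrite F.
Qed.

Lemma gdist_walk i j : connect G i j ->
  (gdist G i j < n)%N /\
  exists s, [/\ path G i s, last i s = j & size s = gdist G i j].
Proof.
move=> /connectP[s0 ps0 lj].
have [s ps [ls us _]] : exists2 s, path G i s & [/\ last i s = j, uniq (i :: s) & True].
  by case: (shortenP ps0) lj => s ps us _ ->; exists s.
have szn : (size s < n)%N by have := max_card (ssrbool.mem (i :: s)); rewrite (card_uniqP us) card_ord.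
set a := (fun k => [exists s : k.-tuple 'I_n, path G i s && (last i s == j)]).
have ha : has a (iota 0 n).
  apply/hasP; exists (size s); first by rewrite mem_iota.
  by apply/existsP; exists (in_tuple s); rewrite ps ls eqxx.
have lt : (gdist G i j < n)%N by have := ha; rewrite has_find size_iota.
split => //; have := nth_find 0%N ha; rewrite nth_iota//.
rewrite add0n => /existsP[t /andP[pt /eqP lt']].
by exists t; split => //; rewrite size_tuple.
Qed.

Variable Dh : nat.
Hypothesis GG : graph_class Dh G.

Lemma gdist_le i j : (gdist G i j <= Dh)%N.
Proof.
case: GG => _ _ _ <-; apply: leq_trans (leq_bigmax_cond (F := fun i => \max_j gdist G i j) i isT).
exact: (leq_bigmax_cond (F := fun j => gdist G i j) j isT).
Qed.

Lemma bfs_level j : exists m q,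
  [/\ bfs G r n.-1 j = Some (m, q), level G r j = m, parent G r j = q & (m <= Dh)%N].
Proof.
have [|lt [s [ps ls ss]]] := @gdist_walk r j; first by case: GG.
have [m [q [ms E]]] := bfs_discovers ps.
have E' : bfs G r n.-1 j = Some (m, q).
  apply: bfs_mono (_ : bfs G r (size s) j = _); last by rewrite -ls.
  by rewrite ss; lia.
exists m, q; split => //.
- by rewrite /level E'.
- by rewrite /parent E'.
- by apply: leq_trans ms _; rewrite ss gdist_le.
Qed.

Lemma level_root : level G r r = 0%N.
Proof. by rewrite /level bfs_root. Qed.

Lemma parent_root : parent G r r = r.
Proof. by rewrite /parent bfs_root. Qed.

Lemma level_parent j : j != r -> level G r j = (level G r (parent G r j)).+1.
Proof.
move=> jr; have [m [q [E -> -> _]]] := bfs_level j.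
have [le _] := bfsP E; case: m E le => [|k] E le; first by move=> [/eqP]; rewrite (negbTE jr).
move=> [_ _]; case Ek : (bfs G r k q) => [[k' q']|]//= [kk]; subst k'.
by rewrite /level (bfs_mono (ltnW le) Ek).
Qed.

Lemma parent_edge j : j != r -> G (parent G r j) j.
Proof.
move=> jr; have [m [q [E _ -> _]]] := bfs_level j.
have [_ _] := bfsP E; case: m E => [|k] E; first by move=> [/eqP]; rewrite (negbTE jr).
by move=> [_].
Qed.

Lemma level_le_depth j : (level G r j <= tree_depth G r)%N.
Proof. exact: (leq_bigmax_cond (F := level G r) j isT). Qed.

Lemma depth_le : (tree_depth G r <= Dh)%N.
Proof. by apply/bigmax_leqP => j _; have [m [q [_ -> _]]] := bfs_level j. Qed.

Lemma depth_gt0 : (1 < n)%N -> (0 < tree_depth G r)%N.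
Proof.
move=> n1; have [j jr] : exists j, j != r.
  exists (if r == Ordinal (ltnW n1) then Ordinal n1 else Ordinal (ltnW n1)).
  by case: ifPn => [/eqP ->//|]; rewrite eq_sym.
by apply: leq_trans (level_le_depth j); rewrite level_parent.
Qed.

(** The tree recursion is a delayed recursion of the root: an agent at level h
    holds the root iterate of h rounds ago, and the root sums the gradients
    that the agents computed as many rounds ago as their level.  The second
    fact is proved level by level: the sum of the trackers y over a level is the
    increment of the sum of the gradients in transit to that level. *)
Section unrolling.
Context {V : zmodType}.
Variables (x y g : nat -> 'I_n -> V) (d : nat -> V) (x0 : V).
Hypothesis x_0 : forall i, x 0 i = x0.
Hypothesis y_0 : forall i, y 0 i = g 0 i.
Hypothesis x_S : forall t i, x t.+1 i = if i == r then d t else x t (parent G r i).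
Hypothesis y_S : forall t i,
  y t.+1 i = \sum_(j | parent G r j == i) y t j + g t.+1 i - g t i.
Let h := level G r.

Lemma unroll_x t i : x t i = x (t - h i) r.
Proof.
elim: t i => [|t IH] i; first by rewrite sub0n !x_0.
have [->|ir] := eqVneq i r; first by rewrite /h level_root subn0.
by rewrite x_S (negbTE ir) IH /h (level_parent ir) subSS.
Qed.

Let lev (f : nat -> 'I_n -> V) l t := \sum_(i | h i == l) f t i.

(* The gradients that have reached level l by round t: those of level h i need
   h i - l rounds. *)
Let A l t := \sum_(i | (l <= h i <= l + t)%N) g (t + l - h i) i.

Let A0 l : A l 0 = lev g l 0.
Proof.
apply: eq_big => [i|i]; first by rewrite addn0 eq_sym eqn_leq.
by rewrite addn0 -eqn_leq => /eqP ->; rewrite add0n subnn.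
Qed.

Let AS l t : A l t.+1 = lev g l t.+1 + A l.+1 t.
Proof.
rewrite /A (bigID (fun i => h i == l)) /=; congr (_ + _).
  apply: eq_big => [i|i /andP[_ /eqP ->]]; last by rewrite addnK.
  by apply/andP/idP => [[]//|/eqP ->]; rewrite leqnn leq_addr eqxx.
apply: eq_big => [i|i _]; last by rewrite addSnnS.
by lia.
Qed.

Let root_level j : (h j == 0%N) = (j == r).
Proof.
have [->|jr] := eqVneq j r; first by rewrite /h level_root.
by rewrite /h level_parent.
Qed.

Let levy_S l t : lev y l.+1 t.+1 = lev y l.+2 t + lev g l.+1 t.+1 - lev g l.+1 t.
Proof.
rewrite {1}/lev (eq_bigr _ (fun i _ => y_S t i)) big_split sumrN big_split /=.
congr (_ + _ - _).
rewrite (exchange_big_dep predT)//= /lev [RHS]big_mkcond /=.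
apply: eq_bigr => j _.
have -> : (h j == l.+2) = (h (parent G r j) == l.+1).
  have [->|jr] := eqVneq j r; first by rewrite parent_root /h level_root.
  by rewrite /h (level_parent jr) eqSS.
rewrite (eq_bigl (fun i => (h (parent G r j) == l.+1) && (i == parent G r j))).
  by case: ifP => hp /=; [rewrite big_pred1_eq|rewrite big_pred0_eq].
move=> i; rewrite [parent G r j == i]eq_sym.
by case: (eqVneq i (parent G r j)) => [->|]; rewrite ?andbT ?andbF.
Qed.

Let levy_0S t : lev y 0 t.+1 = lev y 0 t + lev y 1 t + lev g 0 t.+1 - lev g 0 t.
Proof.
have l0 f u : lev f 0 u = f u r.
  by rewrite /lev (big_pred1 r)// => i; rewrite root_level.
rewrite !l0 y_S; congr (_ + _ - _).
rewrite (bigD1 r) /=; last by rewrite parent_root.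
congr (_ + _); rewrite /lev; apply: eq_bigl => j.
have [->|jr] := eqVneq j r; first by rewrite andbF /h level_root.
by rewrite andbT /h (level_parent jr) eqSS -/h root_level.
Qed.

Lemma unroll_y t : y t r = \sum_(i | (h i <= t)%N) g (t - h i) i.
Proof.
have key u : (forall l, lev y l.+1 u = A l.+1 u - (if u is v.+1 then A l.+1 v else 0)) /\
    lev y 0 u = A 0 u.
  elim: u => [|u [IH1 IH2]].
    by split=> [l|]; rewrite A0 ?subr0; apply: eq_bigr => i _; rewrite y_0.
  split=> [l|].
    rewrite levy_S IH1 AS; case: u {IH1 IH2} => [|u].
      by rewrite subr0 (A0 l.+1) [X in X - _ = _]addrC.
    rewrite [A l.+1 u.+1]AS opprD (addrC (lev g l.+1 u.+2)).
    by rewrite [X in X - _ = _]addrAC [in RHS]addrA [in RHS]addrAC.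
  rewrite levy_0S IH1 IH2 AS; case: u {IH1 IH2} => [|u].
    by rewrite subr0 A0 addrAC (addrC (lev g 0 0)) addrK addrC.
  rewrite [A 0%N u.+1]AS (addrC (A 1%N u.+1)) addrA addrK.
  by rewrite addrAC (addrC (lev g 0 u.+1)) addrK addrC.
have [_] := key t; rewrite {1}/lev (big_pred1 r); last by move=> i; rewrite root_level.
by move=> ->; apply: eq_big => // i _; rewrite addn0.
Qed.

End unrolling.
End breadth_first_tree.

(** * The tree algorithm with variable steps as a protocol *)

Section variable_step_tree.
Context {R : realType}.

Section recursion.
Context {n : nat} (I : problem R n) (G : rel 'I_n) (r : 'I_n) (B : nat).
Variables (gam : nat -> R) (w : omega I).

Fixpoint vtree_iter (t : nat) :
    ('I_n -> 'rV[R]_(dim I)) * ('I_n -> 'rV[R]_(dim I)) :=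
  match t with
  | 0 => (fun=> start I, fun i => minibatch B w i 0 (start I))
  | u.+1 =>
      let (x, y) := vtree_iter u in
      let x' i := if i == r then x r - gam u *: y r else x (parent G r i) in
      (x', fun i => \sum_(j | parent G r j == i) y j
                    + minibatch B w i u.+1 (x' i) - minibatch B w i u (x i))
  end.

Definition root_iter t := (vtree_iter t).1 r.

Variable Dh : nat.
Hypothesis GG : graph_class Dh G.
Let h := level G r.

Lemma vtree_iter_x t i : (vtree_iter t).1 i = root_iter (t - h i).
Proof.
apply: (unroll_x GG (x := fun t => (vtree_iter t).1)
  (d := fun t => (vtree_iter t).1 r - gam t *: (vtree_iter t).2 r) (x0 := start I)) => //.
by move=> u j /=; case: (vtree_iter u).
Qed.

Lemma root_iterS t : root_iter t.+1 = root_iter t - gam t *: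
  \sum_(i | (h i <= t)%N) minibatch B w i (t - h i) (root_iter (t - h i - h i)).
Proof.
have -> : root_iter t.+1 = (vtree_iter t).1 r - gam t *: (vtree_iter t).2 r.
  by rewrite /root_iter /=; case: (vtree_iter t) => a b /=; rewrite eqxx.
congr (_ - _ *: _).
rewrite (unroll_y GG (y := fun t => (vtree_iter t).2)
  (g := fun t i => minibatch B w i t ((vtree_iter t).1 i))) //.
- by apply: eq_bigr => i _; rewrite vtree_iter_x.
- by move=> u j /=; case: (vtree_iter u).
Qed.

End recursion.

Section protocol_of_tree.
Context {n : nat} (G : rel 'I_n) (r : 'I_n) (B : nat).
Variable gam : nat -> R.

(** Tree-RGT with a step size that depends on the round; the state after round t
    involves the step of round t - 1. *)
Definition vtree_protocol (p T : nat) : protocol R n p B :=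
  @Protocol R n p B _ nat (uniform_below T) 3
    (fun t i _ _ S _ => tree_x G r (gam t.-1) t i S)
    (fun t => tree_update G r (gam t.-1) t)
    (fun _ S => row row_out (tnth S r)).

Section states.
Variables (I : problem R n) (T : nat) (w : omega I).
Let A := vtree_protocol (dim I) T.
Let it := vtree_iter G r B gam w.

Let answers_sum t i that (S : n.-tuple 'M[R]_(4, dim I)) :
  B%:R^-1 *: (\sum_b row b (answers A t i that S w B)) =
  minibatch B w i t (tree_x G r (gam t.-1) t i S).
Proof.
have rowE k (b : 'I_B) : row b (answers A t i that S w k) =
    if (b < k)%N then oracle I i (tree_x G r (gam t.-1) t i S) (xi I i t b w) else 0.
  elim: k => [|k IH]; first by rewrite /= row0.
  by rewrite /= rowK ltnS leq_eqVlt; case: eqP => //= _; exact: IH.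
by congr (_ *: _); apply: eq_bigr => b _; rewrite rowE ltn_ord.
Qed.

Let update_rows t i that (S : n.-tuple 'M[R]_(4, dim I)) (Y : 'M[R]_(B, dim I)) :
  let g := B%:R^-1 *: \sum_b row b Y in
  let U := tree_update G r (gam t.-1) t i that S Y in
  [/\ row row_x U = tree_x G r (gam t.-1) t i S,
      row row_y U = if t == 0%N then g
        else \sum_(j | parent G r j == i) row row_y (tnth S j)
             + g - row row_g (tnth S i),
      row row_g U = g
    & row row_out U =
        if t == that then tree_x G r (gam t.-1) t i S else row row_out (tnth S i)].
Proof.
by split; rewrite /tree_update rowK /row_x /row_y /row_g /row_out inordK.
Qed.

Lemma vtree_states t that i (S := tnth (states A that w t.+1) i) :
  [/\ row row_x S = (it t).1 i, row row_y S = (it t).2 i,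
      row row_g S = minibatch B w i t ((it t).1 i)
    & row row_out S = if (that <= t)%N then (it that).1 i else 0].
Proof.
rewrite {}/S; elim: t i => [|t IH] i; rewrite [states _ _ _ _.+1]/= tnth_mktuple.
  have [-> -> -> ->] := update_rows 0%N i that (states A that w 0)
    (answers A 0 i that (states A that w 0) w B).
  have x0 : tree_x G r (gam 0) 0 i (states A that w 0) = start I.
    by rewrite /tree_x /= tnth_mktuple rowK -val_eqE /= inordK.
  rewrite answers_sum x0 leqn0 eq_sym; split => //; case: eqP => [->//|_].
  by rewrite /= tnth_mktuple rowK -val_eqE /= inordK.
have [-> -> -> ->] := update_rows t.+1 i that (states A that w t.+1)
    (answers A t.+1 i that (states A that w t.+1) w B).
have xE : tree_x G r (gam t) t.+1 i (states A that w t.+1) = (it t.+1).1 i.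
  rewrite /tree_x eqn0Ngt ltn0Sn /=.
  have [-> -> _ _] := IH r; have [-> _ _ _] := IH (parent G r i).
  by rewrite /it /=; case: vtree_iter.
rewrite answers_sum xE; have [_ _ -> ->] := IH i; split => //.
  under eq_bigr => j _ do (have [_ -> _ _] := IH j).
  by rewrite /it /=; case: vtree_iter.
by rewrite [(that <= t.+1)%N]leq_eqVlt ltnS eq_sym; case: eqP => [->|].
Qed.

Lemma vtree_output that : output A that (states A that w T) =
  if (that < T)%N then root_iter G r B gam w that else 0.
Proof.
rewrite [LHS]/=; suff H u : row row_out (tnth (states A that w u) r) =
    if (that < u)%N then root_iter G r B gam w that else 0 by exact: H.
case: u => [|u]; last by rewrite ltnS; have [_ _ _ ->] := vtree_states u that r.
by rewrite ltn0 /= tnth_mktuple rowK -val_eqE /= inordK.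
Qed.

End states.

Section in_class.
Variables (Dh p T : nat).
Hypothesis GG : graph_class Dh G.
Let A := vtree_protocol p T.

Let parent_nbhd i : (parent G r i == i) || G i (parent G r i).
Proof.
have [->|ir] := eqVneq i r; first by rewrite parent_root eqxx.
by case: GG => sG _ _ _; rewrite sG (parent_edge GG)// orbT.
Qed.

Let child_nbhd i j : parent G r j == i -> (j == i) || G i j.
Proof.
move=> /eqP <-; have [->|jr] := eqVneq j r; first by rewrite parent_root eqxx.
by rewrite (parent_edge GG)// orbT.
Qed.

Lemma vtree_one_hop : one_hop G A.
Proof.
move=> t i s S S' Y SS'.
have xE : tree_x G r (gam t.-1) t i S = tree_x G r (gam t.-1) t i S'.
  rewrite /tree_x; case: ifP => _; first by rewrite SS' ?eqxx.
  case: eqP => [<-|_]; first by rewrite SS' ?eqxx.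
  by rewrite SS'// parent_nbhd.
split => //=; rewrite /tree_update xE SS' ?eqxx//.
rewrite (eq_bigr (fun j => row row_y (tnth S' j)))// => j ji.
by rewrite SS'// child_nbhd.
Qed.

(** All the operations of the protocol are linear, so that a coordinate that
    vanishes in the neighbourhood and in the answers vanishes in the result. *)
Lemma vtree_zero_respecting : zero_respecting G A.
Proof.
have inact m (S : n.-tuple 'M[R]_(m, p)) i c : ~~ nbhd_active G S i c ->
    forall j k, (j == i) || G i j -> tnth S j k c = 0.
  rewrite negb_exists => /forallP H j k ji.
  have := H j; rewrite ji /= negb_exists => /forallP/(_ k).
  by rewrite negbK => /eqP.
have x0 t i (S : n.-tuple 'M[R]_(4, p)) c : ~~ nbhd_active G S i c ->
    tree_x G r (gam t.-1) t i S 0 c = 0.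
  move=> /inact H; rewrite /tree_x; case: ifP => _; first by rewrite mxE H ?eqxx.
  case: eqP => [e|_]; last by rewrite mxE H// parent_nbhd.
  by rewrite !mxE -e !H ?eqxx// mulr0 subr0.
split.
- by move=> t i b s S Y c; apply: contra_neqT => h; exact: x0.
- move=> t i s S Y k c; apply: contra_neqT; rewrite negb_or => /andP[hS hY].
  have gY b : Y b c = 0.
    by move: hY; rewrite negb_exists => /forallP/(_ b); rewrite negbK => /eqP.
  have g0 : (B%:R^-1 *: \sum_b row b Y) 0 c = 0.
    rewrite mxE summxE big1 ?mulr0// => b _; by rewrite mxE gY.
  have y0 : (\sum_(j | parent G r j == i) row row_y (tnth S j)) 0 c = 0.
    by rewrite summxE big1// => j /child_nbhd ji; rewrite mxE (inact _ _ _ _ hS).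
  rewrite /= /tree_update mxE.
  case: k => [[|[|[|[|k]]]] lk] //=.
  + by rewrite x0.
  + case: ifP => _ //.
    by rewrite !mxE y0 add0r in g0 *; rewrite g0 add0r (inact _ _ _ _ hS) ?eqxx// oppr0.
  + by case: ifP => _; rewrite ?x0// mxE (inact _ _ _ _ hS)// eqxx.
- move=> s S c; apply: contra_neqT; rewrite negb_exists => /forallP/(_ r).
  by rewrite negb_exists => /forallP/(_ row_out); rewrite negbK mxE => /eqP.
Qed.

Lemma vtree_measurable : measurable_protocol A.
Proof.
have mt d (U : measurableType d) (f : U -> n.-tuple 'M[R]_(4, p)) j :
    measurable_fun setT f -> measurable_fun setT (fun z => tnth (f z) j).
  by move=> mf; exact: (measurableT_comp (measurable_tnth j) mf).
have mx d (U : measurableType d) (f : U -> n.-tuple 'M[R]_(4, p)) t i :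
    measurable_fun setT f -> measurable_fun setT (fun z => tree_x G r (gam t.-1) t i (f z)).
  move=> mf; rewrite /tree_x; case: (t == 0%N); first exact/measurable_row/mt.
  case: (i == r); last exact/measurable_row/mt.
  apply: measurable_mxB; first exact/measurable_row/mt.
  exact/measurable_mxZ/measurable_row/mt.
have m1 d1 d2 d3 (U1 : measurableType d1) (U2 : measurableType d2) (U3 : measurableType d3) :
    measurable_fun setT (fun z : U1 * U2 * U3 => z.1.2).
  exact: (measurableT_comp measurable_snd measurable_fst).
split.
- by move=> t i b; apply: mx; exact: m1.
- move=> t i; pose Z := ((nat * n.-tuple 'M[R]_(4, p)) * 'M[R]_(B, p))%type.
  have mg : measurable_fun setT (fun z : Z => B%:R^-1 *: \sum_b row b z.2).
    apply/measurable_mxZ/measurable_mx_sum => b _.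
    by apply: measurable_row; exact: measurable_snd.
  have mS j k : measurable_fun setT (fun z : Z => row k (tnth z.1.2 j)).
    by apply: measurable_row; apply: mt; exact: m1.
  have mX : measurable_fun setT (fun z : Z => tree_x G r (gam t.-1) t i z.1.2).
    by apply: mx; exact: m1.
  have mif (f1 f2 : Z -> 'rV[R]_p) : measurable_fun setT f1 -> measurable_fun setT f2 ->
      measurable_fun setT (fun z : Z => if t == z.1.1 then f1 z else f2 z).
    move=> mf1 mf2; apply: measurable_fun_ifT => //.
    have mfst : measurable_fun setT (fun z : Z => z.1.1).
      exact: (measurableT_comp measurable_fst measurable_fst).
    have meq : measurable_fun setT (fun s : nat => t == s) by [].
    exact: (measurableT_comp meq mfst).
  apply/measurable_fun_matrixP => k c; rewrite /= /tree_update.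
  under eq_fun do rewrite mxE.
  have coord (f : Z -> 'rV[R]_p) : measurable_fun setT f -> measurable_fun setT (fun z => f z 0 c).
    by move=> /measurable_fun_matrixP; apply.
  case: k => [[|[|[|[|k]]]] lk] //=; apply: coord => //.
  + case: (t == 0%N) => //; apply: measurable_mxB => //; apply: measurable_mxD => //.
    exact: measurable_mx_sum.
  + exact: mif.
- by apply: measurable_row; apply: mt; exact: measurable_snd.
Qed.

End in_class.
End protocol_of_tree.
End variable_step_tree.

(** * Noise of the delayed gradients *)

Section vector_expectation.
Context {d} {T : measurableType d} {R : realType} (P : probability T R) (p : nat).
Implicit Types X Y : T -> 'rV[R]_p.

Definition vsqint X := forall j, sqint P (fun w => X w 0 j).

Lemma vsqint_measurable X : vsqint X -> measurable_fun setT X.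
Proof.
move=> hX; apply/measurable_fun_matrixP => i j; rewrite ord1.
by have [] := hX j.
Qed.

Lemma vsqint_sqn X : vsqint X -> intb P (fun w => sqn (X w)).
Proof. by move=> hX; apply: intb_sum => j _; have [] := hX j. Qed.

Lemma vsqint_dotp X Y : vsqint X -> vsqint Y -> intb P (fun w => dotp (X w) (Y w)).
Proof. by move=> hX hY; apply: intb_sum => j _; exact: sqintM. Qed.

Lemma vsqintP X : measurable_fun setT X -> intb P (fun w => sqn (X w)) -> vsqint X.
Proof.
move=> mX iX j.
have mj : measurable_fun setT (fun w => X w 0 j).
  by have /measurable_fun_matrixP := mX; apply.
split => //; apply: intb_le iX; first exact: measurable_funX.
move=> w; rewrite -enorm_sq normrX.
by rewrite lerXn2r ?nnegrE ?enorm_ge0 ?normr_ge0// coord_le_enorm.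
Qed.

Lemma vsqint_cst (v : 'rV[R]_p) : vsqint (fun=> v).
Proof. by move=> j; exact: sqint_cst. Qed.

Lemma vsqintD X Y : vsqint X -> vsqint Y -> vsqint (fun w => X w + Y w).
Proof.
move=> hX hY j; have := sqintD (hX j) (hY j).
by congr sqint; apply/funext => w; rewrite mxE.
Qed.

Lemma vsqintZ (a : R) X : vsqint X -> vsqint (fun w => a *: X w).
Proof.
move=> hX j; have := sqintZ a (hX j).
by congr sqint; apply/funext => w; rewrite mxE.
Qed.

Lemma vsqintB X Y : vsqint X -> vsqint Y -> vsqint (fun w => X w - Y w).
Proof.
move=> hX hY; have := vsqintD hX (vsqintZ (-1) hY).
by congr vsqint; apply/funext => w; rewrite scaleN1r.
Qed.

Lemma vsqint_sum J (s : seq J) (Q : pred J) (X : J -> T -> 'rV[R]_p) :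
  (forall i, Q i -> vsqint (X i)) -> vsqint (fun w => \sum_(i <- s | Q i) X i w).
Proof.
move=> hX j; have := @sqint_sum _ _ _ P _ s Q (fun i w => X i w 0 j) (fun i Qi => hX i Qi j).
by congr sqint; apply/funext => w; rewrite summxE.
Qed.

(** Pythagoras. *)
Lemma ex_sqn_orthogonal (J : eqType) (s : seq J) (X : J -> T -> 'rV[R]_p) :
  (forall a, vsqint (X a)) -> uniq s ->
  (forall a b, a != b -> ex P (fun w => dotp (X a w) (X b w)) = 0) ->
  ex P (fun w => sqn (\sum_(a <- s) X a w)) = \sum_(a <- s) ex P (fun w => sqn (X a w)).
Proof.
move=> hX + orth; elim: s => [_|a s IH /= /andP[as_ us]].
  rewrite big_nil -[RHS](ex_cst P 0); apply: eq_ex => w; by rewrite big_nil sqn0.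
rewrite big_cons -IH//.
have hS : vsqint (fun w => \sum_(b <- s) X b w) by exact: vsqint_sum.
have e w : sqn (\sum_(b <- a :: s) X b w) =
    (sqn (X a w) + 2 * dotp (X a w) (\sum_(b <- s) X b w)) + sqn (\sum_(b <- s) X b w).
  by rewrite big_cons sqnD.
have iD := intbZ 2 (vsqint_dotp (hX a) hS).
rewrite (eq_ex P e) exD; [|apply: intbD => //; exact: vsqint_sqn|exact: vsqint_sqn].
rewrite exD//; last exact: vsqint_sqn.
rewrite exZ; last exact: vsqint_dotp.
suff -> : ex P (fun w => dotp (X a w) (\sum_(b <- s) X b w)) = 0 by rewrite mulr0 addr0.
under eq_fun do rewrite dotp_sumr.
rewrite ex_sum; last by move=> b _; exact: vsqint_dotp.
rewrite big_seq big1// => b bs; apply: orth.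
by apply: contraNneq as_ => ->.
Qed.

End vector_expectation.

Lemma ler_sum_size (R : realType) J (s : seq J) (f : J -> R) c :
  (forall a, f a <= c) -> \sum_(a <- s) f a <= (size s)%:R * c.
Proof.
move=> fc; elim: s => [|a s IH]; first by rewrite big_nil mul0r.
by rewrite big_cons /= -natr1; have := fc a; lra.
Qed.

Section delayed_gradient_noise.
Context {R : realType} {n : nat} (I : problem R n) (L sigma2 : R).
Hypothesis adm : admissible I L sigma2.
Hypothesis L0 : 0 < L.
Context (G : rel 'I_n) (r : 'I_n) (Dh : nat).
Hypothesis GG : graph_class Dh G.
Context (B : nat) (gam : nat -> R).
Hypothesis B0 : (0 < B)%N.
Let P := prob I.
Let h := level G r.
Let z t (w : omega I) := root_iter G r B gam w t.
Let vec := 'rV[R]_(dim I).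

(** The sample that agent i draws when it computes the gradient that reaches the
    root in round t, and its noise; nothing reaches the root before round h i. *)
Definition arrival (a : nat * ('I_n * 'I_B)) : 'I_n * nat * nat :=
  (a.2.1, (a.1 - h a.2.1)%N, a.2.2 : nat).

Definition arrival_noise (a : nat * ('I_n * 'I_B)) (w : omega I) : vec :=
  if (h a.2.1 <= a.1)%N
  then noise (arrival a) (z (a.1 - h a.2.1 - h a.2.1)) w else 0.

Definition noise_sum t (w : omega I) : vec :=
  B%:R^-1 *: \sum_a arrival_noise (t, a) w.

Definition delayed_grad t (w : omega I) : vec :=
  \sum_(i | (h i <= t)%N) agent_grad i (z (t - h i - h i) w).

Lemma minibatchE i t (x : vec) w : minibatch B w i t x =
  agent_grad i x + B%:R^-1 *: \sum_(b < B) (oracle I i x (xi I i t b w) - agent_grad i x).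
Proof.
have -> : \sum_(b < B) (oracle I i x (xi I i t b w) - agent_grad i x) =
    \sum_(b < B) oracle I i x (xi I i t b w) - B%:R *: agent_grad i x.
  by rewrite big_split /= sumrN sumr_const card_ord scaler_nat.
rewrite scalerBr scalerA mulVf ?pnatr_eq0 -?lt0n// scale1r.
by rewrite addrC subrK.
Qed.

Lemma root_step t w : z t.+1 w = z t w - gam t *: (delayed_grad t w + noise_sum t w).
Proof.
rewrite /z (root_iterS r B gam w GG); congr (_ - _ *: _).
under eq_bigr do rewrite minibatchE.
rewrite big_split /=; congr (_ + _).
rewrite /noise_sum -scaler_sumr; congr (_ *: _).
rewrite [LHS]big_mkcond /= -(pair_bigA _ (fun i b => arrival_noise (t, (i, b)) w)) /=.
apply: eq_bigr => i _; rewrite /arrival_noise /= -/h.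
by case: ifP => // _; rewrite big1.
Qed.

(** A sample drawn by agent i in round t enters the root iterates only after it
    has travelled h i rounds. *)
Lemma root_measurable_without (k : 'I_n * nat * nat) s :
  (s <= k.1.2 + h k.1.1)%N -> measurable_fun [set: without I k] (z s).
Proof.
elim/ltn_ind: s => s IH; case: s IH => [|s] IH sk.
  by rewrite /z; exact: measurable_cst.
have -> : z s.+1 = (fun w => z s w - gam s *:
    \sum_(i | (h i <= s)%N) minibatch B w i (s - h i) (z (s - h i - h i) w)).
  by apply/funext => w; rewrite /z (root_iterS r B gam w GG).
apply: measurable_mxB; first by apply: IH => //; exact: ltnW.
apply: measurable_mxZ; apply: measurable_mx_sum => i; rewrite -/h => hi.
apply: measurable_mxZ; apply: measurable_mx_sum => b _.
apply: (oracle_measurable_without adm (k := (i, (s - h i)%N, b : nat))).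
  by apply/eqP => e; move: sk; rewrite -e /= subnK// ltnn.
by apply: IH; lia.
Qed.

(** Lipschitz maps have at most linear growth. *)
Lemma agent_grad_vsqint i (X : omega I -> vec) : vsqint P X ->
  vsqint P (fun w => agent_grad i (X w)).
Proof.
move=> hX.
have mg : measurable_fun setT (fun w => agent_grad i (X w)).
  exact: (measurableT_comp (@agent_grad_measurable _ _ _ _ _ adm i) (vsqint_measurable hX)).
have smI : smooth I L by case: adm => -[].
apply: vsqintP => //.
have i2 := intbD (intbZ (2 * L ^+ 2) (vsqint_sqn (vsqintB hX (vsqint_cst P (start I)))))
  (intb_cst P (2 * sqn (agent_grad i (start I)))).
apply: intb_le i2; first exact: measurable_sqn.
move=> w; rewrite ger0_norm ?sqn_ge0//.
have h1 := agent_grad_lip L0 smI i (X w) (start I).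
have := sqnD_le (agent_grad i (X w) - agent_grad i (start I)) (agent_grad i (start I)).
by rewrite subrK; lra.
Qed.

Lemma arrival_noise_sqn a : vsqint P (arrival_noise a) /\
  ex P (fun w => sqn (arrival_noise a w)) <= sigma2.
Proof.
have s0 : 0 <= sigma2.
  have [_ le] := noise_sqn adm (k := (r, 0%N, 0%N)) (Y := z 0)
    (@root_measurable_without (r, 0%N, 0%N) 0 isT).
  by apply: le_trans le; apply: ex_ge0 => w; exact: sqn_ge0.
rewrite /arrival_noise; case ha : (h a.2.1 <= a.1)%N; last first.
  split; first exact: vsqint_cst.
  by under eq_fun do rewrite sqn0; rewrite ex_cst.
have mz : measurable_fun [set: without I (arrival a)] (z (a.1 - h a.2.1 - h a.2.1)).
  by apply: root_measurable_without; rewrite /=; lia.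
split; last by have [] := noise_sqn adm mz.
by move=> j; exact: (noise_sqint adm mz).
Qed.

Lemma noise_sum_vsqint t : vsqint P (noise_sum t).
Proof. by apply: vsqintZ; apply: vsqint_sum => a _; have [] := arrival_noise_sqn (t, a). Qed.

Lemma root_vsqint t : vsqint P (z t).
Proof.
elim/ltn_ind: t => t IH; case: t IH => [|t] IH; first exact: vsqint_cst.
have -> : z t.+1 = (fun w => z t w - gam t *: (delayed_grad t w + noise_sum t w)).
  by apply/funext => w; rewrite root_step.
apply: vsqintB; first exact: IH.
apply: vsqintZ; apply: vsqintD; last exact: noise_sum_vsqint.
by apply: vsqint_sum => i _; apply: agent_grad_vsqint; apply: IH; lia.
Qed.

Lemma delayed_grad_vsqint t : vsqint P (delayed_grad t).
Proof. by apply: vsqint_sum => i _; apply: agent_grad_vsqint; exact: root_vsqint. Qed.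

Let arrival_noise_dotp a (Z : omega I -> vec) :
  measurable_fun [set: without I (arrival a)] Z -> vsqint P Z ->
  ex P (fun w => dotp (arrival_noise a w) (Z w)) = 0.
Proof.
move=> mZ sZ; rewrite /arrival_noise; case ha : (h a.2.1 <= a.1)%N; last first.
  rewrite -[RHS](ex_cst P 0); apply: eq_ex => w.
  by apply: big1 => j _; rewrite mxE mul0r.
have mz : measurable_fun [set: without I (arrival a)] (z (a.1 - h a.2.1 - h a.2.1)).
  by apply: root_measurable_without; rewrite /=; lia.
rewrite ex_sum; last first.
  by move=> j _; apply: sqintM => //; exact: (noise_sqint adm mz).
apply: big1 => j _; apply: (noise_orthogonal adm) => //.
by have /measurable_fun_matrixP := mZ; apply.
Qed.

(** The samples that arrive in round t have not influenced the root before. *)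
Lemma grad_noise_orthogonal t : vsqint P (fun w => grad (avg_obj I) (z t w)) ->
  ex P (fun w => dotp (grad (avg_obj I) (z t w)) (noise_sum t w)) = 0.
Proof.
move=> sG.
have smI : smooth I L by case: adm => -[].
have e w : dotp (grad (avg_obj I) (z t w)) (noise_sum t w) =
    B%:R^-1 * \sum_a dotp (arrival_noise (t, a) w) (grad (avg_obj I) (z t w)).
  by rewrite dotpZr dotp_sumr; congr (_ * _); apply: eq_bigr => a _; rewrite dotpC.
have ii a : intb P (fun w => dotp (arrival_noise (t, a) w) (grad (avg_obj I) (z t w))).
  by apply: vsqint_dotp => //; have [] := arrival_noise_sqn (t, a).
rewrite (eq_ex P e) exZ; last by apply: intb_sum => a _.
rewrite ex_sum// big1 ?mulr0// => a _.
have [ha|ha] := leqP (h a.1) t; last first.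
  rewrite -[RHS](ex_cst P 0); apply: eq_ex => w.
  by rewrite /arrival_noise /= leqNgt ha; apply: big1 => j _; rewrite mxE mul0r.
apply: arrival_noise_dotp => //.
have mz : measurable_fun [set: without I (arrival (t, a))] (z t).
  by apply: root_measurable_without; rewrite /=; lia.
have -> : (fun w => grad (avg_obj I) (z t w)) =
    (fun w => n%:R^-1 *: \sum_i agent_grad i (z t w)).
  by apply/funext => w; rewrite (grad_avg smI).
apply: measurable_mxZ; apply: measurable_mx_sum => i _.
exact: (measurableT_comp (@agent_grad_measurable _ _ _ _ _ adm i) mz).
Qed.

(** Of two samples, the one that reaches the root last has not influenced the
    noise of the other. *)
Lemma arrival_noise_orthogonal a b : a != b ->
  ex P (fun w => dotp (arrival_noise a w) (arrival_noise b w)) = 0.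
Proof.
wlog ba : a b / (b.1 <= a.1)%N.
  move=> H ab; case: (leqP b.1 a.1) => [|/ltnW] le; first exact: H.
  transitivity (ex P (fun w => dotp (arrival_noise b w) (arrival_noise a w))).
    by apply: eq_ex => w; rewrite dotpC.
  by apply: H => //; rewrite eq_sym.
move=> ab.
have [ha|ha] := leqP (h a.2.1) a.1; last first.
  rewrite -[RHS](ex_cst P 0); apply: eq_ex => w.
  by rewrite {1}/arrival_noise leqNgt ha; apply: big1 => j _; rewrite mxE mul0r.
apply: arrival_noise_dotp; last by have [] := arrival_noise_sqn b.
rewrite /arrival_noise; case hb : (h b.2.1 <= b.1)%N; last exact: measurable_cst.
apply: (noise_measurable_without adm) => //; last first.
  apply: root_measurable_without; rewrite /= subnK//.
  by apply: leq_trans ba; rewrite -subnDA leq_subr.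
apply: contraNneq ab; case: a b {ba} ha hb => [t [i u]] [t' [i' u']] /= ha hb.
rewrite /arrival /= => -[ei et eu].
rewrite (ord_inj eu) ei; apply/eqP; congr (_, _).
by move: ei ha hb et => ->; lia.
Qed.

(** The noise of different rounds is uncorrelated, so that its accumulated
    second moment grows linearly, not quadratically, with the number of rounds. *)
Lemma noise_sum_le (ts : seq nat) : uniq ts ->
  ex P (fun w => sqn (\sum_(t <- ts) noise_sum t w)) <=
  (size ts)%:R * (n%:R * sigma2 / B%:R).
Proof.
move=> uts; pose s := [seq (t, a) | t <- ts, a <- enum {: 'I_n * 'I_B}].
have BR : 0 < B%:R :> R by rewrite ltr0n.
have e w : sqn (\sum_(t <- ts) noise_sum t w) =
    B%:R^-1 ^+ 2 * sqn (\sum_(a <- s) arrival_noise a w).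
  rewrite -sqnZ /s big_allpairs -scaler_sumr; congr (sqn (_ *: _)).
  by apply: eq_bigr => t _; rewrite big_enum.
have us : uniq s.
  by apply: allpairs_uniq => //; [exact: enum_uniq|move=> [? ?] [? ?] _ _ [-> ->]].
have hs a : vsqint P (arrival_noise a) by have [] := arrival_noise_sqn a.
rewrite (eq_ex P e) exZ; last by apply: vsqint_sqn; exact: vsqint_sum.
rewrite ex_sqn_orthogonal//; last exact: arrival_noise_orthogonal.
apply: (@le_trans _ _ (B%:R^-1 ^+ 2 * ((size s)%:R * sigma2))).
  rewrite ler_pM2l ?exprn_gt0 ?invr_gt0//; apply: ler_sum_size => a.
  by have [] := arrival_noise_sqn a.
rewrite size_allpairs -cardE card_prod !card_ord !natrM le_eqVlt.
apply/orP; left; apply/eqP.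
have BB : B%:R^-1 * B%:R = 1 :> R by rewrite mulVf// lt0r_neq0.
transitivity ((size ts)%:R * (n%:R * sigma2 * B%:R^-1) * (B%:R^-1 * B%:R)); last by rewrite BB mulr1.
lra.
Qed.

End delayed_gradient_noise.

(** * Convergence of the root *)

(** Here Sg, Sv and Se are the sums over the rounds of the second moments of the
    gradient, of the delayed gradient sum, and of the bias of the latter; ta is
    the noise level of one round and gp the gap. The first of the last two
    hypotheses is the summed descent inequality, the other the bound on the bias.
    The cap on the step makes the multiples of Sv in both of them smaller than the
    term Sv that the descent inequality provides. *)
Lemma delayed_gradient_arithmetic (R : realFieldType) (L gamma gp nn dd Sg Sv Se K Hh tt ta s : R) :
  0 < L -> 0 < gamma ->
  1 <= nn -> 1 <= dd -> 40 * nn * dd * L * gamma <= 1 -> 0 <= Sv -> 0 <= tt -> 0 <= ta ->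
  ta = nn * s ->
  gamma * (nn ^+ 2 * Sg + Sv - Se) <= 2 * nn * (gp + 2 * L * gamma ^+ 2 * (Sv + tt * ta)) ->
  Se <= 2 * nn * L ^+ 2 * (nn * (2 * gamma ^+ 2 * (2 * dd * (2 * dd * Sv) + 2 * dd * (tt * ta))))
    + K * (2 * nn ^+ 2 * Hh) ->
  Sg <= 2 * gp / (gamma * nn) + 2 * K * Hh + 5 * L * gamma * tt * s.
Proof.
move=> L0 gamma0 n1 d1 step Sv0 tt0 ta0 taE main bias.
have [q qE] : exists q, q = L * gamma by exists (L * gamma).
have q0 : 0 < q by rewrite qE mulr_gt0.
have [x xE] : exists x, x = nn * dd * q by exists (nn * dd * q).
have nn0 : 0 <= nn by lra.
have dd0 : 0 <= dd by lra.
have x0 : 0 <= x by rewrite xE; apply: mulr_ge0; [exact: mulr_ge0|exact: ltW].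
have x1 : 40 * x <= 1 by move: step; rewrite xE qE; lra.
have nq0 : 0 <= nn * q by apply: mulr_ge0 => //; exact: ltW.
have nqx : nn * q <= x.
  by rewrite xE -mulrA [dd * q]mulrC mulrA ler_peMr.
have tta0 : 0 <= tt * ta by exact: mulr_ge0.
have b1 : Se <= Sv / 100 + nn * q * (tt * ta) / 5 + K * (2 * nn ^+ 2 * Hh).
  apply: le_trans bias _; rewrite lerD2r.
  have -> : 2 * nn * L ^+ 2 * (nn * (2 * gamma ^+ 2 * (2 * dd * (2 * dd * Sv) + 2 * dd * (tt * ta))))
     = 16 * (x * x * Sv) + 8 * (x * (nn * q * (tt * ta))) by rewrite xE qE; lra.
  have : x * x <= 1 / 1600 by nra.
  have : 0 <= nn * q * (tt * ta) by exact: mulr_ge0.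
  nra.
have main' : nn ^+ 2 * Sg + Sv - Se <= 2 * nn * gp / gamma + 4 * (nn * q) * (Sv + tt * ta).
  rewrite -(ler_pM2l gamma0); apply: le_trans main _.
  have e : gamma * (2 * nn * gp / gamma) = 2 * nn * gp by rewrite mulrC divfK ?lt0r_neq0.
  by rewrite [leRHS]mulrDr e qE; lra.
have fin : nn ^+ 2 * Sg <= 2 * nn * gp / gamma + 5 * (nn * q) * (tt * ta) + K * (2 * nn ^+ 2 * Hh).
  have : nn * q * Sv <= Sv / 40 by nra.
  have : 0 <= nn * q * (tt * ta) by exact: mulr_ge0.
  lra.
have n2 : 0 < nn ^+ 2 by rewrite exprn_gt0//; lra.
rewrite -(ler_pM2l n2); apply: le_trans fin _.
rewrite invfM le_eqVlt; apply/orP; left; apply/eqP.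
have nn1 : nn * nn^-1 = 1 by rewrite divff// lt0r_neq0//; lra.
transitivity (2 * nn * gp * gamma^-1 * (nn * nn^-1) + 5 * (nn * q) * (tt * ta) + K * (2 * nn ^+ 2 * Hh)).
  by rewrite nn1 mulr1.
by rewrite taE qE; lra.
Qed.

Section convergence.
Context {R : realType} {n : nat} (I : problem R n) (L sigma2 : R).
Hypothesis adm : admissible I L sigma2.
Hypothesis L0 : 0 < L.
Context (G : rel 'I_n) (r : 'I_n) (Dh : nat).
Hypothesis GG : graph_class Dh G.
Context (B D t0 T : nat) (gamma : R).
Hypothesis B0 : (0 < B)%N.
Hypothesis D0 : (0 < D)%N.
Hypothesis levD : forall i, (level G r i <= D)%N.
Hypothesis gamma0 : 0 < gamma.
Hypothesis gammaD : 40 * n%:R * D%:R * L * gamma <= 1.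

(** The root moves from round t0 on only; t0 = 0 is Tree-RGT, and t0 = D lets all
    the gradients reach the root before it moves. *)
Definition delayed_start t : R := if (t0 <= t)%N then gamma else 0.

Let P := prob I.
Let h := level G r.
Let z t (w : omega I) := root_iter G r B delayed_start w t.
Let V := delayed_grad (I := I) G r B delayed_start.
Let N := noise_sum (I := I) G r B delayed_start.
Let Gr t (w : omega I) := grad (avg_obj I) (z t w).
Let tau : R := n%:R * sigma2 / B%:R.
Let v t := ex P (fun w => sqn (V t w)).

Let n0 : (0 < n)%N. Proof. exact: leq_ltn_trans (leq0n r) (ltn_ord r). Qed.
Let nR : 0 < n%:R :> R. Proof. by rewrite ltr0n. Qed.
Let smI : smooth I L. Proof. by case: adm => -[]. Qed.
Let lbI : has_lbound (range (avg_obj I)). Proof. by case: adm => -[]. Qed.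

Let sz t : vsqint P (z t). Proof. exact: (root_vsqint adm L0 r GG delayed_start B0 t). Qed.
Let sV t : vsqint P (V t). Proof. exact: (delayed_grad_vsqint adm L0 r GG delayed_start B0 t). Qed.
Let sN t : vsqint P (N t). Proof. exact: (noise_sum_vsqint adm L0 r GG delayed_start B0 t). Qed.

Let v0 t : 0 <= v t. Proof. by apply: ex_ge0 => w; exact: sqn_ge0. Qed.

Let tau_bound ts : uniq ts ->
  ex P (fun w => sqn (\sum_(t <- ts) N t w)) <= (size ts)%:R * tau.
Proof. exact: (noise_sum_le adm L0 r GG delayed_start B0). Qed.

Let tau0 : 0 <= tau.
Proof.
have := @tau_bound [:: 0%N] isT; rewrite mul1r; apply: le_trans.
by apply: ex_ge0 => w; exact: sqn_ge0.
Qed.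

Let sG t : vsqint P (Gr t).
Proof.
rewrite /Gr; have -> : (fun w => grad (avg_obj I) (z t w)) =
    (fun w => n%:R^-1 *: \sum_i agent_grad i (z t w)).
  by apply/funext => w; rewrite (grad_avg smI).
apply: vsqintZ; apply: vsqint_sum => i _.
exact: (agent_grad_vsqint adm L0 i (sz t)).
Qed.

Let z_step t w : z t.+1 w = z t w - delayed_start t *: (V t w + N t w).
Proof. exact: (root_step r GG delayed_start B0 t w). Qed.

(** Displacement over a window of d rounds: the gradients may add up coherently,
    hence the factor d ^ 2, the noise does not. *)
Let window_le t d : ex P (fun w => sqn (z t w - z (t - d) w)) <=
  2 * gamma ^+ 2 * (d%:R * \sum_(t - d <= s < t | (t0 <= s)%N) v s + d%:R * tau).
Proof.
pose ts := [seq s <- index_iota (t - d) t | (t0 <= s)%N].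
have uts : uniq ts by rewrite filter_uniq// iota_uniq.
have szts : (size ts <= d)%N.
  by apply: leq_trans (size_subseq (filter_subseq _ _)) _; rewrite size_iota; clear; lia.
have e w : z t w - z (t - d) w =
    - gamma *: (\sum_(s <- ts) V s w + \sum_(s <- ts) N s w).
  rewrite -(telescope_sumr (fun s => z s w) (leq_subr d t)) -big_split /= scaler_sumr.
  rewrite big_filter [RHS]big_mkcond /=; apply: eq_bigr => s _.
  rewrite z_step addrAC subrr add0r -scaleNr /delayed_start.
  by case: ifP => // _; rewrite oppr0 scale0r.
have i1 : intb P (fun w => \sum_(s <- ts) sqn (V s w)).
  by apply: intb_sum => s _; exact: vsqint_sqn.
have i2 : intb P (fun w => sqn (\sum_(s <- ts) N s w)).
  by apply: vsqint_sqn; exact: vsqint_sum.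
have i3 := intbD (intbZ d%:R i1) i2.
have i4 := intbZ (2 * gamma ^+ 2) i3.
apply: (@le_trans _ _ (ex P (fun w => 2 * gamma ^+ 2 *
    (d%:R * \sum_(s <- ts) sqn (V s w) + sqn (\sum_(s <- ts) N s w))))).
  apply: ex_le => //; first by apply: vsqint_sqn; exact: vsqintB.
  move=> w; rewrite e sqnZ sqrrN.
  have := sqnD_le (\sum_(s <- ts) V s w) (\sum_(s <- ts) N s w).
  have := sqn_sum_le ts (fun s => V s w).
  have : (size ts)%:R * \sum_(s <- ts) sqn (V s w) <= d%:R * \sum_(s <- ts) sqn (V s w).
    by rewrite ler_wpM2r ?ler_nat// sumr_ge0// => s _; exact: sqn_ge0.
  have : 0 <= gamma ^+ 2 by exact: sqr_ge0.
  nra.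
rewrite exZ//; apply: ler_wpM2l; first by rewrite mulr_ge0 ?sqr_ge0.
rewrite exD//; last exact: intbZ.
rewrite exZ// ex_sum; last by move=> s _; exact: vsqint_sqn.
rewrite big_filter lerD2l; apply: le_trans (tau_bound uts) _.
by rewrite ler_wpM2r// ler_nat.
Qed.

Let sum_index_le (f : nat -> R) (s1 s2 : seq nat) : uniq s1 -> uniq s2 ->
  {subset s1 <= s2} -> (forall s, 0 <= f s) ->
  \sum_(s <- s1) f s <= \sum_(s <- s2) f s.
Proof.
move=> u1 u2 s12 f0; rewrite [leRHS](bigID (ssrbool.mem s1)) /= -[leLHS]addr0.
apply: lerD; last by apply: sumr_ge0.
suff -> : \sum_(s <- s1) f s = \sum_(s <- s2 | ssrbool.mem s1 s) f s by [].
rewrite -[RHS]big_filter; apply: perm_big; apply: uniq_perm => //.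
  exact: filter_uniq.
by move=> s; rewrite mem_filter /=; case s1s : (s \in s1) => //; rewrite (s12 _ s1s).
Qed.

(** Each round lies in at most 2 D windows of length 2 D. *)
Let windows_le :
  \sum_(t0 <= t < T) \sum_(t - 2 * D <= s < t | (t0 <= s)%N) v s <=
  2 * D%:R * \sum_(t0 <= t < T) v t.
Proof.
apply: (@le_trans _ _ (\sum_(t0 <= t < T) \sum_(t0 <= s < T | (s < t <= s + 2 * D)%N) v s)).
  rewrite big_nat_cond [leRHS]big_nat_cond; apply: ler_sum => t /andP[/andP[t1 t2] _].
  rewrite -big_filter -[leRHS]big_filter; apply: sum_index_le => //.
  - by rewrite filter_uniq// iota_uniq.
  - by rewrite filter_uniq// iota_uniq.
  - by move=> s; rewrite !mem_filter !mem_index_iota; move: t1 t2; clear; lia.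
rewrite (exchange_big_dep predT)//= mulr_sumr; apply: ler_sum => s _.
rewrite -big_filter; apply: (@le_trans _ _ (\sum_(t <- iota s.+1 (2 * D)) v s)).
  apply: (@sum_index_le (fun=> v s)).
  - by rewrite filter_uniq// iota_uniq.
  - exact: iota_uniq.
  - by move=> t; rewrite mem_filter mem_iota; clear; lia.
  - by move=> _; exact: v0.
apply: le_trans (@ler_sum_size _ _ _ _ (v s) (fun=> lexx _)) _.
by rewrite size_iota natrM.
Qed.

(** The delayed gradient sum differs from n times the gradient by the
    displacement of the root during the round trips and, in the first D rounds, by
    the gradients at the starting point that have not arrived yet. *)
Let bias_le t : ex P (fun w => sqn (V t w - n%:R *: Gr t w)) <=
  2 * n%:R * L ^+ 2 * \sum_i ex P (fun w => sqn (z t w - z (t - (h i + h i)) w))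
  + (t < D)%N%:R * (2 * n%:R ^+ 2 * grad_energy I).
Proof.
have sizeE (f : 'I_n -> 'rV[R]_(dim I)) : sqn (\sum_i f i) <= n%:R * \sum_i sqn (f i).
  by rewrite -!big_enum; apply: le_trans (sqn_sum_le _ _) _; rewrite size_enum_ord.
pose c : R := (t < D)%N%:R * (2 * n%:R ^+ 2 * grad_energy I).
have ii i : intb P (fun w => sqn (z t w - z (t - (h i + h i)) w)).
  by apply: vsqint_sqn; exact: vsqintB.
have iis := @intb_sum _ _ _ P _ (index_enum 'I_n) xpredT _ (fun i _ => ii i).
rewrite -/c -(ex_sum (P := P))// -exZ// -(ex_cst P c) -exD//; last 2 first.
  exact: intbZ.
  exact: intb_cst.
apply: ex_le.
- by apply: vsqint_sqn; apply: vsqintB => //; exact: vsqintZ.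
- by apply: intbD; [exact: intbZ|exact: intb_cst].
move=> w.
pose a := \sum_i (agent_grad i (z (t - (h i + h i)) w) - agent_grad i (z t w)).
pose b := \sum_i (if (t < h i)%N then agent_grad i (start I) else 0).
have -> : V t w - n%:R *: Gr t w = a + - b.
  rewrite /Gr (grad_avg smI) scalerA divff ?lt0r_neq0// scale1r.
  rewrite /a /b big_split /= sumrN addrAC; congr (_ - _).
  rewrite -big_mkcond /= (bigID (fun i => (h i <= t)%N)) /=.
  rewrite [X in _ + X - _](eq_bigr (fun i => agent_grad i (start I))); last first.
    move=> i; rewrite -ltnNge => hi; congr (agent_grad i _).
    by have -> : (t - (h i + h i) = 0)%N by move: hi; clear; lia.
  rewrite [X in _ + X - _](eq_bigl (fun i => (t < h i)%N)); last by move=> i; rewrite ltnNge.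
  rewrite addrK; apply: eq_bigr => i _; by rewrite -subnDA.
apply: le_trans (sqnD_le _ _) _; rewrite sqnN; apply: lerD.
  rewrite -mulrA -(mulrA 2) ler_pM2l//; apply: le_trans (sizeE _) _.
  rewrite ler_pM2l// mulr_sumr; apply: ler_sum => i _.
  apply: le_trans (agent_grad_lip L0 smI _ _ _) _.
  by rewrite -[X in _ * X <= _]sqnN opprB.
rewrite /c; case: ltnP => tD; last first.
  rewrite mul0r /b big1 ?sqn0 ?mulr0// => i _.
  by rewrite ltnNge (leq_trans (levD i) tD).
rewrite mul1r -mulrA ler_pM2l//.
apply: le_trans (sizeE _) _; rewrite expr2 -mulrA ler_pM2l//.
rewrite /grad_energy mulrA divff ?lt0r_neq0// mul1r; apply: ler_sum => i _.
by rewrite enorm_sq; case: ifP => _ //; rewrite sqn0 sqn_ge0.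
Qed.

Let gap_ge0 : 0 <= gap I.
Proof. by rewrite /gap subr_ge0; exact: avg_ge_inf. Qed.

Let energy_ge0 : 0 <= grad_energy I.
Proof.
by rewrite mulr_ge0 ?invr_ge0 ?ler0n// sumr_ge0// => i _; rewrite sqr_ge0.
Qed.

Let z_start t : (t <= t0)%N -> forall w, z t w = start I.
Proof.
elim: t => [//|t IH] tt0 w; rewrite z_step IH; last exact: ltnW.
by rewrite /delayed_start leqNgt tt0 scale0r subr0.
Qed.

(** Telescoped descent inequality; the noise is orthogonal to the gradient. *)
Let descent_sum : (t0 <= T)%N ->
  gamma * \sum_(t0 <= t < T) ex P (fun w => dotp (Gr t w) (V t w)) <=
  gap I + 2 * L * gamma ^+ 2 * (\sum_(t0 <= t < T) v t + (T - t0)%:R * tau).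
Proof.
move=> t0T.
have iGV t : intb P (fun w => dotp (Gr t w) (V t w)) by exact: vsqint_dotp.
have iGN t : intb P (fun w => dotp (Gr t w) (N t w)) by exact: vsqint_dotp.
have iV t : intb P (fun w => sqn (V t w)) by exact: vsqint_sqn.
have iN t : intb P (fun w => sqn (N t w)) by exact: vsqint_sqn.
have eGN t : ex P (fun w => dotp (Gr t w) (N t w)) = 0.
  exact: (grad_noise_orthogonal adm L0 GG B0 (sG t)).
have eN t : ex P (fun w => sqn (N t w)) <= tau.
  have := @tau_bound [:: t] isT; rewrite mul1r; apply: le_trans.
  rewrite le_eqVlt; apply/orP; left; apply/eqP; apply: eq_ex => w.
  by rewrite big_seq1.
have pw w : gamma * \sum_(t0 <= t < T) (dotp (Gr t w) (V t w) + dotp (Gr t w) (N t w)) <=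
    gap I + 2 * L * gamma ^+ 2 * \sum_(t0 <= t < T) (sqn (V t w) + sqn (N t w)).
  have tel := telescope_sumr (fun t => - avg_obj I (z t w)) t0T.
  have := avg_ge_inf lbI (z T w).
  rewrite !mulr_sumr -lerBlDr -sumrB.
  move=> hT; apply: (@le_trans _ _ (\sum_(t0 <= t < T) (- avg_obj I (z t.+1 w) - - avg_obj I (z t w)))).
    rewrite big_nat_cond [leRHS]big_nat_cond; apply: ler_sum => t /andP[/andP[t1 t2] _].
    have := avg_descent n0 L0 smI (z t w) (- gamma *: (V t w + N t w)).
    rewrite -/(Gr t w) dotpZr dotpDr sqnZ sqrrN.
    have -> : z t w + - gamma *: (V t w + N t w) = z t.+1 w.
      by rewrite z_step /delayed_start t1 scaleNr.
    have := sqnD_le (V t w) (N t w).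
    have : 0 <= L * gamma ^+ 2 by rewrite mulr_ge0 ?sqr_ge0// ltW.
    nra.
  rewrite tel (z_start (leqnn t0)) /gap; lra.
have ex1 : ex P (fun w => gamma * \sum_(t0 <= t < T) (dotp (Gr t w) (V t w) + dotp (Gr t w) (N t w))) =
    gamma * \sum_(t0 <= t < T) ex P (fun w => dotp (Gr t w) (V t w)).
  rewrite exZ; last by apply: intb_sum => t _; exact: intbD.
  congr (_ * _); rewrite ex_sum; last by move=> t _; exact: intbD.
  by apply: eq_bigr => t _; rewrite exD// eGN addr0.
have ex2 : ex P (fun w => gap I + 2 * L * gamma ^+ 2 * \sum_(t0 <= t < T) (sqn (V t w) + sqn (N t w))) <=
    gap I + 2 * L * gamma ^+ 2 * (\sum_(t0 <= t < T) v t + (T - t0)%:R * tau).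
  have iS : intb P (fun w => \sum_(t0 <= t < T) (sqn (V t w) + sqn (N t w))).
    by apply: intb_sum => t _; exact: intbD.
  rewrite exD; [|exact: intb_cst|exact: intbZ].
  rewrite ex_cst lerD2l exZ// ler_pM2l; last by rewrite !mulr_gt0// exprn_gt0.
  rewrite ex_sum; last by move=> t _; exact: intbD.
  rewrite (eq_bigr (fun t => v t + ex P (fun w => sqn (N t w)))); last first.
    by move=> t _; rewrite exD.
  rewrite big_split /= lerD2l.
  by apply: le_trans (ler_sum_size _ eN) _; rewrite size_iota.
rewrite -ex1; apply: le_trans ex2; apply: ex_le => //.
- by apply: intbZ; apply: intb_sum => t _; exact: intbD.
- apply: intbD; first exact: intb_cst.
  by apply: intbZ; apply: intb_sum => t _; exact: intbD.
Qed.

Let bias_sum :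
  \sum_(t0 <= t < T) ex P (fun w => sqn (V t w - n%:R *: Gr t w)) <=
  2 * n%:R * L ^+ 2 * (n%:R * (2 * gamma ^+ 2 * (2 * D%:R *
     (2 * D%:R * \sum_(t0 <= t < T) v t) + 2 * D%:R * (T%:R * tau))))
  + (D - t0)%:R * (2 * n%:R ^+ 2 * grad_energy I).
Proof.
apply: le_trans (ler_sum _ (fun t _ => bias_le t)) _.
rewrite big_split /= -mulr_sumr -mulr_suml; apply: lerD; last first.
  apply: ler_wpM2r; first by apply: mulr_ge0 => //; rewrite mulr_ge0 ?sqr_ge0.
  rewrite -(@natr_sum R) ler_nat -big_mkcond /= sum1_count -size_filter.
  apply: leq_trans (_ : (size (index_iota t0 D) <= _)%N); last by rewrite size_iota.
  apply: uniq_leq_size; first by rewrite filter_uniq// iota_uniq.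
  by move=> s; rewrite mem_filter !mem_index_iota; clear; lia.
apply: ler_wpM2l; first by apply: mulr_ge0; [rewrite mulr_ge0|exact: sqr_ge0].
have g2 : 0 <= 2 * gamma ^+ 2 by rewrite mulr_ge0 ?sqr_ge0.
apply: (@le_trans _ _ (\sum_(t0 <= t < T) n%:R * (2 * gamma ^+ 2 *
   (2 * D%:R * \sum_(t - 2 * D <= s < t | (t0 <= s)%N) v s + 2 * D%:R * tau)))).
  apply: ler_sum => t _.
  apply: (@le_trans _ _ (\sum_(i < n) 2 * gamma ^+ 2 *
    (2 * D%:R * \sum_(t - 2 * D <= s < t | (t0 <= s)%N) v s + 2 * D%:R * tau))); last first.
    by rewrite big_const_ord iter_addr_0 [leRHS]mulr_natl.
  apply: ler_sum => i _; apply: le_trans (window_le _ _) _.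
  apply: ler_wpM2l => //; rewrite -!natrM.
  have hD : (h i + h i <= 2 * D)%N by have := levD i; rewrite -/h; clear; lia.
  apply: lerD; last by apply: ler_wpM2r => //; rewrite ler_nat.
  apply: ler_pM => //; [by rewrite sumr_ge0|by rewrite ler_nat|].
  rewrite -big_filter -[leRHS]big_filter; apply: sum_index_le => //.
  - by rewrite filter_uniq// iota_uniq.
  - by rewrite filter_uniq// iota_uniq.
  - by move=> s; rewrite !mem_filter !mem_index_iota; move: hD; clear; lia.
rewrite -mulr_sumr ler_pM2l// -mulr_sumr; apply: ler_wpM2l => //.
rewrite big_split /= -mulr_sumr; apply: lerD.
  by apply: ler_wpM2l => //; rewrite mulr_ge0 ?ler0n.
rewrite big_const_nat iter_addr_0 -mulrnAr; apply: ler_wpM2l.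
  by rewrite mulr_ge0 ?ler0n.
by rewrite -mulr_natl; apply: ler_wpM2r => //; rewrite ler_nat leq_subr.
Qed.

(** The first t0 rounds contribute the gradient at the starting point. In the
    others the identity
      2 n <G, V> = |n G| ^ 2 + |V| ^ 2 - |V - n G| ^ 2
    turns the descent inequality into a bound on the gradients G in terms of the
    bias V - n G, in which |V| ^ 2 compensates the displacement of the root. *)
Lemma grad_sum_le :
  \sum_(0 <= t < T) ex P (fun w => sqn (grad (avg_obj I) (root_iter G r B delayed_start w t))) <=
  t0%:R * (4 * L * gap I) + (2 * gap I / (gamma * n%:R) + 2 * (D - t0)%:R * grad_energy I
    + 5 * L * gamma * T%:R * (sigma2 / B%:R)).
Proof.
have s0 : 0 <= sigma2 / B%:R.
  have : 0 <= n%:R * (sigma2 / B%:R) by rewrite mulrA.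
  by rewrite pmulr_rge0.
have rest0 : 0 <= 2 * gap I / (gamma * n%:R) + 2 * (D - t0)%:R * grad_energy I
    + 5 * L * gamma * T%:R * (sigma2 / B%:R).
  apply: addr_ge0; first apply: addr_ge0.
  - by apply: divr_ge0; apply: mulr_ge0 => //; exact: ltW.
  - by apply: mulr_ge0 => //; rewrite mulr_ge0 ?ler0n.
  - by apply: mulr_ge0 => //; rewrite !mulr_ge0 ?ler0n// ltW.
have early t : (t <= t0)%N -> ex P (fun w => sqn (Gr t w)) <= 4 * L * gap I.
  move=> tt0; rewrite -[leRHS](ex_cst P); apply: ex_le => [||w].
  - exact: vsqint_sqn.
  - exact: intb_cst.
  - by rewrite /Gr z_start//; exact: grad_start_le.
have Lg : 0 <= 4 * L * gap I by rewrite mulr_ge0// mulr_ge0// ltW.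
have [Tt0|t0T] := leqP T t0.
  apply: (@le_trans _ _ (t0%:R * (4 * L * gap I))); last by rewrite lerDl.
  apply: (@le_trans _ _ (\sum_(0 <= t < T) (4 * L * gap I))).
    rewrite big_nat_cond [leRHS]big_nat_cond; apply: ler_sum => t /andP[/andP[_ tT] _].
    by apply: early; exact: leq_trans (ltnW tT) Tt0.
  apply: le_trans (ler_sum_size _ (fun=> lexx _)) _; rewrite size_iota subn0.
  by apply: ler_wpM2r => //; rewrite ler_nat.
rewrite (big_cat_nat (n := t0))//=; last exact: ltnW.
apply: lerD.
  apply: (@le_trans _ _ (\sum_(0 <= t < t0) (4 * L * gap I))).
    rewrite big_nat_cond [leRHS]big_nat_cond; apply: ler_sum => t /andP[/andP[_ tT] _].
    by apply: early; exact: ltnW.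
  by apply: le_trans (ler_sum_size _ (fun=> lexx _)) _; rewrite size_iota subn0.
have nD : 1 <= n%:R :> R by rewrite ler1n.
have dD : 1 <= D%:R :> R by rewrite ler1n.
apply: (delayed_gradient_arithmetic (Se := \sum_(t0 <= t < T) ex P (fun w => sqn (V t w - n%:R *: Gr t w)))
  (Sv := \sum_(t0 <= t < T) v t) (ta := tau) L0 gamma0 nD dD gammaD) => //.
- by rewrite sumr_ge0.
- by rewrite /tau mulrA.
- have e t : ex P (fun w => dotp (Gr t w) (V t w)) * (2 * n%:R) =
      n%:R ^+ 2 * ex P (fun w => sqn (Gr t w)) + v t
      - ex P (fun w => sqn (V t w - n%:R *: Gr t w)).
    have iV : intb P (fun w => sqn (V t w)) by exact: vsqint_sqn.
    have iG : intb P (fun w => sqn (Gr t w)) by exact: vsqint_sqn.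
    have iD : intb P (fun w => dotp (Gr t w) (V t w)) by exact: vsqint_dotp.
    have -> : ex P (fun w => sqn (V t w - n%:R *: Gr t w)) =
        v t + (- (2 * n%:R)) * ex P (fun w => dotp (Gr t w) (V t w))
        + n%:R ^+ 2 * ex P (fun w => sqn (Gr t w)).
      have i1 := intbZ (- (2 * n%:R)) iD.
      rewrite -!exZ// -!exD//; [|exact: intbD|exact: intbZ].
      apply: eq_ex => w; rewrite sqnD -scaleNr dotpZr sqnZ sqrrN dotpC; lra.
    lra.
  have := descent_sum (ltnW t0T) => ds.
  rewrite mulr_sumr -big_split /= -sumrB -(eq_bigr _ (fun t _ => e t)) -mulr_suml.
  have nn0 : 0 < 2 * n%:R :> R by rewrite mulr_gt0.
  rewrite [X in gamma * X]mulrC mulrCA ler_pM2l//; apply: le_trans ds _.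
  rewrite lerD2l ler_pM2l ?mulr_gt0 ?exprn_gt0// lerD2l.
  by apply: ler_wpM2r => //; rewrite ler_nat leq_subr.
Qed.

End convergence.

(** * The random output time *)

Section random_output.
Context {R : realType}.

Lemma measurable_fun_prod_nat d d' (U : measurableType d) (U' : measurableType d')
    (F : U * nat -> U') :
  (forall s, measurable_fun setT (fun w => F (w, s))) -> measurable_fun setT F.
Proof.
move=> mF _ A mA; rewrite setTI.
have -> : F @^-1` A = \bigcup_s (((fun w => F (w, s)) @^-1` A) `*` [set s]).
  apply/seteqP; split=> [[w s] /= Fws|[w s] [u _ [/= Fwu ->]]] //.
  by exists s.
apply: bigcupT_measurable => s; apply: measurableX => //.
by have := mF s measurableT A mA; rewrite setTI.
Qed.

Lemma integral_uniform_below (T : nat) (f : nat -> \bar R) : (0 < T)%N ->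
  (forall s, 0 <= f s)%E ->
  (\int[uniform_below T]_s f s = (T%:R^-1)%:E * \sum_(s < T) f s)%E.
Proof.
move=> T0 f0; pose mu : {measure set nat -> \bar R} :=
  msum (fun k => dirac k : {measure set nat -> \bar R}) T.
have TR : 0 <= T%:R^-1 :> R by rewrite invr_ge0 ler0n.
have muT : mu setT = T%:R%:E.
  rewrite /mu /= /msum (eq_bigr (fun=> 1%E)); last by move=> i _; exact: diracT.
  by rewrite sumEFin sumr_const card_ord.
transitivity (\int[mscale (NngNum TR) mu]_s f s)%E.
  apply: eq_measure_integral => A _ _; rewrite /uniform_below /= /mnormalize /mscale.
  rewrite -/mu muT /= eqe pnatr_eq0 eqn0Ngt T0 /=.
  by rewrite muleC.
rewrite ge0_integral_mscale//; congr (_ * _)%E.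
rewrite ge0_integral_measure_sum//; apply: eq_bigr => s _.
by rewrite integral_dirac// diracT mul1e.
Qed.

Context {n : nat} (I : problem R n) (L sigma2 : R).
Hypothesis adm : admissible I L sigma2.
Hypothesis L0 : 0 < L.
Context (G : rel 'I_n) (r : 'I_n) (Dh : nat).
Hypothesis GG : graph_class Dh G.
Context (B : nat) (gam : nat -> R).
Hypothesis B0 : (0 < B)%N.
Let P := prob I.

(** The output time being uniform and independent of the samples, the expected
    gradient norm is the average over the rounds, and an average squared norm of
    at most eps^2 suffices. *)
Lemma vtree_expected_grad (T : nat) (eps : R) : (0 < T)%N -> 0 < eps ->
  \sum_(0 <= t < T) ex P (fun w => sqn (grad (avg_obj I) (root_iter G r B gam w t)))
    <= T%:R * eps ^+ 2 ->
  (expected_grad (vtree_protocol G r B gam (dim I) T) T <= eps%:E)%E.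
Proof.
move=> T0 eps0 sum_le.
have smI : smooth I L by case: adm => -[].
pose g t w := grad (avg_obj I) (root_iter G r B gam w t).
have sg t : vsqint P (g t).
  have -> : g t = (fun w => n%:R^-1 *: \sum_i agent_grad i (root_iter G r B gam w t)).
    by apply/funext => w; rewrite /g (grad_avg smI).
  apply: vsqintZ; apply: vsqint_sum => i _.
  exact: (agent_grad_vsqint adm L0 i (root_vsqint adm L0 r GG gam B0 t)).
(* A seed beyond the budget, of probability 0, leaves the output row at 0. *)
pose F (z : omega I * nat) := enorm (if (z.2 < T)%N then g z.2 z.1 else grad (avg_obj I) 0).
have FE z : enorm (grad (avg_obj I) (output (vtree_protocol G r B gam (dim I) T) z.2
    (states (vtree_protocol G r B gam (dim I) T) z.2 z.1 T))) = F z.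
  by rewrite vtree_output /F /g; case: ifP.
have mF : measurable_fun setT F.
  apply: measurable_fun_prod_nat => s; rewrite /F /=.
  case: (s < T)%N; last exact: measurable_cst.
  by apply: measurable_enorm; exact: vsqint_measurable.
rewrite /expected_grad; under eq_integral do rewrite FE.
have mFE : measurable_fun setT (fun z => (F z)%:E) by exact/measurable_EFinP.
have F0 z : (0 <= (F z)%:E)%E by rewrite lee_fin enorm_ge0.
rewrite (fubini_tonelli2 (m2 := uniform_below T) (fun z => (F z)%:E))//.
rewrite integral_uniform_below//; last by move=> s; apply: integral_ge0 => w _.
have term (s : 'I_T) : (\int[P]_w (F (w, s : nat))%:E)%E =
    (ex P (fun w => enorm (g s w)))%:E.
  rewrite /F /= ltn_ord exE//.
  have [] // := ex_le_of_sq (P := P) (X := fun w => enorm (g s w)) ltr01 (fun w => enorm_ge0 _).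
    by apply: measurable_enorm; exact: vsqint_measurable.
  by under eq_fun do rewrite enorm_sq; exact: vsqint_sqn.
rewrite (eq_bigr _ (fun s _ => term s)) sumEFin -EFinM lee_fin.
have bound (s : 'I_T) : ex P (fun w => enorm (g s w)) <=
    (ex P (fun w => sqn (g s w)) / eps + eps) / 2.
  have [] := ex_le_of_sq (P := P) (X := fun w => enorm (g s w)) eps0 (fun w => enorm_ge0 _).
  - by apply: measurable_enorm; exact: vsqint_measurable.
  - by under eq_fun do rewrite enorm_sq; exact: vsqint_sqn.
  - by move=> _; under [X in ex P X / _]eq_fun do rewrite enorm_sq.
have TR : 0 < T%:R :> R by rewrite ltr0n.
rewrite mulrC ler_pdivrMr//; apply: le_trans (ler_sum _ (fun s _ => bound s)) _.
rewrite -mulr_suml big_split /= -mulr_suml sumr_const card_ord -[eps *+ T]mulr_natl.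
rewrite big_mkord in sum_le.
have : (\sum_(s < T) ex P (fun w => sqn (g s w))) / eps <= T%:R * eps.
  by rewrite ler_pdivrMr// -mulrA -expr2.
by move=> hs; lra.
Qed.

End random_output.

(** * Round complexity of the tree algorithms *)

Section upper_bounds.
Context {R : realType}.

Lemma stepsize_gt0 n D B T (Df L sigma2 : R) : (0 < n)%N -> (0 < D)%N ->
  (0 < B)%N -> (0 < T)%N -> 0 < Df -> 0 < L -> 0 < sigma2 ->
  0 < stepsize n D B T Df L sigma2.
Proof.
move=> n0 D0 B0 T0 Df0 L0 s0; rewrite /stepsize lt_min invr_gt0 !mulr_gt0 ?ltr0n//.
all: by rewrite ?invr_gt0 sqrtr_gt0 !mulr_gt0 ?ltr0n.
Qed.

(** With this step the descent term and the noise term are both of order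
    sqrt (T Df L sigma2 / (n B)), up to the term due to the cap on the step. *)
Lemma stepsize_balance n D B T (Df L sigma2 eps gp H : R) (t0 : nat) :
  (0 < n)%N -> (0 < D)%N -> (0 < B)%N -> (0 < T)%N ->
  0 < Df -> 0 < L -> 0 < sigma2 -> 0 < eps -> 0 <= gp <= Df -> 0 <= H -> (t0 <= D)%N ->
  196 * Df * L * sigma2 / (n%:R * B%:R * eps ^+ 4) <= T%:R ->
  (168 * Df * L + 4 * H) * D%:R / eps ^+ 2 <= T%:R ->
  forall gamma, gamma = stepsize n D B T Df L sigma2 ->
  t0%:R * (4 * L * gp) + (2 * gp / (gamma * n%:R) + 2 * (D - t0)%:R * H
    + 5 * L * gamma * T%:R * (sigma2 / B%:R)) <= T%:R * eps ^+ 2.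
Proof.
move=> n0 D0 B0 T0 Df0 L0 s0 e0 /andP[g0 gDf] H0 t0D T1 T2 gamma gammaE.
have gam0 : 0 < gamma by rewrite gammaE; exact: stepsize_gt0.
have nR : 0 < n%:R :> R by rewrite ltr0n.
have BR : 0 < B%:R :> R by rewrite ltr0n.
have TR : 0 < T%:R :> R by rewrite ltr0n.
have DR : 0 < D%:R :> R by rewrite ltr0n.
pose a := Num.sqrt (B%:R * Df); pose b := Num.sqrt (n%:R * T%:R * L * sigma2).
have a0 : 0 < a by rewrite sqrtr_gt0 mulr_gt0.
have b0 : 0 < b by rewrite sqrtr_gt0 !mulr_gt0.
have a2 : a ^+ 2 = B%:R * Df by rewrite sqr_sqrtr// ltW// mulr_gt0.
have b2 : b ^+ 2 = n%:R * T%:R * L * sigma2 by rewrite sqr_sqrtr// ltW// !mulr_gt0.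
pose K := 40 * n%:R * D%:R * L.
have K0 : 0 < K by rewrite !mulr_gt0.
have gab : gamma <= a / b by rewrite gammaE ge_min lexx.
have ginv : gamma^-1 <= b / a + K.
  have [h|h] := leP (a / b) K^-1.
    have -> : gamma = a / b by rewrite gammaE /stepsize -/a -/b -/K min_l.
    by rewrite invf_div lerDl ltW.
  have -> : gamma = K^-1 by rewrite gammaE /stepsize -/a -/b -/K min_r// ltW.
  by rewrite invrK lerDr ltW// divr_gt0.
pose M := a * b / (n%:R * B%:R).
have M0 : 0 < M by rewrite divr_gt0 ?mulr_gt0.
have nn : n%:R * n%:R^-1 = 1 :> R by rewrite divff// lt0r_neq0.
have BB : B%:R * B%:R^-1 = 1 :> R by rewrite divff// lt0r_neq0.
have aa : a * a^-1 = 1 by rewrite divff// lt0r_neq0.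
have bb : b * b^-1 = 1 by rewrite divff// lt0r_neq0.
have h1 : Df * (b / a) / n%:R = M.
  rewrite /M invfM; transitivity (Df * (B%:R * B%:R^-1) * b * a^-1 * n%:R^-1).
    by rewrite BB; lra.
  transitivity (a ^+ 2 * B%:R^-1 * b * a^-1 * n%:R^-1); first by rewrite a2; lra.
  transitivity (a * B%:R^-1 * b * (a * a^-1) * n%:R^-1); first by lra.
  by rewrite aa; lra.
have h2 : L * (a / b) * T%:R * (sigma2 / B%:R) = M.
  rewrite /M invfM; transitivity ((n%:R * n%:R^-1) * L * (a / b) * T%:R * (sigma2 / B%:R)).
    by rewrite nn; lra.
  transitivity (b ^+ 2 * n%:R^-1 * (a / b) * B%:R^-1); first by rewrite b2; lra.
  transitivity (b * n%:R^-1 * a * (b * b^-1) * B%:R^-1); first by lra.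
  by rewrite bb; lra.
have M_le : 14 * M <= T%:R * eps ^+ 2.
  have e4 : 0 < n%:R * B%:R * eps ^+ 4 by rewrite !mulr_gt0// exprn_gt0.
  move: T1; rewrite ler_pdivrMr// => T1.
  have p1 : 0 <= 14 * M by rewrite mulr_ge0// ltW.
  have p2 : 0 <= T%:R * eps ^+ 2 by rewrite mulr_ge0 ?sqr_ge0// ltW.
  suff : (14 * M) ^+ 2 <= (T%:R * eps ^+ 2) ^+ 2 by rewrite ler_pXn2r ?nnegrE.
  have -> : (14 * M) ^+ 2 = 196 * (a ^+ 2 * b ^+ 2) / (n%:R * B%:R) ^+ 2.
    by rewrite /M -exprVn; lra.
  rewrite ler_pdivrMr ?exprn_gt0 ?mulr_gt0// a2 b2.
  have := ler_wpM2l (ltW (mulr_gt0 (mulr_gt0 BR nR) TR)) T1.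
  by move=> hT; lra.
have descent : 2 * gp / (gamma * n%:R) <= 2 * M + 80 * Df * L * D%:R.
  apply: (@le_trans _ _ (2 * (Df * (b / a + K) / n%:R))).
    have hg : gp * gamma^-1 <= Df * (b / a + K).
      by apply: ler_pM => //; rewrite invr_ge0 ltW.
    have -> : 2 * gp / (gamma * n%:R) = 2 * (gp * gamma^-1 / n%:R) by rewrite invfM; lra.
    by rewrite ler_pM2l// ler_pM2r ?invr_gt0.
  rewrite mulrDr mulrDl h1 mulrDr lerD2l le_eqVlt; apply/orP; left; apply/eqP.
  transitivity (80 * Df * L * D%:R * (n%:R * n%:R^-1)); first by rewrite /K; lra.
  by rewrite nn mulr1.
have noise_ : 5 * L * gamma * T%:R * (sigma2 / B%:R) <= 5 * M.
  rewrite -h2 -!mulrA ler_pM2l// ler_pM2l// [leRHS]mulrA; apply: ler_wpM2r => //.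
  by apply: mulr_ge0; [exact: ltW|apply: divr_ge0; exact: ltW].
have T2' : (168 * Df * L + 4 * H) * D%:R <= T%:R * eps ^+ 2.
  by move: T2; rewrite ler_pdivrMr// exprn_gt0.
have start_ : t0%:R * (4 * L * gp) <= 4 * Df * L * D%:R.
  apply: (@le_trans _ _ (D%:R * (4 * L * Df))); last by lra.
  apply: ler_pM; rewrite ?ler0n ?ler_nat// ?ler_pM2l ?mulr_gt0//.
  by rewrite !mulr_ge0// ltW.
have energy : 2 * (D - t0)%:R * H <= 2 * H * D%:R.
  rewrite -mulrA -[leRHS]mulrA ler_pM2l// mulrC; apply: ler_wpM2l => //.
  by rewrite ler_nat leq_subr.
lra.
Qed.

(** Without warm start, once the stepsize balances the two terms, H enters only
    through the rounds in which the gradients of the deep agents have not yet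
    reached the root; with a warm start of D rounds it does not enter at all. *)
Lemma tree_round_complexity n (I : problem R n) (Df L sigma2 : R) G (r : 'I_n)
    Dh B T t0 (eps : R) (D := tree_depth G r) :
  (1 < n)%N -> (0 < B)%N -> (0 < T)%N -> 0 < Df -> 0 < L -> 0 < sigma2 -> 0 < eps ->
  admissible I L sigma2 -> gap I <= Df -> graph_class Dh G -> (t0 <= D)%N ->
  196 * Df * L * sigma2 / (n%:R * B%:R * eps ^+ 4) <= T%:R ->
  (168 * Df * L + (t0 < D)%N%:R * (4 * grad_energy I)) * Dh%:R / eps ^+ 2 <= T%:R ->
  (expected_grad (vtree_protocol G r B
     (delayed_start t0 (stepsize n D B T Df L sigma2)) (dim I) T) T <= eps%:E)%E.
Proof.
move=> n1 B0 T0 Df0 L0 s0 e0 adm gDf GG t0D T1 T2.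
have D0 : (0 < D)%N by exact: (@depth_gt0 _ _ _ _ GG).
have n0 := ltnW n1.
set gamma := stepsize _ _ _ _ _ _ _.
have gam0 : 0 < gamma by exact: stepsize_gt0.
have lbI : has_lbound (range (avg_obj I)) by case: adm => -[].
have g0 : 0 <= gap I by rewrite /gap subr_ge0; exact: avg_ge_inf.
have H0 : 0 <= grad_energy I.
  by rewrite mulr_ge0 ?invr_ge0 ?ler0n// sumr_ge0// => i _; rewrite sqr_ge0.
apply: (@vtree_expected_grad _ _ _ _ _ adm L0 _ _ _ GG _ _ B0 _ _ T0 e0).
have K0 : 0 < 40 * n%:R * D%:R * L by rewrite !mulr_gt0 ?ltr0n.
have gD : 40 * n%:R * D%:R * L * gamma <= 1.
  by rewrite -[leRHS](divff (lt0r_neq0 K0)) ler_pM2l// ge_min lexx orbT.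
have := grad_sum_le adm L0 GG t0 T B0 D0 (level_le_depth G r) gam0 gD.
move=> le; apply: le_trans le _.
pose H := (t0 < D)%N%:R * grad_energy I.
have -> : 2 * (D - t0)%:R * grad_energy I = 2 * (D - t0)%:R * H.
  rewrite /H; case: ltnP => [_|]; first by rewrite mul1r.
  by rewrite -subn_eq0 => /eqP ->; rewrite mulr0 !mul0r.
apply: (stepsize_balance (Df := Df) (eps := eps) (gp := gap I) (H := H) n0 D0 B0 T0
  Df0 L0 s0 e0 _ _ t0D T1 _ erefl).
- by rewrite g0.
- by rewrite mulr_ge0.
apply: le_trans T2; rewrite ler_pM2r ?invr_gt0 ?exprn_gt0//.
rewrite (_ : 4 * H = (t0 < D)%N%:R * (4 * grad_energy I)); last by rewrite /H; lra.
apply: ler_wpM2l; last by rewrite ler_nat (@depth_le _ _ _ _ GG).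
apply: addr_ge0; first by rewrite !mulr_ge0// ltW.
by apply: mulr_ge0 => //; exact: mulr_ge0.
Qed.

Lemma round_complexity_le n B (M : method R n B) G (I : problem R n) (eps x : R) T :
  (0 < T)%N -> (expected_grad (M G (dim I) T) T <= eps%:E)%E -> T%:R <= x ->
  (round_complexity M G I eps <= x%:E)%E.
Proof.
move=> T0 eg Tx; apply: (@le_trans _ _ (T%:R)%:E); last by rewrite lee_fin.
by apply: ereal_inf_lbound; exists T.
Qed.

Lemma truncS_bounds (x : R) : 0 <= x ->
  x <= (Num.truncn x).+1%:R /\ (Num.truncn x).+1%:R <= x + 1.
Proof.
move=> x0; have /andP[h1 h2] := truncn_itv x0; split; first exact: ltW.
by rewrite -natr1 lerD2r.
Qed.

Definition round_const (Df L sigma2 H : R) : R :=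
  196 * Df * L * sigma2 + 168 * Df * L + 4 * H + 1.

Lemma round_const_gt0 (Df L sigma2 H : R) :
  0 < Df -> 0 < L -> 0 < sigma2 -> 0 <= H -> 0 < round_const Df L sigma2 H.
Proof.
move=> Df0 L0 s0 H0; have h1 := mulr_gt0 Df0 L0; have h2 := mulr_gt0 h1 s0.
rewrite /round_const; lra.
Qed.

Lemma treeRGT_vtree n (hn : (1 < n)%N) B (Df L sigma2 : R) G p T :
  treeRGT hn B Df L sigma2 G p T =
  vtree_protocol G (root hn) B (delayed_start 0
    (stepsize n (tree_depth G (root hn)) B T Df L sigma2)) p T.
Proof. by []. Qed.

Lemma treeRGT_round_complexity n (hn : (1 < n)%N) Dh B (I : problem R n)
    (Df L sigma2 H eps : R) G :
  0 < Df -> 0 < L -> 0 < sigma2 -> 0 <= H -> (1 <= Dh)%N -> (0 < B)%N ->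
  admissible I L sigma2 -> gap I = Df -> grad_energy I = H -> 0 < eps <= 1 ->
  graph_class Dh G ->
  (round_complexity (treeRGT hn B Df L sigma2) G I eps <=
    (round_const Df L sigma2 H *
     ((n%:R * B%:R * eps ^+ 4)^-1 + Dh%:R / eps ^+ 2))%:E)%E.
Proof.
move=> Df0 L0 s0 H0 Dh0 B0 adm gI HI /andP[e0 e1] GG.
pose r1 := (n%:R * B%:R * eps ^+ 4)^-1; pose r2 := Dh%:R / eps ^+ 2.
have r1_0 : 0 <= r1 by rewrite invr_ge0 mulr_ge0 ?exprn_ge0 ?(ltW e0)// mulr_ge0 ?ler0n.
have r2_1 : 1 <= r2.
  rewrite ler_pdivlMr ?exprn_gt0// mul1r; apply: (@le_trans _ _ 1); last by rewrite ler1n.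
  by rewrite expr_le1// ltW.
(* The second term of the rate is at least 1 and absorbs the rounding of T. *)
pose c := 196 * Df * L * sigma2 + 168 * Df * L + 4 * H.
have c1 : 0 <= 196 * Df * L * sigma2 by rewrite !mulr_ge0// ltW.
have c2 : 0 <= 168 * Df * L + 4 * H by rewrite addr_ge0 ?mulr_ge0// ltW.
have c0 : 0 <= c by rewrite /c -addrA addr_ge0.
have x0 : 0 <= c * (r1 + r2) by rewrite mulr_ge0// addr_ge0//; lra.
have [T1 T2] := truncS_bounds x0; set T := (Num.truncn _).+1 in T1 T2.
apply: (@round_complexity_le _ _ _ _ _ _ _ T) => //; last first.
  by apply: le_trans T2 _; rewrite -/r1 -/r2 /round_const -/c; lra.
rewrite treeRGT_vtree; apply: (tree_round_complexity (Dh := Dh)) => //.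
- by rewrite gI.
- by apply: le_trans T1; rewrite -/r1 /c; nra.
- rewrite (@depth_gt0 _ _ _ _ GG)// mul1r HI -mulrA -/r2; apply: le_trans T1.
  by rewrite /c; nra.
Qed.

Lemma treeRGT_in_class n (hn : (1 < n)%N) Dh B (Df L sigma2 : R) :
  in_method_class Dh (treeRGT hn B Df L sigma2).
Proof.
move=> G GG p T; rewrite treeRGT_vtree; split.
- exact: vtree_one_hop GG.
- exact: vtree_zero_respecting GG.
- exact: vtree_measurable.
Qed.

(** Tree-RGT with a warm start: the root waits until the gradients of all the
    agents at the common starting point have reached it. *)
Definition warm_tree n (r : 'I_n) B (Df L sigma2 : R) : method R n B :=
  fun G p T => vtree_protocol G r B (delayed_start (tree_depth G r)
    (stepsize n (tree_depth G r) B T Df L sigma2)) p T.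

(** The bound for the warm start involves no quantity that is unbounded over the
    admissible instances with parameters Delta, L, sigma2. *)
Lemma minimax_le n Dh B (Delta L sigma2 eps : R) :
  (1 < n)%N -> (1 <= Dh)%N -> (0 < B)%N -> 0 < Delta -> 0 < L -> 0 < sigma2 ->
  0 < eps -> eps ^+ 2 <= Delta * L ->
  (minimax n Dh B Delta L sigma2 eps <=
   (197 * (Delta * L * sigma2 / (n%:R * B%:R * eps ^+ 4)
           + Delta * L * Dh%:R / eps ^+ 2))%:E)%E.
Proof.
move=> n1 Dh0 B0 De0 L0 s0 e0 eDL.
have r := Ordinal (ltnW n1).
apply: (@le_trans _ _ (ereal_sup [set u | exists2 I : problem R n,
          admissible I L sigma2 /\ gap I <= Delta
        & u = worst_case (warm_tree r B Delta L sigma2) Dh I eps])).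
  apply: ereal_inf_lbound; exists (warm_tree r B Delta L sigma2) => //.
  move=> G GG p T; split.
  - exact: vtree_one_hop GG.
  - exact: vtree_zero_respecting GG.
  - exact: vtree_measurable.
apply: ge_ereal_sup => _ [I [adm gI] ->].
apply: ge_ereal_sup => _ [G GG <-].
pose r1 := Delta * L * sigma2 / (n%:R * B%:R * eps ^+ 4).
pose r2 := Delta * L * Dh%:R / eps ^+ 2.
have r1_0 : 0 <= r1.
  by rewrite divr_ge0 ?mulr_ge0 ?ler0n ?exprn_ge0// ltW.
have r2_1 : 1 <= r2.
  rewrite ler_pdivlMr ?exprn_gt0// mul1r; apply: le_trans eDL _.
  by rewrite ler_peMr ?ler1n// mulr_ge0// ltW.
have x0 : 0 <= 196 * (r1 + r2) by lra.
have [T1 T2] := truncS_bounds x0; set T := (Num.truncn _).+1 in T1 T2.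
apply: (@round_complexity_le _ _ _ _ _ _ _ T) => //; last first.
  by apply: le_trans T2 _; rewrite -/r1 -/r2; lra.
apply: (tree_round_complexity (Dh := Dh)) => //.
- have -> : 196 * Delta * L * sigma2 / (n%:R * B%:R * eps ^+ 4) = 196 * r1.
    by rewrite /r1; lra.
  by apply: le_trans T1; lra.
- rewrite ltnn mul0r addr0.
  have -> : 168 * Delta * L * Dh%:R / eps ^+ 2 = 168 * r2 by rewrite /r2; lra.
  by apply: le_trans T1; lra.
Qed.

End upper_bounds.

(** * A graph with two distant large groups *)

Section band_graph.
Variables (n Dh : nat).
Hypotheses (n1 : (1 < n)%N) (Dh0 : (0 < Dh)%N) (Dhn : (Dh <= n.-1)%N).

(** The agents stand in a line with positions 0, ..., Dh, one agent in each inner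
    position; those in excess share the two extreme positions evenly. *)
Definition band_pos (i : nat) : nat := minn (i - (n - Dh.+1)./2) Dh.

Definition band : rel 'I_n := fun i j =>
  [&& i != j, (band_pos i <= (band_pos j).+1)%N & (band_pos j <= (band_pos i).+1)%N].

Let ord k : 'I_n := odflt (Ordinal (ltnW n1)) (insub k).

Let ord_val k : (k < n)%N -> ord k = k :> nat.
Proof. by move=> kn; rewrite /ord insubT. Qed.

Let band_pos_surj k : (k <= Dh)%N -> exists i : 'I_n, band_pos i = k.
Proof.
move=> kD; exists (ord (k + (n - Dh.+1)./2)).
have h : (k + (n - Dh.+1)./2 < n)%N.
  by move: kD Dhn n1; clear; lia.
by rewrite ord_val// /band_pos addnK; apply/minn_idPl.
Qed.

Lemma band_pos_path i s : path band i s ->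
  (band_pos (last i s) <= band_pos i + size s)%N.
Proof.
elim: s i => [|j s IH] i; first by rewrite addn0.
by move=> /= /andP[/and3P[_ _ h] /IH]; lia.
Qed.

Let band_sym : symmetric band.
Proof.
by move=> i j; rewrite /band eq_sym; congr (_ && _); rewrite andbC.
Qed.

(** Moving one position at a time, any agent is reached within the difference of
    the positions, or in one round when the positions agree. *)
Let band_walk_up (i j : 'I_n) m : band_pos j = (band_pos i + m.+1)%N ->
  exists s, [/\ path band i s, last i s = j & size s = m.+1].
Proof.
elim: m i => [|m IH] i pij.
  exists [:: j]; rewrite /= /band pij; split=> //.
  rewrite andbT; apply/and3P; split; try (by clear; lia).
  by apply/eqP => ij; move: pij; rewrite ij; clear; lia.
have [k kE] : exists k : 'I_n, band_pos k = (band_pos i).+1.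
  by apply: band_pos_surj; move: (geq_minr _ _ : (band_pos j <= Dh)%N); lia.
have [|s [ps ls ss]] := IH k; first by rewrite kE pij; clear; lia.
exists (k :: s); rewrite /= ps ls ss andbT; split=> //.
rewrite /band kE; apply/and3P; split; try (by clear; lia).
by apply/eqP => ij; move: kE; rewrite ij; clear; lia.
Qed.

Let band_walk (i j : 'I_n) :
  exists s, [/\ path band i s, last i s = j & (size s <= Dh)%N].
Proof.
have posD k : (band_pos k <= Dh)%N by exact: geq_minr.
have [/eqP -> |ij] := boolP (i == j); first by exists [::].
have [ji|ij'|pij] := ltngtP (band_pos j) (band_pos i).
- have [s [ps ls ss]] := band_walk_up (i := j) (j := i)
    (m := (band_pos i - band_pos j).-1) ltac:(lia).
  have := rev_path band j s; rewrite ls => rp.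
  exists (rev (belast j s)); rewrite rp; split.
  + by rewrite (eq_path (e' := band)) // => x y /=; rewrite band_sym.
  + case: s {rp ps ss} ls => [/= ->//|x s] ls.
    by rewrite /= rev_cons last_rcons.
  + by rewrite size_rev size_belast ss; have := posD i; lia.
- have [s [ps ls ss]] := band_walk_up (i := i) (j := j)
    (m := (band_pos j - band_pos i).-1) ltac:(lia).
  by exists s; rewrite ps ls ss; split=> //; have := posD j; lia.
- exists [:: j]; rewrite /= /band ij pij; split=> //.
  by rewrite leqnSn.
Qed.

Lemma band_class : graph_class Dh band.
Proof.
have Dhn' : (Dh < n)%N by lia.
have conn i j : connect band i j.
  by have [s [ps ls _]] := band_walk i j; apply/connectP; exists s.
split=> //; first by move=> i; rewrite /band eqxx.
apply/eqP; rewrite eqn_leq; apply/andP; split.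
  apply/bigmax_leqP => i _; apply/bigmax_leqP => j _.
  have [s [ps ls ss]] := band_walk i j.
  rewrite leqNgt; apply/negP => lt.
  have := before_find 0%N (leq_ltn_trans ss lt).
  rewrite nth_iota ?add0n; last exact: leq_ltn_trans ss Dhn'.
  by move/existsP; apply; exists (in_tuple s); rewrite ps ls eqxx.
have [i i0] := band_pos_surj (leq0n Dh).
have [j jD] := band_pos_surj (leqnn Dh).
have [_ [s [ps ls ss]]] := gdist_walk (conn i j).
apply: (@leq_trans (gdist band i j)).
  by rewrite -ss -jD -ls; have := band_pos_path ps; rewrite i0.
apply: leq_trans (leq_bigmax_cond (F := fun i => \max_j gdist band i j) i isT).
exact: (leq_bigmax_cond (F := fun j => gdist band i j) j isT).
Qed.

(** Two groups that contain at least a sixth of the agents each, at a distance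
    [band_sep] of at least a third of the diameter. *)
Definition band_end (c : bool) : pred 'I_n := fun i =>
  if c then (Dh - Dh %/ 3 <= band_pos i)%N else (band_pos i <= Dh %/ 3)%N.

Definition band_sep : nat := Dh - (Dh %/ 3).*2.

Definition band_height (i : 'I_n) : nat := minn (band_pos i - Dh %/ 3) band_sep.

Lemma band_sep_ge : (Dh <= 3 * band_sep)%N.
Proof. rewrite /band_sep; lia. Qed.

Lemma band_height_le i : (band_height i <= band_sep)%N.
Proof. exact: geq_minr. Qed.

Lemma band_height_edge i j : band i j -> (band_height j <= (band_height i).+1)%N.
Proof. by move=> /and3P[_ _]; rewrite /band_height; lia. Qed.

Lemma band_height_end c i : i \in band_end c ->
  band_height i = if c then band_sep else 0%N.
Proof.
rewrite -topredE /= /band_end.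
move: (geq_minr _ _ : (band_pos i <= Dh)%N).
by case: c; rewrite /band_height /band_sep; lia.
Qed.

Lemma band_end_card c : (n <= 6 * #|band_end c|)%N.
Proof.
set s := (n - Dh.+1)./2.
have s2 : (n <= s.*2 + Dh.+2 /\ s.*2 + Dh.+1 <= n)%N.
  have Dhn' : (Dh < n)%N by lia.
  by have := odd_double_half (n - Dh.+1); rewrite -/s; case: odd => /=; lia.
have cardge (f : nat -> nat) k (A : pred 'I_n) :
    injective f -> (forall a, (a < k)%N -> (f a < n)%N /\ ord (f a) \in A) ->
    (k <= #|A|)%N.
  move=> fi h; rewrite -[leqLHS]card_ord -(@card_in_image _ _ (fun a : 'I_k => ord (f a)) predT).
    apply: subset_leq_card; apply/fintype.subsetP => x.
    move=> /(@mapP _ _ (fun a : 'I_k => ord (f a)))[a _ ->].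
    exact: (h a (ltn_ord a)).2.
  move=> a b _ _ /(congr1 val) /=; rewrite !ord_val; try exact: (h _ (ltn_ord _)).1.
  by move/fi/val_inj.
have k0 : (s + Dh %/ 3 + 1 <= #|band_end c|)%N.
  case: c; last first.
    apply: (cardge id) => // a ak; have an : (a < n)%N by lia.
    by split=> //; rewrite -topredE /= /band_end ord_val// /band_pos -/s; lia.
  apply: (cardge (fun a => s + Dh - Dh %/ 3 + a)%N); first by move=> a b /=; lia.
  move=> a ak; have an : (s + Dh - Dh %/ 3 + a < n)%N by lia.
  by split=> //; rewrite -topredE /= /band_end ord_val// /band_pos -/s; lia.
lia.
Qed.

End band_graph.

(** * Independent coins from the digits of a uniform point *)

Section bernoulli_sequence.
Context {R : realType} (Q : nat).
Hypothesis Q0 : (0 < Q)%N.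

Notation P := (uniform_prob (@ltr01 R)).

(** The digits of a uniform point of [0, 1] in base Q are independent and uniform;
    [cell N x] encodes the first N of them as a number below Q ^ N, and
    [zero_digit k] tests the digit of rank k. *)
Definition cell N (x : R) : nat := Num.truncn (Q%:R ^+ N * x).

Definition zero_digit k (x : measurableTypeR R) : bool := (cell k.+1 x %% Q == 0)%N.

Let QR : 0 < Q%:R :> R.
Proof. by rewrite ltr0n. Qed.

(** Dropping the last digit. *)
Lemma cellS N x : cell N x = (cell N.+1 x %/ Q)%N.
Proof.
have key k : (k < cell N x)%N = (k < cell N.+1 x %/ Q)%N.
  rewrite [RHS]leq_divRL// /cell truncn_gt_nat.
  rewrite -[(k.+1 * Q)%N]prednK ?muln_gt0// truncn_gt_nat prednK ?muln_gt0//.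
  by rewrite natrM exprS -mulrA [k.+1%:R * _]mulrC ler_pM2l.
move: (cell N x) (cell N.+1 x %/ Q)%N key => a b key.
by case: (ltngtP a b) (key a) (key b) => //; rewrite !ltnn.
Qed.

Lemma measurable_cell N m : measurable [set x : measurableTypeR R | cell N x = m].
Proof.
have mc : measurable_fun setT (fun x : measurableTypeR R => Q%:R ^+ N * x : R).
  by apply: measurable_funM => //; exact: measurable_id.
rewrite (_ : mkset _ = (fun x : R => Q%:R ^+ N * x) @^-1`
  (if m is k.+1 then `[m%:R, m.+1%:R[%classic else `]-oo, 1[%classic)).
  by rewrite -[X in measurable X]setTI; apply: mc => //; case: m.
apply/seteqP; split=> x /=; case: m => [|m]; rewrite /= in_itv /=.
- by move=> h; rewrite -[ltRHS]/(0.+1%:R) -truncn_le_nat -/(cell N x) h.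
- by move=> h; rewrite -truncn_gt_nat -truncn_le_nat -/(cell N x) h ltnS !leqnn.
- by rewrite -[ltRHS]/(0.+1%:R) -truncn_le_nat leqn0 => /eqP.
- rewrite -truncn_gt_nat -truncn_le_nat -/(cell N x) => /andP[h1 h2].
  by apply/eqP; rewrite eqn_leq h2.
Qed.

Lemma measurable_zero_digit k : measurable_fun setT (zero_digit k).
Proof.
apply: (measurable_fun_bool true); rewrite setTI.
rewrite (_ : _ @^-1` _ = \bigcup_m [set x : measurableTypeR R | cell k.+1 x = (m * Q)%N]).
  by apply: bigcup_measurable => m _; exact: measurable_cell.
apply/seteqP; split=> x; rewrite /= /zero_digit.
  by move=> /eqP h; exists (cell k.+1 x %/ Q)%N => //=; rewrite [LHS](divn_eq _ Q) h addn0.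
by move=> [m _ /= ->]; rewrite modnMl.
Qed.

Lemma prob_cell N m : (m < Q ^ N)%N ->
  P [set x : measurableTypeR R | cell N x = m] = ((Q%:R ^+ N)^-1)%:E.
Proof.
move=> mQ; rewrite /uniform_prob integral_uniform_pdf.
have q0 : 0 < Q%:R ^+ N :> R by rewrite exprn_gt0.
have mq : m.+1%:R <= Q%:R ^+ N :> R by rewrite -natrX ler_nat.
rewrite (_ : _ `&` _ = `[m%:R / Q%:R ^+ N, m.+1%:R / Q%:R ^+ N[%classic); last first.
  apply/seteqP; split=> x /=; rewrite !in_itv /= ler_pdivrMr// ltr_pdivlMr//.
    move=> [h /andP[x0 x1]]; rewrite mulrC -truncn_eq ?mulr_ge0 ?(ltW q0)//.
    exact/eqP.
  move=> /andP[h1 h2]; split; first by apply: truncn_def; rewrite mulrC h1.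
  rewrite -[0 <= x](pmulr_lge0 _ q0) (le_trans _ h1)//=.
  by rewrite -(ler_pM2r q0) mul1r (le_trans (ltW h2)).
rewrite (eq_integral (fun=> 1%E)); last first.
  move=> x; rewrite inE /= in_itv /= ler_pdivrMr// ltr_pdivlMr// => /andP[h1 h2].
  rewrite /uniform_pdf subr0 invr1 ifT//.
  rewrite -[0 <= x](pmulr_lge0 _ q0) (le_trans _ h1)//=.
  by rewrite -(ler_pM2r q0) mul1r (le_trans (ltW h2)).
rewrite integral_cst//= mul1e lebesgue_measure_itv /= lte_fin.
rewrite ltr_pM2r ?invr_gt0// ltr_nat ltnS leqnn -EFinB -mulrBl -natrB ?leqnSn//.
by rewrite subSnn mul1r.
Qed.

Definition digit_event (S : nat -> pred bool) N m k : set (measurableTypeR R) :=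
  [set x | cell N x = m /\ forall j, (N <= j < N + k)%N -> S j (zero_digit j x)].

(** The probability that a uniform digit passes the test S, which is only told
    whether the digit is 0. *)
Definition digit_weight (S : pred bool) : R :=
  Q%:R^-1 * (S true)%:R + (1 - Q%:R^-1) * (S false)%:R.

(** Splitting according to the digit of rank N. *)
Lemma digit_eventS S N m k :
  digit_event S N m k.+1 = \big[setU/set0]_(a < Q)
    (if S N (a == 0%N :> nat) then digit_event S N.+1 (m * Q + a) k else set0).
Proof.
apply/seteqP; split=> x.
  move=> [xm h]; rewrite -bigcup_seq; have aQ := ltn_pmod (cell N.+1 x) Q0.
  exists (Ordinal aQ); rewrite /= ?mem_index_enum//.
  have := h N; rewrite leqnn addnS ltnS leq_addr => /(_ isT); rewrite /zero_digit => ->.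
  split; first by rewrite -xm (cellS N) -divn_eq.
  by move=> j /andP[j1 j2]; apply: h; rewrite (ltnW j1) addnS -addSn.
rewrite -bigcup_seq => -[a _]; case Sa : (S N _) => // -[xa h].
have xm : cell N x = m by rewrite cellS xa divnMDl// divn_small ?addn0.
split=> // j /andP[]; rewrite leq_eqVlt => /predU1P[<- _|j1 j2].
  by rewrite /zero_digit xa modnMDl modn_small.
by apply: h; rewrite j1 addSn -addnS.
Qed.

Lemma measurable_digit_event S N m k : measurable (digit_event S N m k).
Proof.
elim: k N m => [|k IH] N m.
  rewrite (_ : digit_event _ _ _ _ = [set x | cell N x = m]).
    exact: measurable_cell.
  by apply/seteqP; split=> x; [case|move=> h; split=> // j; lia].
rewrite digit_eventS; apply: bigsetU_measurable => a _.
by case: ifP => // _; exact: IH.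
Qed.

(** Conditionally on the first N digits, the next digit is uniform. *)
Lemma prob_digit_event S N m k : (m < Q ^ N)%N ->
  P (digit_event S N m k) =
  ((Q%:R ^+ N)^-1 * \prod_(N <= j < N + k) digit_weight (S j))%:E.
Proof.
elim: k N m => [|k IH] N m mQ.
  rewrite addn0 big_geq// mulr1 -(prob_cell mQ); congr (P _).
  by apply/seteqP; split=> x; [case|move=> h; split=> // j; lia].
have aQ (a : 'I_Q) : (m * Q + a < Q ^ N.+1)%N.
  apply: (@leq_trans (m * Q + Q)); first by rewrite ltn_add2l.
  by rewrite -mulSnr expnSr leq_mul2r mQ orbT.
rewrite digit_eventS measure_semi_additive_ord; last 3 first.
- by move=> a; case: ifP => // _; exact: measurable_digit_event.
- apply/trivIsetP => a b _ _ ab; apply/seteqP; split=> // x [].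
  case: ifP => // _ [xa _]; case: ifP => // _ [xb _].
  case/eqP: ab; apply/val_inj/eqP => /=.
  by rewrite -(eqn_add2l (m * Q)) -xa -xb.
- apply: bigsetU_measurable => a _.
  by case: ifP => // _; exact: measurable_digit_event.
pose Pi := \prod_(N.+1 <= j < N.+1 + k) digit_weight (S j).
rewrite (eq_bigr (fun a : 'I_Q => ((Q%:R ^+ N.+1)^-1 * Pi * (S N (a == 0%N :> nat))%:R)%:E)); last first.
  move=> a _; case: ifP => _; last by rewrite mulr0 measure0.
  by rewrite mulr1; exact: IH.
rewrite sumEFin -mulr_sumr; congr (_%:E).
rewrite [in RHS]addnS big_ltn_cond/=; last by lia.
rewrite -addSn -/Pi exprSr invfM mulrA -!mulrA; congr (_ * _).
rewrite mulrCA [RHS]mulrC; congr (_ * _).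
rewrite /digit_weight; case: Q QR => [|q] qR; first by move: qR; rewrite ltxx.
rewrite big_ord_recl /= (eq_bigr (fun=> (S N false)%:R)) // sumr_const card_ord.
rewrite mulrDr; congr (_ + _); rewrite -[_ *+ q]mulr_natl mulrA; congr (_ * _).
rewrite -[X in X - _](mulVf (lt0r_neq0 qR)) -[X in _ = _ - X]mulr1 -mulrBr.
by rewrite -[X in _ = _ * (X - _)]natr1 addrK.
Qed.

Lemma prob_digits (S : nat -> pred bool) N :
  P [set x | forall j, (j < N)%N -> S j (zero_digit j x)] =
  (\prod_(j < N) digit_weight (S j))%:E.
Proof.
have P0 : P [set x : measurableTypeR R | cell 0 x = 0%N] = 1%E.
  by rewrite prob_cell// expr0 invr1.
have mE : measurable [set x | forall j, (j < N)%N -> S j (zero_digit j x)].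
  rewrite (_ : mkset _ = \bigcap_(j in `I_N) (zero_digit j @^-1` [set` S j])).
    apply: bigcap_measurableType => // j _.
    by rewrite -[X in measurable X]setTI; exact: measurable_zero_digit.
  by apply/seteqP; split=> x h j; exact: h.
rewrite -(big_mkord xpredT (fun j => digit_weight (S j))).
transitivity (P (digit_event S 0 0 N)); last first.
  by rewrite prob_digit_event// expr0 invr1 mul1r.
have eqI : digit_event S 0 0 N =
    [set x | cell 0 x = 0%N] `&` [set x | forall j, (j < N)%N -> S j (zero_digit j x)].
  by apply/seteqP; split=> x [h1 h2].
have mC := measurable_cell 0 0.
rewrite eqI; apply/eqP; rewrite eq_le; apply/andP; split; last first.
  by apply: le_measure; rewrite ?inE//; apply: measurableI.
apply: (@le_trans _ _ (P ([set x | cell 0 x = 0%N] `&`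
   [set x | forall j, (j < N)%N -> S j (zero_digit j x)]) +
   P (~` [set x | cell 0 x = 0%N])))%E.
  apply: (@le_trans _ _ (P (([set x | cell 0 x = 0%N] `&`
     [set x | forall j, (j < N)%N -> S j (zero_digit j x)]) `|`
     (~` [set x | cell 0 x = 0%N])))).
    apply: le_measure; rewrite ?inE//.
      by apply: measurableU; [exact: measurableI|exact: measurableC].
    by move=> x h; case: (pselect (cell 0 x = 0%N)) => h'; [left|right].
  by apply: measureU2; [exact: measurableI|exact: measurableC].
have PC : P (~` [set x : measurableTypeR R | cell 0 x = 0%N]) = 0%E.
  transitivity (1 - P [set x : measurableTypeR R | cell 0 x = 0%N])%E.
    exact: probability_setC.
  by rewrite P0 subee.
by rewrite PC adde0.
Qed.

End bernoulli_sequence.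

Section bernoulli_family.
Context {R : realType} (Q : nat) (K : countType).
Hypothesis Q0 : (0 < Q)%N.

Notation P := (uniform_prob (@ltr01 R)).
Notation q := (Q%:R^-1 : R).

(** Heads is the digit 0, so that its probability is 1 / Q. *)
Definition coin (k : K) : measurableTypeR R -> bool := zero_digit Q (pickle k).

Lemma inv_nat01 : 0 <= q <= 1.
Proof. by rewrite invr_ge0 ler0n invf_le1 ?ler1n ?ltr0n. Qed.

Lemma measurable_coin k : measurable_fun setT (coin k).
Proof. exact: measurable_zero_digit. Qed.

Lemma prob_coin k (A : set bool) : P (coin k @^-1` A) = bernoulli_prob q A.
Proof.
pose S j : pred bool := if j == pickle k then (fun b => b \in A) else predT.
have T1 : digit_weight Q predT = 1 :> R.
  by rewrite /digit_weight !mulr1 addrC subrK.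
have -> : coin k @^-1` A =
    [set x | forall j, (j < (pickle k).+1)%N -> S j (zero_digit Q j x)].
  apply/seteqP; split=> x /=.
    by move=> h j _; rewrite /S; case: eqP => // ->; rewrite inE.
  by move/(_ _ (ltnSn _)); rewrite /S eqxx inE.
rewrite prob_digits// big_ord_recr /= /S eqxx big1 ?mul1r; last first.
  by move=> j _; rewrite ltn_eqF.
by rewrite bernoulli_probE ?inv_nat01// /digit_weight EFinD !EFinM !diracE.
Qed.

Lemma coin_independent (J : seq K) (A : K -> set bool) : uniq J ->
  P (\bigcap_(k in [set` J]) (coin k @^-1` A k)) =
  (\prod_(k <- J) P (coin k @^-1` A k))%E.
Proof.
move=> uJ.
pose S j : pred bool := if pickle_inv j is Some k then
  (if k \in J then (fun b => b \in A k) else predT) else predT.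
have Sk k : S (pickle k) = if k \in J then (fun b => b \in A k) else predT.
  by rewrite /S pickleK_inv.
pose N := (\max_(k <- J) pickle k).+1.
have JN k : k \in J -> (pickle k < N)%N.
  by move=> kJ; rewrite ltnS; apply: leq_bigmax_seq.
have T1 : digit_weight Q predT = 1 :> R.
  by rewrite /digit_weight !mulr1 addrC subrK.
have -> : \bigcap_(k in [set` J]) (coin k @^-1` A k) =
    [set x | forall j, (j < N)%N -> S j (zero_digit Q j x)].
  apply/seteqP; split=> x /= h.
    move=> j _; rewrite /S; have := @pickle_invK K j; case: pickle_inv => [k|//] /= jE.
    by case: ifP => // kJ; rewrite inE -jE; exact: h.
  move=> k /= kJ; have := h _ (JN _ kJ); rewrite Sk kJ inE; exact.
rewrite prob_digits//.
transitivity (\prod_(k <- J) (digit_weight Q (S (pickle k)) : R)%:E)%E; last first.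
  apply: eq_big_seq => k kJ; rewrite prob_coin Sk kJ.
  by rewrite bernoulli_probE ?inv_nat01// /digit_weight EFinD !EFinM !diracE.
rewrite prodEFin; congr (_%:E).
rewrite -(big_mkord xpredT (fun j => digit_weight Q (S j))).
rewrite (bigID (fun j => j \in map pickle J)) /= mulrC big1_seq ?mul1r; last first.
  move=> j /andP[jJ _]; rewrite (_ : S j = predT)//.
  apply/funext => b; rewrite /S; have := @pickle_invK K j.
  case: pickle_inv => [k|//] /= jE; case: ifP => // kJ.
  by move: jJ; rewrite -jE map_f.
rewrite -big_filter (perm_big (map pickle J)) ?big_map//.
apply: uniq_perm.
- by rewrite filter_uniq// iota_uniq.
- by rewrite map_inj_uniq//; exact: (pcan_inj pickleK).
move=> j; rewrite mem_filter mem_index_iota /=.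
by case jJ: (j \in _) => //=; move/mapP: jJ => [k /JN kN ->].
Qed.

End bernoulli_family.

(** * Differentiability and continuity criteria *)

Section quadratic_remainder.
Context {R : realType} {p : nat}.
Implicit Types (f : 'rV[R]_p -> R) (g v x y : 'rV[R]_p).

Lemma norm_le_enorm v : `|v| <= enorm v.
Proof.
rewrite -[`|v|]/(mx_norm v) mx_normrE; apply/bigmax_leP; split=> [|[i j] _ /=].
  exact: enorm_ge0.
by rewrite (ord1 i); exact: coord_le_enorm.
Qed.

Lemma coord_le_norm v j : `|v 0 j| <= `|v|.
Proof.
rewrite -[`|v|]/(mx_norm v) mx_normrE.
exact: (le_bigmax _ (fun ij : 'I_1 * 'I_p => `|v ij.1 ij.2|) (0, j)).
Qed.

Lemma sqn_le_norm v : sqn v <= p%:R * `|v| ^+ 2.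
Proof.
rewrite /sqn; apply: (@le_trans _ _ (\sum_(j < p) `|v| ^+ 2)).
  apply: ler_sum => j _; rewrite -real_normK ?num_real//.
  by rewrite lerXn2r ?nnegrE// coord_le_norm.
by rewrite sumr_const card_ord mulr_natl.
Qed.

Lemma dotp_is_linear g : linear (dotp g : 'rV[R]_p -> R^o).
Proof. by move=> a u v; rewrite dotpDr dotpZr. Qed.

HB.instance Definition _ g :=
  GRing.isLinear.Build R 'rV[R]_p R^o *:%R (dotp g) (dotp_is_linear g).

Lemma continuous_dotp g : continuous (dotp g : 'rV[R]_p -> R^o).
Proof.
apply/linear_bounded_continuous/bounded_funP => r.
exists (\sum_j `|g 0 j| * r) => v vr; rewrite /dotp.
apply: le_trans (ler_norm_sum _ _ _) _; apply: ler_sum => j _.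
by rewrite normrM ler_wpM2l// (le_trans (coord_le_norm _ _)).
Qed.

(** A remainder that is quadratic in the step is negligible with respect to it. *)
Lemma quadratic_diff f g x C :
  (forall v, `|f (x + v) - f x - dotp g v| <= C * sqn v) ->
  differentiable f x /\ grad f x = g.
Proof.
move=> h.
have C' : exists2 K : R, 0 < K & forall v, `|f (x + v) - f x - dotp g v| <= K * `|v| ^+ 2.
  exists (`|C| * p%:R + 1); first by rewrite ltr_wpDl// mulr_ge0.
  move=> v; apply: le_trans (h v) _; apply: (@le_trans _ _ (`|C| * sqn v)).
    by rewrite ler_wpM2r ?sqn_ge0// ler_norm.
  apply: (@le_trans _ _ (`|C| * (p%:R * `|v| ^+ 2))).
    by rewrite ler_wpM2l// sqn_le_norm.
  by rewrite mulrA mulrDl lerDl mul1r exprn_ge0.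
have [K K0 hK] := C'.
have e : (f : 'rV[R]_p -> R^o) \o shift x =
    cst (f x : R^o) + (dotp g : 'rV[R]_p -> R^o) +o_ (0 : 'rV[R]_p) id.
  apply/eqaddoP => eps eps0; rewrite nearE; apply/nbhs_ballP.
  exists (eps / K) => /=; first by rewrite divr_gt0.
  move=> v; rewrite -ball_normE /= sub0r normrN => vd.
  rewrite !fctE /= opprD addrA addrC addrCA [v + x]addrC [X in `|X|](_ : _ = f (x + v) - f x - dotp g v); last by lra.
  apply: le_trans (hK v) _; rewrite expr2 mulrA ler_wpM2r//.
  by rewrite mulrC -ler_pdivlMr// ltW.
have d : 'd f x = dotp g :> (_ -> _).
  exact: (@diff_unique _ _ _ f (dotp g) x (@continuous_dotp g) e).
have df : differentiable f x.
  apply/diff_locallyP; rewrite d; split=> //; exact: continuous_dotp.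
split=> //; apply/rowP => j; rewrite mxE deriveE// d /dotp (bigD1 j)//= mxE !eqxx mulr1.
rewrite big1 ?addr0// => k kj; rewrite mxE (negbTE kj) andbF mulr0//.
Qed.

(** The Euclidean norm and the maximum norm, which defines the topology, are
    equivalent. *)
Lemma lipschitz_continuous (F : 'rV[R]_p -> 'rV[R]_p) (L : R) :
  (forall x y, enorm (F x - F y) <= L * enorm (x - y)) -> continuous F.
Proof.
move=> lip x; apply/(@cvgrPdist_lt R 'rV[R]_p _ _ (nbhs_filter x)) => eps eps0.
pose K := `|L| * (p%:R + 1) + 1.
have K0 : 0 < K by rewrite ltr_wpDl// mulr_ge0// addr_ge0.
rewrite nearE; apply/nbhs_ballP; exists (eps / K) => /=; first by rewrite divr_gt0.
move=> y; rewrite -ball_normE /= => xy.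
apply: le_lt_trans (norm_le_enorm _) _; apply: le_lt_trans (lip _ _) _.
have h : enorm (x - y) <= (p%:R + 1) * `|x - y|.
  apply: enorm_le; first by rewrite mulr_ge0// addr_ge0.
  apply: le_trans (sqn_le_norm _) _; rewrite exprMn ler_wpM2r ?exprn_ge0//.
  have : 0 <= p%:R :> R by [].
  by nra.
apply: le_lt_trans (_ : `|L| * ((p%:R + 1) * `|x - y|) < _).
  apply: (@le_trans _ _ (`|L| * enorm (x - y))).
    by rewrite ler_wpM2r ?enorm_ge0// ler_norm.
  by rewrite ler_wpM2l.
apply: (@le_lt_trans _ _ (K * `|x - y|)).
  by rewrite mulrA /K; rewrite ler_wpM2r// lerDl.
by rewrite mulrC -ltr_pdivlMr.
Qed.

End quadratic_remainder.

(** * Profiles of one link of the chain *)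

Section profiles.
Context {R : realType}.
Implicit Types (u v : R) (f g : R -> R).

Definition relu u : R := Num.max u 0.

(** The profiles below are combinations of shifts of this C^1 function, whose
    derivative is [relu]. *)
Definition half_sq u : R := relu u ^+ 2 / 2.

(** Increases from 0 to 1 on [0, 1], with a tent as its derivative. *)
Definition gate u : R := 4 * (half_sq u - 2 * half_sq (u - 1 / 2) + half_sq (u - 1)).

Definition dgate u : R := 4 * (relu u - 2 * relu (u - 1 / 2) + relu (u - 1)).

(** Bounded and increasing, with slope 1 on [-1, 1]. *)
Definition ramp u : R :=
  half_sq (u + 2) - half_sq (u + 1) - half_sq (u - 1) + half_sq (u - 2).

Definition dramp u : R := relu (u + 2) - relu (u + 1) - relu (u - 1) + relu (u - 2).

(** Vanishes on the right of 0, with slope -1 on the left of -1: it keeps the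
    gradient large where the ramp flattens. *)
Definition wall u : R := half_sq (- u) - half_sq (- u - 1).

Definition dwall u : R := relu (- u - 1) - relu (- u).

Lemma reluE u : relu u = if 0 <= u then u else 0.
Proof. by rewrite /relu; case: leP. Qed.

Lemma half_sq_rem u v :
  0 <= half_sq v - half_sq u - relu u * (v - u) <= (v - u) ^+ 2 / 2.
Proof.
rewrite /half_sq !reluE.
have := sqr_ge0 (v - u).
by case: (leP 0 u) => hu; case: (leP 0 v) => hv ?; apply/andP; split; nra.
Qed.

Lemma relu_lip u v : `|relu v - relu u| <= `|v - u|.
Proof.
rewrite !reluE; case: (leP 0 u) => hu; case: (leP 0 v) => hv;
  rewrite ?subr0 ?sub0r ?normrN ?normr0//.
  by rewrite ger0_norm// ltr0_norm; lra.
by rewrite ger0_norm// ger0_norm; lra.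
Qed.

Ltac rem a b := move: (half_sq_rem a b).

Lemma gate_rem u v : `|gate v - gate u - dgate u * (v - u)| <= 8 * (v - u) ^+ 2.
Proof.
rem u v; rem (u - 1 / 2) (v - 1 / 2); rem (u - 1) (v - 1).
rewrite (_ : v - 1 / 2 - (u - 1 / 2) = v - u); last by lra.
rewrite (_ : v - 1 - (u - 1) = v - u); last by lra.
rewrite ler_norml /gate /dgate => /andP[a1 a2] /andP[b1 b2] /andP[c1 c2].
by apply/andP; split; lra.
Qed.

Lemma ramp_rem u v : `|ramp v - ramp u - dramp u * (v - u)| <= 2 * (v - u) ^+ 2.
Proof.
rem (u + 2) (v + 2); rem (u + 1) (v + 1); rem (u - 1) (v - 1); rem (u - 2) (v - 2).
rewrite (_ : v - 1 - (u - 1) = v - u); last by lra.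
rewrite (_ : v - 2 - (u - 2) = v - u); last by lra.
rewrite (_ : v + 1 - (u + 1) = v - u); last by lra.
rewrite (_ : v + 2 - (u + 2) = v - u); last by lra.
rewrite ler_norml /ramp /dramp => /andP[a1 a2] /andP[b1 b2] /andP[c1 c2] /andP[d1 d2].
by apply/andP; split; lra.
Qed.

Lemma wall_rem u v : `|wall v - wall u - dwall u * (v - u)| <= (v - u) ^+ 2.
Proof.
rem (- u) (- v); rem (- u - 1) (- v - 1).
rewrite (_ : - v - - u = - (v - u)); last by lra.
rewrite (_ : - v - 1 - (- u - 1) = - (v - u)); last by lra.
rewrite sqrrN ler_norml /wall /dwall => /andP[a1 a2] /andP[b1 b2].
by apply/andP; split; lra.
Qed.

Ltac cases_relu :=
  rewrite ?reluE;
  repeat match goal with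
  | |- context [if (0 <= ?a)%R then _ else _] => case: (leP 0 a) => ?
  end; nra.

Lemma gate_range u : 0 <= gate u <= 1.
Proof.
by rewrite /gate /half_sq !reluE; apply/andP; split; cases_relu.
Qed.

Lemma dgate_range u : 0 <= dgate u <= 2.
Proof. by rewrite /dgate !reluE; apply/andP; split; cases_relu. Qed.

Lemma ramp_range u : 0 <= ramp u <= 3.
Proof. by rewrite /ramp /half_sq !reluE; apply/andP; split; cases_relu. Qed.

Lemma dramp_range u : 0 <= dramp u <= 1.
Proof. by rewrite /dramp !reluE; apply/andP; split; cases_relu. Qed.

Lemma wall_ge0 u : 0 <= wall u.
Proof. by rewrite /wall /half_sq !reluE; cases_relu. Qed.

Lemma dwall_range u : -1 <= dwall u <= 0.
Proof. by rewrite /dwall !reluE; apply/andP; split; cases_relu. Qed.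

Lemma gate_le0 u : u <= 0 -> gate u = 0.
Proof. by move=> u0; rewrite /gate /half_sq !reluE; cases_relu. Qed.

Lemma gate_ge1 u : 1 <= u -> gate u = 1.
Proof. by move=> u0; rewrite /gate /half_sq !reluE; cases_relu. Qed.

Lemma dgate0 : dgate 0 = 0.
Proof. by rewrite /dgate !reluE; cases_relu. Qed.

Lemma dramp_mid u : -1 <= u <= 1 -> dramp u = 1.
Proof. by move=> /andP[u0 u1]; rewrite /dramp !reluE; cases_relu. Qed.

Lemma dwall_left u : u <= -1 -> dwall u = -1.
Proof. by move=> u0; rewrite /dwall !reluE; cases_relu. Qed.

Lemma wall_ge u : 0 <= u -> wall u = 0 /\ dwall u = 0.
Proof. by move=> u0; rewrite /wall /dwall /half_sq !reluE; split; cases_relu. Qed.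

Lemma ramp0 : ramp 0 = 3 / 2.
Proof. by rewrite /ramp /half_sq !reluE; cases_relu. Qed.

Lemma ramp1 : ramp 1 = 5 / 2.
Proof. by rewrite /ramp /half_sq !reluE; cases_relu. Qed.

(** Small steps are controlled by the remainder and the derivative, large steps
    by the range. *)
Lemma lip_of_rem f g (M K C : R) : 0 <= M -> 0 <= K -> C <= M + K ->
  (forall u v, `|f v - f u - g u * (v - u)| <= K * (v - u) ^+ 2) ->
  (forall u, `|g u| <= M) -> (forall u v, `|f v - f u| <= C) ->
  forall u v, `|f v - f u| <= (M + K) * `|v - u|.
Proof.
move=> M0 K0 CMK rem gM fC u v.
have [h|h] := leP `|v - u| 1.
  rewrite (_ : f v - f u = (f v - f u - g u * (v - u)) + g u * (v - u)); last by lra.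
  apply: le_trans (ler_normD _ _) _; rewrite mulrDl addrC; apply: lerD.
    by rewrite normrM ler_wpM2r.
  apply: le_trans (rem u v) _; rewrite ler_wpM2l// -real_normK ?num_real//.
  by rewrite expr2 ler_piMl.
apply: le_trans (fC u v) _; apply: le_trans CMK _.
by rewrite ler_peMr ?addr_ge0// ltW.
Qed.

Lemma gate_lip u v : `|gate v - gate u| <= 10 * `|v - u|.
Proof.
have -> : 10 = 2 + 8 :> R by lra.
apply: (@lip_of_rem gate dgate 2 8 1) => //; first by lra.
- exact: gate_rem.
- by move=> w; move: (dgate_range w) => /andP[a b]; rewrite ger0_norm.
- move=> a b; move: (gate_range a) (gate_range b) => /andP[? ?] /andP[? ?].
  by rewrite ler_norml; apply/andP; split; lra.
Qed.

Lemma ramp_lip u v : `|ramp v - ramp u| <= 3 * `|v - u|.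
Proof.
have -> : 3 = 1 + 2 :> R by lra.
apply: (@lip_of_rem ramp dramp 1 2 3) => //.
- exact: ramp_rem.
- by move=> w; move: (dramp_range w) => /andP[a b]; rewrite ger0_norm.
- move=> a b; move: (ramp_range a) (ramp_range b) => /andP[? ?] /andP[? ?].
  by rewrite ler_norml; apply/andP; split; lra.
Qed.

Ltac lip a b := move: (relu_lip a b).

Lemma dgate_lip u v : `|dgate v - dgate u| <= 16 * `|v - u|.
Proof.
lip u v; lip (u - 1 / 2) (v - 1 / 2); lip (u - 1) (v - 1).
rewrite (_ : v - 1 / 2 - (u - 1 / 2) = v - u); last by lra.
rewrite (_ : v - 1 - (u - 1) = v - u); last by lra.
rewrite !ler_norml /dgate => /andP[a1 a2] /andP[b1 b2] /andP[c1 c2].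
by apply/andP; split; lra.
Qed.

Lemma dramp_lip u v : `|dramp v - dramp u| <= 4 * `|v - u|.
Proof.
lip (u + 2) (v + 2); lip (u + 1) (v + 1); lip (u - 1) (v - 1); lip (u - 2) (v - 2).
rewrite (_ : v - 1 - (u - 1) = v - u); last by lra.
rewrite (_ : v - 2 - (u - 2) = v - u); last by lra.
rewrite (_ : v + 1 - (u + 1) = v - u); last by lra.
rewrite (_ : v + 2 - (u + 2) = v - u); last by lra.
rewrite !ler_norml /dramp => /andP[a1 a2] /andP[b1 b2] /andP[c1 c2] /andP[d1 d2].
by apply/andP; split; lra.
Qed.

Lemma dwall_lip u v : `|dwall v - dwall u| <= 2 * `|v - u|.
Proof.
lip (- u) (- v); lip (- u - 1) (- v - 1).
rewrite (_ : - v - - u = - (v - u)); last by lra.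
rewrite (_ : - v - 1 - (- u - 1) = - (v - u)); last by lra.
rewrite normrN !ler_norml /dwall => /andP[a1 a2] /andP[b1 b2].
by apply/andP; split; lra.
Qed.

(** One link of the chain: as long as u <= 0, there is no incentive to move v
    away from 0. *)
Definition link u v : R := wall v - gate u * ramp v.
Definition dlink1 u v : R := - (dgate u * ramp v).
Definition dlink2 u v : R := dwall v - gate u * dramp v.

Lemma link_rem u v u' v' :
  `|link u' v' - link u v - dlink1 u v * (u' - u) - dlink2 u v * (v' - v)|
   <= 39 * (u' - u) ^+ 2 + 18 * (v' - v) ^+ 2.
Proof.
set a := u' - u; set b := v' - v.
have hw := wall_rem v v'; rewrite -/b in hw.
have hg := gate_rem u u'; rewrite -/a in hg.
have hr := ramp_rem v v'; rewrite -/b in hr.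
have hgl := gate_lip u u'; rewrite -/a in hgl.
have hrl := ramp_lip v v'; rewrite -/b in hrl.
move: (gate_range u) (ramp_range v) => /andP[g0 g1] /andP[r0 r3].
rewrite (_ : link u' v' - _ - _ - _ = (wall v' - wall v - dwall v * b)
  - (gate u' - gate u - dgate u * a) * ramp v
  - gate u * (ramp v' - ramp v - dramp v * b)
  - (gate u' - gate u) * (ramp v' - ramp v)); last first.
  by rewrite /link /dlink1 /dlink2; lra.
have h1 : `|(gate u' - gate u - dgate u * a) * ramp v| <= 8 * a ^+ 2 * 3.
  by rewrite normrM; apply: ler_pM => //; rewrite ger0_norm.
have h2 : `|gate u * (ramp v' - ramp v - dramp v * b)| <= 1 * (2 * b ^+ 2).
  by rewrite normrM; apply: ler_pM => //; rewrite ger0_norm.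
have h3 : `|(gate u' - gate u) * (ramp v' - ramp v)| <= 10 * `|a| * (3 * `|b|).
  by rewrite normrM; apply: ler_pM.
have h4 : 2 * (`|a| * `|b|) <= a ^+ 2 + b ^+ 2.
  rewrite -(real_normK (num_real a)) -(real_normK (num_real b)).
  by have := sqr_ge0 (`|a| - `|b|); lra.
have tri (x y z w : R) : `|x - y - z - w| <= `|x| + `|y| + `|z| + `|w|.
  by rewrite !(le_trans (ler_normB _ _))// lerD2r !(le_trans (ler_normB _ _))// lerD2r ler_normB.
apply: le_trans (tri _ _ _ _) _; lra.
Qed.

Lemma dlink1_lip u v u' v' :
  `|dlink1 u' v' - dlink1 u v| <= 48 * `|u' - u| + 6 * `|v' - v|.
Proof.
move: (dgate_range u') (ramp_range v) => /andP[g0 g2] /andP[r0 r3].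
rewrite (_ : dlink1 u' v' - _ = - ((dgate u' - dgate u) * ramp v)
  - dgate u' * (ramp v' - ramp v)); last by rewrite /dlink1; lra.
apply: le_trans (ler_normB _ _) _; rewrite normrN.
have h1 : `|(dgate u' - dgate u) * ramp v| <= 16 * `|u' - u| * 3.
  by rewrite normrM; apply: ler_pM => //; [exact: dgate_lip|rewrite ger0_norm].
have h2 : `|dgate u' * (ramp v' - ramp v)| <= 2 * (3 * `|v' - v|).
  by rewrite normrM; apply: ler_pM => //; [rewrite ger0_norm|exact: ramp_lip].
lra.
Qed.

Lemma dlink2_lip u v u' v' :
  `|dlink2 u' v' - dlink2 u v| <= 10 * `|u' - u| + 6 * `|v' - v|.
Proof.
move: (gate_range u') (dramp_range v) => /andP[g0 g1] /andP[r0 r1].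
rewrite (_ : dlink2 u' v' - _ = (dwall v' - dwall v) - ((gate u' - gate u) * dramp v)
  - gate u' * (dramp v' - dramp v)); last by rewrite /dlink2; lra.
apply: le_trans (ler_normB _ _) _; apply: le_trans (lerD (ler_normB _ _) (lexx _)) _.
have h1 := dwall_lip v v'.
have h2 : `|(gate u' - gate u) * dramp v| <= 10 * `|u' - u| * 1.
  by rewrite normrM; apply: ler_pM => //; [exact: gate_lip|rewrite ger0_norm].
have h3 : `|gate u' * (dramp v' - dramp v)| <= 1 * (4 * `|v' - v|).
  by rewrite normrM; apply: ler_pM => //; [rewrite ger0_norm|exact: dramp_lip].
lra.
Qed.

Lemma link_ge u v : - 3 <= link u v.
Proof.
move: (gate_range u) (ramp_range v) (wall_ge0 v) => /andP[g0 g1] /andP[r0 r3] w0.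
by rewrite /link; nra.
Qed.

(** Once the gate is open, the slope of the ramp or that of the wall has modulus 1,
    according to the side of -1, and both push v to the right. *)
Lemma dlink2_front u v : 1 <= u -> v < 1 -> dlink2 u v <= - 1.
Proof.
move=> u1 v1; rewrite /dlink2 gate_ge1// mul1r.
move: (dramp_range v) (dwall_range v) => /andP[r0 r1] /andP[w1 w0].
have [h|h] := leP (- 1) v; first by rewrite dramp_mid; [lra|rewrite h ltW].
by rewrite dwall_left; [lra|rewrite ltW].
Qed.

Lemma dlink1_le0 u v : dlink1 u v <= 0.
Proof.
move: (dgate_range u) (ramp_range v) => /andP[g0 g2] /andP[r0 r3].
by rewrite /dlink1 oppr_le0 mulr_ge0.
Qed.

End profiles.

(** * The chain *)

Section chain_function.
Context {R : realType} {p : nat}.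
Implicit Types (x y v : 'rV[R]_p) (w : nat -> R) (c : 'I_p).

(** Coordinate k of x has rank k.+1; the value e at rank 0 is 1 for points and
    0 for their differences. *)
Definition ranked (e : R) x (k : nat) : R :=
  if k is j.+1 then (if insub j is Some c then x 0 c else 0) else e.

#[global] Arguments ranked : simpl never.

Lemma ranked0 e x : ranked e x 0 = e.
Proof. by []. Qed.

Lemma rankedS e x c : ranked e x c.+1 = x 0 c.
Proof. by rewrite /ranked valK. Qed.

Lemma ranked_out e x k : (p <= k)%N -> ranked e x k.+1 = 0.
Proof. by move=> pk; rewrite /ranked insubF// ltnNge pk. Qed.

Lemma rankedB e e' x y k : ranked e x k - ranked e' y k = ranked (e - e') (x - y) k.
Proof.
case: k => [//|k]; rewrite /ranked; case: insub => [c|]; last by rewrite subr0.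
by rewrite !mxE.
Qed.

Lemma sum_shift (F : nat -> R) : F 0%N = 0 ->
  \sum_(k < p) F k = \sum_(c < p) (c.+1 < p)%:R * F c.+1.
Proof.
move=> F0; case: p => [|m]; first by rewrite !big_ord0.
rewrite big_ord_recl F0 add0r big_ord_recr /= ltnn mul0r addr0.
by apply: eq_bigr => c _; rewrite ltnS ltn_ord mul1r.
Qed.

Lemma ranked_sqn v : \sum_(c < p) ranked 0 v c.+1 ^+ 2 = sqn v.
Proof. by apply: eq_bigr => c _; rewrite rankedS. Qed.

Lemma ranked_sqn_lower v : \sum_(c < p) ranked 0 v c ^+ 2 <= sqn v.
Proof.
rewrite (@sum_shift (fun k => ranked 0 v k ^+ 2)) -?ranked_sqn; last first.
  by rewrite ranked0 expr0n.
apply: ler_sum => c _; rewrite -[leRHS]mul1r ler_wpM2r ?sqr_ge0//.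
by case: (_ < _)%N.
Qed.

Lemma ranked_sqn_upper v : \sum_(c < p) ranked 0 v c.+2 ^+ 2 <= sqn v.
Proof.
have : \sum_(k < p.+1) ranked 0 v k.+1 ^+ 2 = sqn v.
  by rewrite big_ord_recr /= ranked_sqn ranked_out// expr0n addr0.
by rewrite big_ord_recl => <-; rewrite lerDr sqr_ge0.
Qed.

(** A chain with links of weights w; its front end is fixed at 1, which opens the
    gate of the first link. *)
Definition chain w x : R :=
  \sum_(k < p) w k * link (ranked 1 x k) (ranked 1 x k.+1).

Definition dchain w x : 'rV[R]_p := \row_c
  (w c * dlink2 (ranked 1 x c) (ranked 1 x c.+1) +
   (c.+1 < p)%:R * (w c.+1 * dlink1 (ranked 1 x c.+1) (ranked 1 x c.+2))).

(** Each coordinate occurs in two links, so that the remainder of the sum is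
    controlled by twice the squared norm. *)
Lemma chain_rem w (W : R) x v : (forall k, 0 <= w k <= W) ->
  `|chain w (x + v) - chain w x - dotp (dchain w x) v| <= 57 * W * sqn v.
Proof.
move=> wW; pose d := ranked 0 v.
have W0 : 0 <= W by move: (wW 0%N) => /andP[]; exact: le_trans.
have dE k : ranked 1 (x + v) k - ranked 1 x k = d k.
  by rewrite rankedB subrr addrC addKr.
have -> : dotp (dchain w x) v = \sum_(k < p) w k *
    (dlink1 (ranked 1 x k) (ranked 1 x k.+1) * d k +
     dlink2 (ranked 1 x k) (ranked 1 x k.+1) * d k.+1).
  rewrite /dotp; under [RHS]eq_bigr do rewrite mulrDr.
  rewrite big_split /= addrC.
  rewrite (@sum_shift (fun k => w k * (dlink1 (ranked 1 x k) (ranked 1 x k.+1) * d k)));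
    last by rewrite /d ranked0 !mulr0.
  by rewrite -big_split; apply: eq_bigr => c _; rewrite mxE /d !rankedS /=; lra.
rewrite /chain -!sumrB; apply: le_trans (ler_norm_sum _ _ _) _.
apply: (@le_trans _ _ (\sum_(k < p) (39 * W * d k ^+ 2 + 18 * W * d k.+1 ^+ 2))).
  apply: ler_sum => k _; move: (wW k) => /andP[w0 w1].
  rewrite -!mulrBr normrM ger0_norm//.
  apply: (@le_trans _ _ (W * (39 * d k ^+ 2 + 18 * d k.+1 ^+ 2))); last by lra.
  apply: ler_pM => //; rewrite -!dE.
  have := link_rem (ranked 1 x k) (ranked 1 x k.+1) (ranked 1 (x + v) k) (ranked 1 (x + v) k.+1).
  by rewrite -addrA -opprD.
rewrite big_split /= -!mulr_sumr ranked_sqn.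
have := ler_wpM2l (_ : 0 <= 39 * W) (ranked_sqn_lower v).
by rewrite -/d mulr_ge0// => /(_ isT); lra.
Qed.

Lemma dchain_lip w (W : R) x y : (forall k, 0 <= w k <= W) ->
  enorm (dchain w x - dchain w y) <= 70 * W * enorm (x - y).
Proof.
move=> wW; pose d k := ranked 0 (x - y) k.
have W0 : 0 <= W by move: (wW 0%N) => /andP[]; exact: le_trans.
have dE k : ranked 1 x k - ranked 1 y k = d k by rewrite rankedB subrr.
apply: enorm_le; first by rewrite !mulr_ge0// enorm_ge0.
rewrite !exprMn enorm_sq.
apply: (@le_trans _ _ (\sum_(c < p) W ^+ 2 *
   (70 * (10 * d c ^+ 2 + 54 * d c.+1 ^+ 2 + 6 * d c.+2 ^+ 2)))).
  apply: ler_sum => c _; rewrite -real_normK ?num_real//.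
  set D := (dchain w x - dchain w y) 0 c.
  have hD : `|D| <= W * (10 * `|d c| + 54 * `|d c.+1| + 6 * `|d c.+2|).
    rewrite /D !mxE.
    move: (wW c) (wW c.+1) => /andP[w0 w1] /andP[w0' w1'].
    set A := dlink2 _ _; set A' := (X in _ - (w c * X + _)).
    set B := dlink1 _ _; set B' := (X in _ - (_ + _ * (_ * X))).
    have hA : `|A - A'| <= 10 * `|d c| + 6 * `|d c.+1| by rewrite -!dE; exact: dlink2_lip.
    have hB : `|B - B'| <= 48 * `|d c.+1| + 6 * `|d c.+2| by rewrite -!dE; exact: dlink1_lip.
    rewrite (_ : _ - _ = w c * (A - A') + (c.+1 < p)%:R * (w c.+1 * (B - B'))); last by lra.
    apply: le_trans (ler_normD _ _) _; rewrite !normrM (ger0_norm w0) (ger0_norm w0').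
    have h1 : w c * `|A - A'| <= W * (10 * `|d c| + 6 * `|d c.+1|) by apply: ler_pM.
    have h2 : w c.+1 * `|B - B'| <= W * (48 * `|d c.+1| + 6 * `|d c.+2|) by apply: ler_pM.
    have h3 : `|(c.+1 < p)%:R| * (w c.+1 * `|B - B'|) <= w c.+1 * `|B - B'|.
      rewrite -[leRHS]mul1r ler_wpM2r ?mulr_ge0//.
      by case: (_ < _)%N; rewrite ?normr1 ?normr0.
    lra.
  apply: (@le_trans _ _ ((W * (10 * `|d c| + 54 * `|d c.+1| + 6 * `|d c.+2|)) ^+ 2)).
    by rewrite lerXn2r// nnegrE// mulr_ge0// !addr_ge0// mulr_ge0.
  rewrite exprMn ler_wpM2l ?sqr_ge0//.
  have sq (a : R) : a ^+ 2 = `|a| ^+ 2 by rewrite real_normK ?num_real.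
  rewrite (sq (d c)) (sq (d c.+1)) (sq (d c.+2)).
  move: `|d c| `|d c.+1| `|d c.+2| => a b e.
  have := sqr_ge0 (a - b); have := sqr_ge0 (a - e); have := sqr_ge0 (b - e).
  by lra.
rewrite -mulr_sumr -mulr_sumr !big_split /= -!mulr_sumr ranked_sqn.
have h1 := ranked_sqn_lower (x - y); have h2 := ranked_sqn_upper (x - y).
rewrite (_ : 70 ^+ 2 * W ^+ 2 * sqn (x - y) = W ^+ 2 * (70 * (70 * sqn (x - y)))); last by lra.
rewrite ler_wpM2l ?sqr_ge0// ler_pM2l//; rewrite -/d in h1 h2.
have := sqn_ge0 (x - y).
by rewrite /d; lra.
Qed.

Lemma chain_ge w x : (forall k, 0 <= w k <= 1) -> - (3 * p%:R) <= chain w x.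
Proof.
move=> w01; rewrite /chain; apply: (@le_trans _ _ (\sum_(k < p) - 3)).
  by rewrite sumr_const card_ord mulNrn mulr_natr.
apply: ler_sum => k _; move: (w01 k) (link_ge (ranked 1 x k) (ranked 1 x k.+1)).
by move=> /andP[w0 w1]; nra.
Qed.

(** At the first coordinate that has not reached 1 the gate is open, and the two
    links in which it occurs push it in the same direction. *)
Lemma dchain_front x c : x 0 c < 1 -> 1 <= enorm (dchain (fun=> 1) x).
Proof.
move=> xc; have ex : exists k, (k < p)%N && (ranked 1 x k.+1 < 1).
  by exists c; rewrite rankedS ltn_ord.
case: (ex_minnP ex) => k /andP[kp xk] kmin.
apply: le_trans (coord_le_enorm _ (Ordinal kp)); rewrite mxE /= !mul1r.
have x1 : 1 <= ranked 1 x k.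
  case: k kp xk kmin => [//|k] kp xk kmin; rewrite leNgt; apply/negP => h.
  by have := kmin k; rewrite (ltnW kp) h ltnn => /(_ isT).
have h1 := dlink2_front x1 xk; have h2 := dlink1_le0 (ranked 1 x k.+1) (ranked 1 x k.+2).
rewrite ler0_norm; last by case: (_ < _)%N => /=; lra.
by case: (_ < _)%N => /=; lra.
Qed.

(** At 0 the wall is flat and the next gate is closed to first order, so that only
    the ramp of the own link is felt. *)
Lemma dchain_zero w x c : x 0 c = 0 ->
  dchain w x 0 c = - (w c * gate (ranked 1 x c)).
Proof.
move=> xc; rewrite mxE rankedS xc /dlink1 /dlink2 dgate0 mul0r oppr0 !mulr0 addr0.
by rewrite (wall_ge (lexx 0)).2 dramp_mid ?mulr1 ?sub0r ?mulrN//; apply/andP; split; lra.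
Qed.

(** The chain reveals its coordinates one after the other: a gate stays closed
    until the preceding coordinate is nonzero. *)
Lemma dchain_reveal w x c : dchain w x 0 c != 0 -> x 0 c = 0 ->
  w c != 0 /\ (forall c' : 'I_p, c'.+1 = c :> nat -> x 0 c' != 0).
Proof.
move=> dc xc; move: dc; rewrite dchain_zero// oppr_eq0 mulf_eq0 negb_or => /andP[wc g].
split=> // c' c'E; apply/eqP => xc'; move: g; rewrite -c'E rankedS xc'.
by rewrite gate_le0 ?eqxx.
Qed.

Lemma dchain_zero_le w (W : R) x c : (forall k, 0 <= w k <= W) -> x 0 c = 0 ->
  dchain w x 0 c ^+ 2 <= W ^+ 2.
Proof.
move=> wW xc; rewrite dchain_zero// sqrrN.
move: (wW c) (gate_range (ranked 1 x c)) => /andP[w0 w1] /andP[g0 g1].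
have W0 := le_trans w0 w1.
rewrite lerXn2r ?nnegrE//; first exact: mulr_ge0.
by apply: le_trans w1; rewrite ler_piMr.
Qed.

Lemma chain_start : (0 < p)%N -> chain (fun=> 1) (0 : 'rV[R]_p) = - (3 / 2).
Proof.
move=> p0; have r0 k : ranked 1 (0 : 'rV[R]_p) k.+1 = 0.
  by rewrite /ranked; case: insub => // c; rewrite mxE.
rewrite /chain (bigD1 (Ordinal p0))//= big1; last first.
  move=> [[//|k] kp] _ ; rewrite !r0 /link (wall_ge (lexx 0)).1 gate_le0//.
  by rewrite mul0r subr0 mulr0.
by rewrite mul1r r0 ranked0 /link (wall_ge (lexx 0)).1 gate_ge1// ramp0; lra.
Qed.

Lemma chain_ones : (0 < p)%N ->
  chain (fun=> 1) (const_mx 1 : 'rV[R]_p) <= - (5 / 2).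
Proof.
move=> p0; rewrite /chain (eq_bigr (fun=> - (5 / 2))).
  rewrite sumr_const card_ord mulNrn lerN2 -mulr_natr.
  have : 1 <= p%:R :> R by rewrite ler1n.
  lra.
move=> k _; have r1 : ranked 1 (const_mx 1 : 'rV[R]_p) k = 1.
  case: k => [[//|k] kp]; rewrite /= /ranked insubT; first exact: ltnW.
  by move=> kp'; rewrite mxE.
rewrite r1 rankedS mxE /link gate_ge1// ramp1 (wall_ge ler01).1; lra.
Qed.

End chain_function.

(** * The hard instance *)

Section bernoulli_expectation.
Context {R : realType}.

Lemma expectation_bernoulli (q : R) (f : bool -> R) : 0 <= q <= 1 ->
  ('E_(bernoulli_prob q)[f] = (q * f true + (1 - q) * f false)%:E)%E.
Proof.
move=> q01; rewrite unlock integralE !integral_bernoulli_prob//.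
rewrite !funeposE !funenegE.
have mx (u : R) : maxe u%:E 0%E = (Num.max u 0)%:E by rewrite -[0%E]/(0%:E) EFin_max.
rewrite -!EFinN !mx -!EFinM -!EFinD -?EFinN -?EFinD; congr (_%:E).
have m (u : R) : Num.max u 0 - Num.max (- u) 0 = u.
  by case: (leP u 0) => u0; [rewrite max_l|rewrite max_r]; lra.
rewrite -[in RHS](m (f true)) -[in RHS](m (f false)) /unstable.onem; lra.
Qed.

End bernoulli_expectation.

Section measurable_profiles.
Context {R : realType} {d : measure_display} {T : measurableType d}.
Implicit Types f g : T -> R.

Lemma measurable_relu f : measurable_fun setT f -> measurable_fun setT (relu \o f).
Proof.
by move=> mf; apply: (measurable_maxr mf); exact: measurable_cst.
Qed.

Let mrelu (a b : R) f : measurable_fun setT f ->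
  measurable_fun setT (fun x => relu (a * f x + b)).
Proof.
move=> mf; apply: (@measurable_relu (fun x => a * f x + b)).
by apply: measurable_funD => //; exact: measurable_funM.
Qed.

Let mhalf (a b : R) f : measurable_fun setT f ->
  measurable_fun setT (fun x => half_sq (a * f x + b)).
Proof.
move=> mf; apply: measurable_funM => //.
by apply: measurable_funX; exact: mrelu.
Qed.

Lemma measurable_dlink1 f g : measurable_fun setT f -> measurable_fun setT g ->
  measurable_fun setT (fun x => dlink1 (f x) (g x)).
Proof.
move=> mf mg.
rewrite (_ : (fun x => _) = (fun x => - (4 * (relu (1 * f x + 0)
    - 2 * relu (1 * f x + (- (1 / 2))) + relu (1 * f x + (- 1))) *
  (half_sq (1 * g x + 2) - half_sq (1 * g x + 1) - half_sq (1 * g x + (- 1))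
   + half_sq (1 * g x + (- 2)))))); last first.
  by apply/funext => x; rewrite /dlink1 /dgate /ramp !mul1r addr0.
apply: measurableT_comp => //; apply: measurable_funM; last first.
  apply: measurable_funD; last exact: mhalf.
  apply: measurable_funB; last exact: mhalf.
  by apply: measurable_funB; exact: mhalf.
apply: measurable_funM => //.
apply: measurable_funD; last exact: mrelu.
apply: measurable_funB; first exact: mrelu.
by apply: measurable_funM => //; exact: mrelu.
Qed.

Lemma measurable_dlink2 f g : measurable_fun setT f -> measurable_fun setT g ->
  measurable_fun setT (fun x => dlink2 (f x) (g x)).
Proof.
move=> mf mg.
rewrite (_ : (fun x => _) = (fun x => relu ((-1) * g x + (- 1)) - relu ((-1) * g x + 0) -
  4 * (half_sq (1 * f x + 0) - 2 * half_sq (1 * f x + (- (1 / 2)))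
    + half_sq (1 * f x + (- 1))) *
  (relu (1 * g x + 2) - relu (1 * g x + 1) - relu (1 * g x + (- 1))
   + relu (1 * g x + (- 2))))); last first.
  by apply/funext => x; rewrite /dlink2 /dwall /gate /dramp !mul1r !mulN1r !addr0.
apply: measurable_funB; first by apply: measurable_funB; exact: mrelu.
apply: measurable_funM; last first.
  apply: measurable_funD; last exact: mrelu.
  apply: measurable_funB; last exact: mrelu.
  by apply: measurable_funB; exact: mrelu.
apply: measurable_funM => //.
apply: measurable_funD; last exact: mhalf.
apply: measurable_funB; first exact: mhalf.
by apply: measurable_funM => //; exact: mhalf.
Qed.

End measurable_profiles.

Lemma enormZ (R : realType) p (b : R) (v : 'rV[R]_p) : 0 < b ->
  enorm (b *: v) = b * enorm v.
Proof.
move=> b0; apply/eqP; rewrite -(eqrXn2 (_ : 0 < 2)%N) ?enorm_ge0//.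
  by rewrite exprMn !enorm_sq sqnZ.
by rewrite mulr_ge0 ?enorm_ge0 ?(ltW b0).
Qed.

Section hard_instance.
Context {R : realType} {n : nat} (p Q : nat) (w : 'I_n -> nat -> R) (W a lam : R).
Implicit Types (x y : 'rV[R]_p) (i : 'I_n) (c : 'I_p).

Definition hard_obj i x : R := a * chain (w i) (lam^-1 *: x).

Definition hard_grad i x : 'rV[R]_p := (a / lam) *: dchain (w i) (lam^-1 *: x).

(** Indicator of the coordinates beyond the last nonzero one. Written as a product
    of indicators, it is visibly measurable in x. *)
Definition fresh x c : R := \prod_(c' < p | (c <= c')%N) (x 0 c' == 0)%:R.

(** The gradient, except that its fresh coordinate is sent, amplified by Q, with
    probability 1 / Q only. *)
Definition hard_oracle i x (z : bool) : 'rV[R]_p :=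
  \row_c (hard_grad i x 0 c * (1 + fresh x c * (z%:R * Q%:R - 1))).

Lemma fresh_01 x c : fresh x c = 0 \/ fresh x c = 1.
Proof.
rewrite /fresh; elim/big_ind: _ => [|u v|c' _]; first by right.
  by move=> [->|->] [->|->]; rewrite ?mulr0 ?mul0r ?mulr1; [left|left|left|right].
by case: eqP => _; [right|left].
Qed.

Lemma fresh_eq1 x c : fresh x c = 1 -> forall c' : 'I_p, (c <= c')%N -> x 0 c' = 0.
Proof.
move=> f1 c' cc'; apply/eqP; apply: contraPT f1 => xc'.
rewrite /fresh (bigD1 c')//= (negbTE xc') mul0r => /eqP.
by rewrite eq_sym oner_eq0.
Qed.

Lemma fresh_eq0 x c : fresh x c = 0 -> exists2 c' : 'I_p, (c <= c')%N & x 0 c' != 0.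
Proof.
move/eqP; rewrite /fresh prodf_seq_eq0 => /hasP[c' _ /andP[cc' h]].
by exists c' => //; move: h; case: (x 0 c' == 0) => //; rewrite oner_eq0.
Qed.

Hypotheses (Q0 : (0 < Q)%N) (a0 : 0 < a) (lam0 : 0 < lam).
Hypothesis wW : forall i k, 0 <= w i k <= W.

Lemma hard_diff i x :
  differentiable (hard_obj i) x /\ grad (hard_obj i) x = hard_grad i x.
Proof.
apply: (@quadratic_diff _ _ _ _ _ (a * (57 * W) * lam^-1 ^+ 2)) => v.
rewrite /hard_obj /hard_grad dotpZl scalerDr -mulrBr.
have := chain_rem (lam^-1 *: x) (lam^-1 *: v) (wW i).
rewrite sqnZ dotpZr => h.
rewrite (_ : _ - _ = a * (chain (w i) (lam^-1 *: x + lam^-1 *: v) -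
  chain (w i) (lam^-1 *: x) - lam^-1 * dotp (dchain (w i) (lam^-1 *: x)) v)); last by lra.
rewrite normrM gtr0_norm// -!mulrA ler_pM2l//.
by apply: le_trans h _; rewrite le_eqVlt; apply/orP; left; apply/eqP; lra.
Qed.

Lemma hard_gradE i x : grad (hard_obj i) x = hard_grad i x.
Proof. exact: (hard_diff i x).2. Qed.

Lemma hard_grad_lip (L : R) i x y : a * (70 * W) / lam ^+ 2 <= L ->
  enorm (hard_grad i x - hard_grad i y) <= L * enorm (x - y).
Proof.
move=> aL; rewrite /hard_grad -scalerBr.
have al : 0 < a / lam by rewrite divr_gt0.
rewrite enormZ//; have := dchain_lip (lam^-1 *: x) (lam^-1 *: y) (wW i).
rewrite -scalerBr enormZ ?invr_gt0// => h.
apply: (@le_trans _ _ (a / lam * (70 * W * (lam^-1 * enorm (x - y))))).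
  by rewrite ler_pM2l.
have := ler_wpM2r (enorm_ge0 (x - y)) aL.
by rewrite expr2 invfM; lra.
Qed.

Lemma hard_grad_reveal i x c : hard_grad i x 0 c != 0 -> x 0 c = 0 ->
  w i c != 0 /\ (forall c' : 'I_p, c'.+1 = c :> nat -> x 0 c' != 0).
Proof.
rewrite mxE mulf_eq0 negb_or => /andP[_ h] xc.
have [|w0 h'] := dchain_reveal h; first by rewrite mxE xc mulr0.
by split=> // c' /h'; rewrite mxE mulf_eq0 negb_or => /andP[].
Qed.

Lemma hard_oracle_reveal i x z c : hard_oracle i x z 0 c != 0 -> x 0 c = 0 ->
  [/\ w i c != 0, forall c' : 'I_p, c'.+1 = c :> nat -> x 0 c' != 0
    & z || [exists c' : 'I_p, (c <= c')%N && (x 0 c' != 0)]].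
Proof.
rewrite mxE mulf_eq0 negb_or => /andP[g f] xc.
have [w0 h] := hard_grad_reveal g xc; split=> //.
have [f0|f1] := fresh_01 x c.
  have [c' cc' xc'] := fresh_eq0 f0.
  by apply/orP; right; apply/existsP; exists c'; rewrite cc'.
by move: f; rewrite f1; case: z => //; rewrite mul0r mul1r sub0r subrr eqxx.
Qed.

(** At most one term is nonzero, that of the coordinate after the last nonzero
    one; up to the scale a / lam its size is at most W, since the gate and the slope
    are at most 1. *)
Lemma fresh_grad_sqn i x :
  \sum_c (hard_grad i x 0 c * fresh x c) ^+ 2 <= (a / lam) ^+ 2 * W ^+ 2.
Proof.
have [[c hc]|/forallNP no] := pselect (exists c, hard_grad i x 0 c * fresh x c != 0); last first.
  rewrite big1; first by apply: mulr_ge0; exact: sqr_ge0.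
  by move=> c _; have /negP := no c; rewrite negbK => /eqP ->; rewrite expr0n.
have props c' : hard_grad i x 0 c' * fresh x c' != 0 ->
    [/\ hard_grad i x 0 c' != 0, fresh x c' = 1 & x 0 c' = 0].
  rewrite mulf_eq0 negb_or => /andP[g f].
  have [f0|f1] := fresh_01 x c'; first by rewrite f0 eqxx in f.
  by split=> //; exact: (fresh_eq1 f1).
have lt c1 c2 : hard_grad i x 0 c1 * fresh x c1 != 0 ->
    hard_grad i x 0 c2 * fresh x c2 != 0 -> (c2 <= c1)%N.
  move=> /props[_ f1 _] /props[g2 _ x2]; rewrite leqNgt; apply/negP => c12.
  have [_ h] := hard_grad_reveal g2 x2.
  have c2p : (c2.-1 < p)%N by apply: leq_ltn_trans (leq_pred _) (ltn_ord c2).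
  have := h (Ordinal c2p); rewrite /= prednK ?(leq_ltn_trans _ c12)// => /(_ erefl).
  by rewrite (fresh_eq1 f1) ?eqxx//= -ltnS prednK// (leq_ltn_trans _ c12).
rewrite (bigD1 c)//= big1 ?addr0 => [|c' c'c]; last first.
  apply/eqP; rewrite sqrf_eq0; apply: contraNT c'c => hc'.
  by apply/eqP/val_inj/eqP; rewrite eqn_leq !lt.
have [_ -> xc] := props _ hc; rewrite mulr1 mxE exprMn ler_wpM2l ?sqr_ge0//.
by apply: dchain_zero_le => //; rewrite mxE xc mulr0.
Qed.

Definition hard_xi i (t b : nat) : measurableTypeR R -> bool := coin Q (i, t, b).

HB.instance Definition _ i t b := @isMeasurableFun.Build _ _ _ _ (hard_xi i t b)
  (@measurable_coin R Q _ (i, t, b)).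

Definition hard_problem : problem R n :=
  @Problem R n p hard_obj 0 _ (fun=> bool) (fun=> bernoulli_prob Q%:R^-1) hard_oracle
    _ (measurableTypeR R) (uniform_prob (@ltr01 R)) hard_xi.

End hard_instance.

(** * Admissibility of the hard instance *)

Section hard_admissible.
Context {R : realType} {n : nat} (p Q : nat) (w : 'I_n -> nat -> R) (W a lam : R).
Hypotheses (n0 : (0 < n)%N) (p0 : (0 < p)%N) (Q0 : (0 < Q)%N) (a0 : 0 < a) (lam0 : 0 < lam).
Hypothesis wW : forall i k, 0 <= w i k <= W.
Hypothesis w_avg : forall k, n%:R^-1 * \sum_i w i k = 1.

Let I := hard_problem p Q w a lam.
Let gradE i x : grad (obj I i) x = hard_grad w a lam i x.
Proof. exact: hard_gradE. Qed.

(** The weights average to 1, whence the average objective is the uniform chain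
    whatever the distribution of its links among the agents. *)
Lemma hard_avgE (x : 'rV[R]_p) : avg_obj I x = a * chain (fun=> 1) (lam^-1 *: x).
Proof.
rewrite /avg_obj /= /hard_obj -mulr_sumr mulrCA; congr (_ * _).
rewrite /chain exchange_big /= mulr_sumr; apply: eq_bigr => k _.
by rewrite -mulr_suml mulrA w_avg.
Qed.

Lemma hard_avg_gradE (x : 'rV[R]_p) :
  grad (avg_obj I) x = (a / lam) *: dchain (fun=> 1) (lam^-1 *: x).
Proof.
have -> : avg_obj I = hard_obj (fun=> (fun=> 1)) a lam (Ordinal n0).
  by apply/funext => y; rewrite hard_avgE.
by rewrite (@hard_gradE _ _ _ _ 1)// => i k; rewrite lexx ler01.
Qed.

Lemma hard_avg_ge (x : 'rV[R]_p) : - (a * (3 * p%:R)) <= avg_obj I x.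
Proof.
by rewrite hard_avgE -mulrN ler_pM2l// chain_ge// => k; rewrite lexx ler01.
Qed.

Lemma hard_lbound : has_lbound (range (avg_obj I)).
Proof.
by exists (- (a * (3 * p%:R))) => _ [x _ <-]; exact: hard_avg_ge.
Qed.

(** The point with all its coordinates equal to lam is better than 0. *)
Lemma hard_gap_gt0 : 0 < gap I.
Proof.
rewrite /gap /= hard_avgE scaler0 chain_start// subr_gt0.
apply: (@le_lt_trans _ _ (avg_obj I (lam *: const_mx 1))).
  by apply: ge_inf; [exact: hard_lbound|exists (lam *: const_mx 1)].
rewrite hard_avgE scalerA mulVf ?lt0r_neq0// scale1r ltr_pM2l//.
by have := @chain_ones R p p0; lra.
Qed.

Lemma hard_gap_le : gap I <= 3 * a * p%:R.
Proof.
rewrite /gap /= hard_avgE scaler0 chain_start//.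
have : - (a * (3 * p%:R)) <= inf (range (avg_obj I)).
  by apply: lb_le_inf; [exists (avg_obj I 0); exists 0|move=> _ [x _ <-]; exact: hard_avg_ge].
by have := a0; lra.
Qed.

Lemma hard_smooth (L : R) : a * (70 * W) / lam ^+ 2 <= L -> smooth I L.
Proof.
move=> aL i; split.
- by move=> x; exact: (hard_diff _ a0 wW i x).1.
- rewrite (_ : grad (obj I i) = hard_grad w a lam i).
    apply: (lipschitz_continuous (L := L)) => x y.
    exact: (hard_grad_lip a0 lam0 wW).
  by apply/funext => x; exact: gradE.
- by move=> x y; rewrite /= !gradE; exact: (hard_grad_lip a0 lam0 wW).
Qed.

Let QQ : Q%:R^-1 * Q%:R = 1 :> R.
Proof. by rewrite mulVf// pnatr_eq0 -lt0n. Qed.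

Lemma hard_unbiased : unbiased I.
Proof.
move=> i x c /=; rewrite gradE.
rewrite (_ : (fun z => _) = (fun z : bool => hard_oracle Q w a lam i x z 0 c))//.
rewrite expectation_bernoulli ?inv_nat01// !mxE /=; congr (_%:E).
set g := a / lam * _; set f := fresh x c; rewrite mul1r mul0r.
transitivity (g * (1 + f * (Q%:R^-1 * Q%:R - 1))); last by rewrite QQ subrr mulr0 addr0 mulr1.
by rewrite /=; lra.
Qed.

(** Q times a Bernoulli variable of parameter 1 / Q has variance Q - 1. *)
Lemma hard_variance (sigma2 : R) : (a / lam) ^+ 2 * W ^+ 2 * (Q%:R - 1) <= sigma2 ->
  variance_le I sigma2.
Proof.
move=> hs i x /=; rewrite gradE.
rewrite (_ : (fun z => _) = (fun z : bool =>
    enorm (hard_oracle Q w a lam i x z - hard_grad w a lam i x) ^+ 2))//.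
rewrite expectation_bernoulli ?inv_nat01// lee_fin; apply: le_trans hs.
pose S := \sum_c (hard_grad w a lam i x 0 c * fresh x c) ^+ 2.
have E z : enorm (hard_oracle Q w a lam i x z - hard_grad w a lam i x) ^+ 2 =
    (z%:R * Q%:R - 1) ^+ 2 * S.
  rewrite enorm_sq /sqn mulr_sumr; apply: eq_bigr => c _; rewrite !mxE.
  by rewrite -exprMn; congr (_ ^+ 2); lra.
have SW := fresh_grad_sqn a lam wW i x; rewrite -/S in SW.
have Q1 : 1 <= Q%:R :> R by rewrite ler1n.
rewrite !E /= mul1r mul0r sub0r sqrrN expr1n mul1r.
rewrite (_ : _ + _ = S * (Q%:R - 1)); first by rewrite ler_wpM2r// subr_ge0.
transitivity (S * ((Q%:R^-1 * Q%:R) * (Q%:R - 2) + 1)).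
  by rewrite /=; lra.
by rewrite QQ; lra.
Qed.

Lemma hard_same_law : same_law I.
Proof. by move=> i t b A _; exact: prob_coin. Qed.

Lemma hard_independent : mutually_independent I.
Proof. by move=> J A uJ _; exact: (@coin_independent R Q _ Q0 J A uJ). Qed.

Let measurable_ranked (d : measure_display) (T : measurableType d) (f : T -> 'rV[R]_p) k :
  measurable_fun setT f -> measurable_fun setT (fun x => ranked 1 (lam^-1 *: f x) k).
Proof.
move=> mf; case: k => [|k]; first exact: measurable_cst.
rewrite /ranked; case: insubP => [c _ _|_]; last exact: measurable_cst.
rewrite (_ : (fun x => _) = (fun x => lam^-1 * f x 0 c)); last by apply/funext => x; rewrite mxE.
by apply: measurable_funM => //; have /measurable_fun_matrixP := mf; apply.
Qed.

Lemma hard_measurable i : measurable_fun setT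
  (fun z : 'rV[R]_(dim I) * smp I i => oracle I i z.1 z.2).
Proof.
apply/measurable_fun_matrixP => r c; rewrite (ord1 r) {r}.
have m1 : measurable_fun setT (fun z : 'rV[R]_p * bool => z.1) by exact: measurable_fst.
rewrite (_ : (fun z => _) = (fun z : 'rV[R]_p * bool =>
  (a / lam) * (w i c * dlink2 (ranked 1 (lam^-1 *: z.1) c) (ranked 1 (lam^-1 *: z.1) c.+1) +
   (c.+1 < p)%:R * (w i c.+1 * dlink1 (ranked 1 (lam^-1 *: z.1) c.+1)
      (ranked 1 (lam^-1 *: z.1) c.+2))) *
  (1 + fresh z.1 c * (z.2%:R * Q%:R - 1)))); last first.
  by apply/funext => z; rewrite /= !mxE.
apply: measurable_funM.
  apply: measurable_funM => //; apply: measurable_funD.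
    apply: measurable_funM => //.
    by apply: measurable_dlink2; exact: measurable_ranked.
  do 2 apply: measurable_funM => //.
  by apply: measurable_dlink1; exact: measurable_ranked.
apply: measurable_funD => //; apply: measurable_funM.
  rewrite (_ : (fun z => _) = (fun z : 'rV[R]_p * bool =>
      \prod_(c' < p) (if (c <= c')%N then (z.1 0 c' == 0)%:R else 1))); last first.
    by apply/funext => z; rewrite /fresh big_mkcond.
  apply: measurable_prod => c' _; case: (c <= c')%N => //.
  have mI : measurable_fun setT (fun u : R => (u == 0)%:R : R).
    rewrite (_ : (fun u => _) = \1_[set 0]); first exact: measurable_indic.
    by apply/funext => u; rewrite indicE; case: eqP => h; [rewrite mem_set|rewrite memNset].
  by apply: (measurableT_comp mI); have /measurable_fun_matrixP := m1; apply.
apply: measurable_funB => //; apply: measurable_funM => //.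
have mb : measurable_fun setT (fun b : bool => b%:R : R) by [].
exact: (measurableT_comp mb measurable_snd).
Qed.

Lemma hard_admissible (L sigma2 : R) : a * (70 * W) / lam ^+ 2 <= L ->
  (a / lam) ^+ 2 * W ^+ 2 * (Q%:R - 1) <= sigma2 -> admissible I L sigma2.
Proof.
move=> hL hs; split; split.
- exact: hard_smooth.
- exact: hard_lbound.
- exact: hard_gap_gt0.
- exact: hard_measurable.
- exact: hard_unbiased.
- exact: hard_variance.
- exact: hard_same_law.
- exact: hard_independent.
Qed.

(** A point with a coordinate below lam is far from stationary, and a coordinate
    that has not been discovered is 0. *)
Lemma hard_grad_front (x : 'rV[R]_p) (c : 'I_p) : x 0 c = 0 ->
  a / lam <= enorm (grad (avg_obj I) x).
Proof.
move=> xc; rewrite hard_avg_gradE.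
have al : 0 < a / lam by rewrite divr_gt0.
have h : 1 <= enorm (dchain (fun=> 1) (lam^-1 *: x)).
  by apply: (@dchain_front _ _ _ c); rewrite mxE xc mulr0.
by rewrite enormZ// ler_peMr// ltW.
Qed.

End hard_admissible.

(** * Progress of zero-respecting methods *)

Definition heads (R : realType) (n B Q : nat) (om : measurableTypeR R) (t : nat) : nat :=
  \sum_(u < t) \sum_(i < n) \sum_(b < B) hard_xi Q i u b om.

Section hard_progress.
Context {R : realType} {n B : nat} (p Q : nat) (w : 'I_n -> nat -> R) (a lam : R).
Let I := hard_problem p Q w a lam.
Variables (G : rel 'I_n) (A : protocol R n (dim I) B).
Hypothesis zero_resp : zero_respecting G A.
Variables (s : seed A) (om : omega I).

Lemma answers_row t i (S : n.-tuple 'M[R]_((Defs.mem A).+1, dim I)) k (b : 'I_B) :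
  row b (answers A t i s S om k) =
  if (b < k)%N then oracle I i (query A t i b s S (answers A t i s S om b)) (xi I i t b om)
  else 0.
Proof.
elim: k => [|k IH]; first by rewrite /= row0.
rewrite /= rowK ltnS leq_eqVlt; case: eqP => [->//|_] /=.
exact: IH.
Qed.

(** Coordinates spread along the edges of the graph, and an agent discovers
    coordinate c from an oracle only if this link of the chain belongs to its
    objective, if the preceding coordinate is known in its neighbourhood, and if
    either a later coordinate is known as well or the coin falls on heads. *)
Lemma hard_progress (reach : nat -> 'I_n -> 'I_p -> Prop)
    (known := fun t (i : 'I_n) c => exists2 j, (j == i) || G i j & reach t j c) :
  (forall t i c, known t i c -> reach t.+1 i c) ->
  (forall t i (b : 'I_B) (c : 'I_p), w i c != 0 ->
     (forall c' : 'I_p, c'.+1 = c :> nat -> known t i c') ->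
     hard_xi Q i t b om \/ (exists2 c' : 'I_p, (c <= c')%N & known t i c') ->
     reach t.+1 i c) ->
  forall t i c, active (tnth (states A s om t) i) c -> reach t i c.
Proof.
move=> spread discover; case: zero_resp => zq zu _.
elim=> [|t IH] i c; rewrite /= tnth_mktuple => /existsP[r].
  rewrite /init_state mxE; case: (r == ord0); by rewrite mxE eqxx.
have nb c' : nbhd_active G (states A s om t) i c' -> known t i c'.
  by move=> /existsP[j /andP[ij /IH h]]; exists j.
move/zu => /orP[/nb/spread//|/existsP[b]].
have -> : answers A t i s (states A s om t) om B b c =
    row b (answers A t i s (states A s om t) om B) 0 c by rewrite [RHS]mxE.
rewrite answers_row ltn_ord.
set x := query _ _ _ _ _ _ _ => oc.
have kn c' : x 0 c' != 0 -> known t i c' by move=> h; apply: nb; exact: zq h.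
have [xc|xc] := eqVneq (x 0 c) 0; last exact: (spread _ _ _ (kn _ xc)).
have [w0 prev h] := hard_oracle_reveal oc xc.
apply: (discover t i b c w0); first by move=> c' /prev; exact: kn.
case/orP: h => [h|/existsP[c' /andP[cc' /kn h]]]; first by left.
by right; exists c'.
Qed.

Lemma hard_output (T : nat) (c : 'I_p) :
  (forall i, ~~ active (tnth (states A s om T) i) c) ->
  output A s (states A s om T) 0 c = 0.
Proof.
move=> h; apply/eqP; apply: contraT; case: zero_resp => _ _ zo /zo /existsP[j].
by rewrite (negbTE (h j)).
Qed.

(** At most one coordinate is discovered per heads. *)
Lemma active_heads t i c : active (tnth (states A s om t) i) c -> (c < heads n B Q om t)%N.
Proof.
have hS u : (heads n B Q om u <= heads n B Q om u.+1)%N by rewrite /heads big_ord_recr leq_addr.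
apply: (hard_progress (reach := fun t _ c => (c < heads n B Q om t)%N)) => {t i c}.
  by move=> t i c [j _ h]; exact: leq_trans h (hS t).
move=> t i b c _ prev [hb|[c' cc' [j _ h]]]; last first.
  exact: leq_trans (leq_ltn_trans cc' h) (hS t).
have cN : (c <= heads n B Q om t)%N.
  case: c prev => [[//|c] cp] prev; have cp' := ltnW cp.
  by have [|j _] := prev (Ordinal cp').
apply: (leq_ltn_trans cN); rewrite /heads big_ord_recr -addn1 leq_add2l.
by rewrite (bigD1 i)//= (bigD1 b)//= hb.
Qed.

End hard_progress.

Section hard_travel.
Context {R : realType} {n B : nat} (p Dh : nat) (a lam : R).
Hypotheses (n1 : (1 < n)%N) (Dh0 : (0 < Dh)%N) (Dhn : (Dh <= n.-1)%N).

(** The even links of the chain belong to the agents of one end of the band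
    graph, the odd links to those of the other end. *)
Definition split_weight (i : 'I_n) (k : nat) : R :=
  if i \in band_end Dh (odd k) then n%:R / #|band_end (n := n) Dh (odd k)|%:R else 0.

Lemma band_end_gt0 c : 0 < #|band_end (n := n) Dh c|%:R :> R.
Proof. by rewrite ltr0n; have := band_end_card n1 Dh0 Dhn c; lia. Qed.

Lemma split_weight_range i k : 0 <= split_weight i k <= 6.
Proof.
have E0 := band_end_gt0 (odd k).
rewrite /split_weight; case: ifP => _; last by apply/andP; split.
rewrite divr_ge0 ?ler0n//= ler_pdivrMr//.
by rewrite -(natrM R 6) ler_nat; exact: band_end_card.
Qed.

Lemma split_weight_avg k : n%:R^-1 * \sum_i split_weight i k = 1.
Proof.
rewrite /split_weight -big_mkcond /= sumr_const.
have E0 := band_end_gt0 (odd k).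
rewrite -[X in _ * X]mulr_natr divfK ?lt0r_neq0// mulVf//.
by rewrite pnatr_eq0; lia.
Qed.

Let I := hard_problem p 1 split_weight a lam.
Variable A : protocol R n (dim I) B.
Hypothesis zero_resp : zero_respecting (band Dh) A.
Variables (s : seed A) (om : omega I).

(** Coordinate c is discovered at one end of the graph after its predecessors have
    crossed the graph c times, and must then climb to agent i. *)
Definition travel_time (i : 'I_n) (c : nat) : nat :=
  (1 + c * band_sep Dh +
   (if odd c then band_sep Dh - band_height Dh i else band_height Dh i))%N.

Lemma active_travel t i c :
  active (tnth (states A s om t) i) c -> (travel_time i c <= t)%N.
Proof.
have edge j k c' t' : (k == j) || band Dh j k ->
    (travel_time k c' <= t')%N -> (travel_time j c' <= t'.+1)%N.
  move=> jk.
  have h1 : (band_height Dh j <= (band_height Dh k).+1)%N.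
    case/orP: jk => [/eqP ->//|jk]; apply: (band_height_edge n1 Dh0 Dhn).
    by have [sym _ _ _] := band_class n1 Dh0 Dhn; rewrite sym.
  have h2 : (band_height Dh k <= (band_height Dh j).+1)%N.
    by case/orP: jk => [/eqP ->//|jk]; apply: (band_height_edge n1 Dh0 Dhn).
  move: (band_height_le Dh j) (band_height_le Dh k) h1 h2.
  by rewrite /travel_time; case: odd; clear; lia.
apply: (hard_progress zero_resp (reach := fun t i c => (travel_time i c <= t)%N)) => {t i c}.
  by move=> t i c [j ij h]; exact: edge h.
move=> t i b c wc prev _.
have iE : i \in band_end Dh (odd c) by move: wc; rewrite /split_weight; case: ifP; rewrite ?eqxx.
have hE := band_height_end n1 Dh0 Dhn iE.
case: c prev iE hE {wc} => [[|c] cp] prev iE hE /=.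
  by rewrite /travel_time /= hE.
have [|j ij h] := prev (Ordinal (ltnW cp)); first by [].
have := edge _ _ _ _ ij h; move: hE; rewrite /travel_time /=.
by case: (odd c) => /= ->; clear; lia.
Qed.

End hard_travel.

(** * Expected gradients and the number of heads *)

Section expected_gradient.
Context {R : realType} {n B : nat} (I : problem R n) (A : protocol R n (dim I) B).

Import HBNNSimple.

(** The expectation is a supremum over the simple functions below the integrand,
    and e times the indicator of the event is one of them. *)
Lemma expected_grad_ge T (E : set (omega I)) (e : R) : 0 <= e -> measurable E ->
  (forall om s, E om -> e <= enorm (grad (avg_obj I) (output A s (states A s om T)))) ->
  (e%:E * prob I E <= expected_grad A T)%E.
Proof.
move=> e0 mE h; pose F := E `*` [set: seed A].
have mF : measurable F by exact: measurableX.
pose f := scale_nnsfun (indic_nnsfun R mF) e0.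
have -> : (e%:E * prob I E = sintegral (prob I \x seed_law A) f)%E.
  transitivity (e%:E * sintegral (prob I \x seed_law A) (\1_F : _ -> R))%E.
    congr (_ * _)%E; rewrite sintegral_indic -[LHS]mule1 -(@probability_setT _ _ _ (seed_law A)).
    exact/esym/product_measure1E.
  exact/esym/(sintegralrM _ e (indic_nnsfun R mF)).
rewrite /expected_grad ge0_integralTE; last first.
  by move=> z; rewrite lee_fin enorm_ge0.
apply: ereal_sup_ubound; exists f => // z; rewrite lee_fin -[leLHS]/(e * \1_F z) indicE.
have [/set_mem zF|_] := boolP (z \in F); last by rewrite mulr0 enorm_ge0.
by rewrite mulr1; apply: h; exact: zF.1.
Qed.
End expected_gradient.

Section heads_count.
Context {R : realType} (n B p Q : nat).
Hypotheses (Q0 : (0 < Q)%N) (p0 : (0 < p)%N).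
Notation P := (uniform_prob (@ltr01 R)).

Lemma heads_sumE T om : (heads n B Q (om : measurableTypeR R) T)%:R =
  \sum_(k : 'I_T * 'I_n * 'I_B) (\1_(hard_xi Q k.1.2 k.1.1 k.2 @^-1` [set true]) om : R).
Proof.
rewrite /heads natr_sum; under eq_bigr do rewrite natr_sum.
under eq_bigr do under eq_bigr do rewrite natr_sum.
rewrite !pair_bigA; apply: eq_bigr => -[[u i] b] _ /=.
by rewrite indicE; case h: (hard_xi Q i u b om); [rewrite mem_set|rewrite memNset//= h].
Qed.

Lemma measurable_heads_lt T :
  measurable [set om : measurableTypeR R | (heads n B Q om T < p)%N].
Proof.
have mN : measurable_fun setT (fun om : measurableTypeR R => (heads n B Q om T)%:R : R).
  rewrite (_ : (fun om => _) = (fun om => \sum_(k : 'I_T * 'I_n * 'I_B)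
      (\1_(hard_xi Q k.1.2 k.1.1 k.2 @^-1` [set true]) om : R))); last first.
    by apply/funext => om; exact: heads_sumE.
  apply: measurable_sum => k; apply: measurable_indic.
  by rewrite -[X in measurable X]setTI; exact: measurable_coin.
rewrite (_ : mkset _ = (fun om : measurableTypeR R => (heads n B Q om T)%:R : R) @^-1`
    `]-oo, p%:R[%classic); last first.
  by apply/seteqP; split=> om /=; rewrite in_itv /= ltr_nat.
by rewrite -[X in measurable X]setTI; exact: mN.
Qed.

(** Markov's inequality for the number of heads. *)
Lemma prob_heads_lt T : (4 * (T * n * B) <= p * Q)%N ->
  ((3 / 4)%:E <= P [set om | (heads n B Q om T < p)%N])%E.
Proof.
move=> hT; set E := mkset _; have mE : measurable E by exact: measurable_heads_lt.
have mk (k : 'I_T * 'I_n * 'I_B) : measurable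
    (hard_xi Q k.1.2 k.1.1 k.2 @^-1` [set true] : set (measurableTypeR R)).
  by rewrite -[X in measurable X]setTI; exact: measurable_coin.
have ik (k : 'I_T * 'I_n * 'I_B) : intb P
    (\1_(hard_xi Q k.1.2 k.1.1 k.2 @^-1` [set true]) : measurableTypeR R -> R).
  exact: integrable_indic.
have exN : ex P (fun om => (heads n B Q om T)%:R) = (T * n * B)%:R / Q%:R.
  rewrite (eq_ex _ (heads_sumE T)) ex_sum//.
  transitivity (\sum_(k : 'I_T * 'I_n * 'I_B) Q%:R^-1 : R).
    apply: eq_bigr => k _; apply: EFin_inj; rewrite exE// integral_indic// setIT.
    transitivity (bernoulli_prob (Q%:R^-1 : R) [set true]).
      exact: (@prob_coin R Q _ Q0 (k.1.2, k.1.1 : nat, k.2 : nat)).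
    rewrite bernoulli_probE ?inv_nat01// !diracE mem_set// memNset//.
    by rewrite mule1 mule0 adde0.
  rewrite sumr_const -[LHS]mulr_natl; congr (_%:R * _).
  by rewrite -[LHS]/#|{: 'I_T * 'I_n * 'I_B}| !card_prod !card_ord.
have iN : intb P (fun om => (heads n B Q om T)%:R).
  rewrite (_ : (fun om => _) = (fun om => \sum_(k : 'I_T * 'I_n * 'I_B)
      (\1_(hard_xi Q k.1.2 k.1.1 k.2 @^-1` [set true]) om : R))).
    by apply: intb_sum => k _; exact: ik.
  by apply/funext => om; exact: heads_sumE.
have iE : intb P (\1_E : measurableTypeR R -> R) by exact: integrable_indic.
have pR : 0 < p%:R :> R by rewrite ltr0n.
have QR : 0 < Q%:R :> R by rewrite ltr0n.
have h : ex P (fun om => p%:R + (- p%:R) * \1_E om) <= ex P (fun om => (heads n B Q om T)%:R).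
  apply: ex_le => //; first by apply: intbD; [exact: intb_cst|exact: intbZ].
  move=> om; rewrite indicE; have [/set_mem _|] := boolP (om \in E).
    by rewrite mulr1 addrN ler0n.
  by rewrite notin_setE /E /= mulr0 addr0 ler_nat => /negP; rewrite -leqNgt.
move: h; rewrite exD ?exZ ?ex_cst//; [|exact: intb_cst|exact: intbZ].
rewrite exN ler_pdivlMr// => h.
have exE1 : (ex P (\1_E : measurableTypeR R -> R))%:E = P E.
  by rewrite exE// integral_indic// setIT.
rewrite -exE1 lee_fin.
have : (4 * (T * n * B))%:R <= (p * Q)%:R :> R by rewrite ler_nat.
rewrite !natrM; move: h; rewrite !natrM; move: (ex _ _) => x h1 h2.
have pQ : 0 < p%:R * Q%:R :> R by rewrite mulr_gt0.
rewrite -(ler_pM2l pQ); lra.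
Qed.

End heads_count.

(** * The minimax lower bound *)

Section lower_bound.
Context {R : realType}.

Lemma round_complexity_ge n B (M : method R n B) G (I : problem R n) (eps x : R) :
  (forall T, (0 < T)%N -> T%:R < x -> (eps%:E < expected_grad (M G (dim I) T) T)%E) ->
  (x%:E <= round_complexity M G I eps)%E.
Proof.
move=> h; apply: le_ereal_inf_tmp => _ [T [T0 hT] <-].
rewrite lee_fin leNgt; apply/negP => /(h _ T0).
by rewrite ltNge hT.
Qed.

Section hard_parameters.
Variables (n Dh B p : nat) (Delta L sigma2 eps a lam : R).
Hypotheses (n1 : (1 < n)%N) (Dh0 : (0 < Dh)%N) (Dhn : (Dh <= n.-1)%N).
Hypotheses (s0 : 0 < sigma2) (e0 : 0 < eps) (p2 : (1 < p)%N) (a0 : 0 < a) (lam0 : 0 < lam).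
Hypotheses (a_lam : a / lam = 2 * eps) (aL : a * 420 / lam ^+ 2 <= L).
Hypothesis aD : 3 * a * p%:R <= Delta.

Let p0 : (0 < p)%N := ltnW p2.
Let n0 : (0 < n)%N := ltnW n1.

Definition worst_instance (M : method R n B) : \bar R :=
  ereal_sup [set u | exists2 I : problem R n,
    admissible I L sigma2 /\ (gap I <= Delta)%R & u = worst_case M Dh I eps].

Section instance.
Variables (Q : nat) (w : 'I_n -> nat -> R).
Hypothesis Q0 : (0 < Q)%N.
Hypothesis wW : forall i k, 0 <= w i k <= 6.
Hypothesis w_avg : forall k, n%:R^-1 * \sum_i w i k = 1.
Hypothesis Qs : 144 * eps ^+ 2 * (Q%:R - 1) <= sigma2.

Notation I := (hard_problem p Q w a lam).

Let scaled_admissible : admissible I L sigma2 /\ gap I <= Delta.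
Proof.
split; last exact: (le_trans (hard_gap_le Q lam p0 a0 w_avg) aD).
apply: (hard_admissible p0 Q0 a0 lam0 wW w_avg).
  by rewrite (_ : 70 * 6 = 420)//; lra.
rewrite a_lam (_ : (2 * eps) ^+ 2 * 6 ^+ 2 = 144 * eps ^+ 2)//.
by rewrite exprMn; lra.
Qed.

(** The output vanishes in the last coordinate if no agent knows it. *)
Lemma not_stationary (A : protocol R n (dim I) B) (G : rel 'I_n) s (om : omega I) T :
  zero_respecting G A -> (forall i (c : 'I_p), c.+1 = p :> nat ->
    ~~ active (tnth (states A s om T) i) c) ->
  2 * eps <= enorm (grad (avg_obj I) (output A s (states A s om T))).
Proof.
move=> zr h; have pp : (p.-1 < p)%N by rewrite prednK.
have oc : output A s (states A s om T) 0 (Ordinal pp) = 0.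
  by apply: (hard_output zr) => i; apply: h; rewrite /= prednK.
by rewrite -a_lam; exact: (hard_grad_front Q n0 a0 lam0 w_avg oc).
Qed.

Lemma worst_instance_ge (M : method R n B) (y : R) :
  (forall T, (0 < T)%N -> T%:R < y ->
    (eps%:E < expected_grad (I := I) (M (band Dh) p T) T)%E) ->
  (y%:E <= worst_instance M)%E.
Proof.
move=> h; apply: le_ereal_sup_tmp.
exists (worst_case M Dh I eps); first by exists I => //; exact: scaled_admissible.
apply: le_ereal_sup_tmp; exists (round_complexity M (band Dh) I eps).
  by exists (band Dh) => //; exact: band_class.
exact: round_complexity_ge.
Qed.

End instance.

(** Sampling: on average Q / (n B) rounds pass between two heads. *)
Lemma sampling_bound (M : method R n B) (Q : nat) : (0 < B)%N -> (0 < Q)%N ->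
  144 * eps ^+ 2 * (Q%:R - 1) <= sigma2 -> in_method_class Dh M ->
  ((p%:R * Q%:R / (4 * (n%:R * B%:R)))%:E <= worst_instance M)%E.
Proof.
move=> B0 Q0 Qs inM.
have nB : 0 < n%:R * B%:R :> R by rewrite mulr_gt0 ?ltr0n.
pose w (i : 'I_n) (k : nat) : R := 1.
have wW i k : 0 <= w i k <= 6 by rewrite /w; apply/andP; split; lra.
have w_avg k : n%:R^-1 * \sum_i w i k = 1.
  by rewrite /w sumr_const card_ord mulVf// pnatr_eq0 -lt0n.
apply: (worst_instance_ge Q0 wW w_avg Qs) => T T0 hT.
have [_ zr _] := inM _ (band_class n1 Dh0 Dhn) p T.
have hT' : (4 * (T * n * B) <= p * Q)%N.
  rewrite -(ler_nat R); move: hT; rewrite ltr_pdivlMr ?(mulr_gt0 _ nB)// => /ltW.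
  by rewrite !natrM; lra.
have PE := prob_heads_lt (R := R) Q0 p0 hT'.
apply: (@lt_le_trans _ _ ((2 * eps)%:E * (3 / 4)%:E)%E).
  by rewrite -EFinM lte_fin; have := e0; lra.
apply: (@le_trans _ _ ((2 * eps)%:E * uniform_prob (@ltr01 R) [set om | (heads n B Q om T < p)%N])%E).
  by rewrite lee_pmul2l// lte_fin mulr_gt0.
apply: (expected_grad_ge (I := hard_problem p Q w a lam)).
- by rewrite mulr_ge0// ltW.
- exact: measurable_heads_lt.
move=> om s /= hE; apply: (not_stationary w_avg zr) => i c cp.
apply/negP => /(active_heads zr) h.
by have := leq_ltn_trans h hE; rewrite cp ltnn.
Qed.

(** Communication: each of the p - 1 last coordinates of the chain has to travel
    between the two ends of the band graph. *)
Lemma communication_bound (M : method R n B) : in_method_class Dh M ->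
  (((p%:R - 1) * (band_sep Dh)%:R)%:E <= worst_instance M)%E.
Proof.
move=> inM.
have wW := split_weight_range (R := R) n1 Dh0 Dhn.
have w_avg := split_weight_avg (R := R) n1 Dh0 Dhn.
have Qs : 144 * eps ^+ 2 * (1%:R - 1) <= sigma2 by rewrite subrr mulr0 ltW.
apply: (worst_instance_ge (Q := 1) _ wW w_avg Qs) => // T T0 hT.
have [_ zr _] := inM _ (band_class n1 Dh0 Dhn) p T.
have hT' : (T < p.-1 * band_sep Dh)%N.
  by rewrite -(ltr_nat R) natrM -subn1 natrB.
apply: (@lt_le_trans _ _ ((2 * eps)%:E * uniform_prob (@ltr01 R) setT)%E).
  by rewrite probability_setT mule1 lte_fin; have := e0; lra.
apply: (expected_grad_ge (I := hard_problem p 1 (split_weight Dh) a lam)).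
- by rewrite mulr_ge0// ltW.
- exact: measurableT.
move=> om s _; apply: (not_stationary w_avg zr) => i c cp.
apply/negP => /(active_travel n1 Dh0 Dhn zr).
apply/negP; rewrite -ltnNge; apply: leq_trans hT' _.
have -> : p.-1 = c by exact: (esym (congr1 predn cp)).
by rewrite /travel_time -addnA addnCA leq_addr.
Qed.

End hard_parameters.

(** The chain is scaled so that its smoothness constant is L and that the norm of
    its gradient before its end is at least 2 eps; this leaves room for
    Delta L / (5040 eps ^ 2) coordinates. *)
Lemma minimax_ge : exists2 c : R, 0 < c & forall n Dh B (Delta L sigma2 eps : R),
  (1 < n)%N -> (1 <= Dh <= n.-1)%N -> (0 < B)%N -> 0 < L -> 0 < sigma2 -> 0 < eps ->
  210 * 72 * eps ^+ 2 <= Delta * L ->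
  ((c * (Delta * L * sigma2 / (n%:R * B%:R * eps ^+ 4)
     + Delta * L * Dh%:R / eps ^+ 2))%:E <= minimax n Dh B Delta L sigma2 eps)%E.
Proof.
(* The gradient of the chain with weights at most 6 is 420-Lipschitz; this constant
   is doubled because the gradient has to be at least 2 eps instead of eps. *)
have [k kE] : exists k : R, k = 840 by exists 840.
have k0 : 0 < k by lra.
exists (2304 * (6 * k))^-1; first by rewrite invr_gt0; lra.
move=> n Dh B Delta L sigma2 eps n1 /andP[Dh0 Dhn] B0 L0 s0 e0 he.
have e2 : 0 < eps ^+ 2 by rewrite exprn_gt0.
have LL : L * L^-1 = 1 by rewrite divff// lt0r_neq0.
pose lam := k * eps / L; pose a := 2 * k * eps ^+ 2 / L.
pose x := Delta * L / (6 * k * eps ^+ 2).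
have lam0 : 0 < lam := divr_gt0 (mulr_gt0 k0 e0) L0.
have ke0 : 0 < k * eps ^+ 2 := mulr_gt0 k0 e2.
have a0 : 0 < a by apply: divr_gt0 => //; lra.
have k6 : 0 < 6 * k * eps ^+ 2 by lra.
have x3 : 3 <= x by rewrite (ler_pdivlMr _ _ k6) kE; lra.
have DL : 0 <= Delta * L by lra.
clear he; have x0 : 0 <= x by apply: le_trans x3; lra.
have [p x_ge x_lt] : exists2 p : nat, p%:R <= x & x < p%:R + 1.
  by have /andP[h1 h2] := truncn_itv x0; exists (Num.truncn x); rewrite ?natr1.
have p2 : (1 < p)%N by rewrite -(ltr_nat R); lra.
have a_lam : a / lam = 2 * eps.
  by apply: (mulIf (lt0r_neq0 lam0)); rewrite divfK ?lt0r_neq0// /a /lam; lra.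
have aL : a * 420 / lam ^+ 2 <= L.
  rewrite (_ : _ / _ = a / lam * 420 / lam); last by rewrite expr2 invfM; lra.
  rewrite a_lam ler_pdivrMr// /lam.
  have -> : L * (k * eps / L) = k * eps * (L * L^-1) by move: (L^-1) => u; lra.
  by rewrite LL mulr1 kE; lra.
have aD : 3 * a * p%:R <= Delta.
  apply: (@le_trans _ _ (3 * a * x)); first by rewrite ler_pM2l//; lra.
  rewrite /x mulrA (ler_pdivrMr _ _ k6) /a.
  rewrite (_ : 3 * _ * _ = Delta * (6 * k * eps ^+ 2) * (L * L^-1)); last by lra.
  by rewrite LL mulr1.
apply: le_ereal_inf_tmp => _ [M inM ->].
set r1 := _ / (_ * eps ^+ 4); set r2 := Delta * L * Dh%:R / eps ^+ 2.
have h1 : ((r1 / (1152 * (6 * k)))%:E <= worst_instance Dh Delta L sigma2 eps M)%E.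
  pose y := sigma2 / (144 * eps ^+ 2).
  have k1 : 0 < 144 * eps ^+ 2 by lra.
  have y0 : 0 <= y by apply: divr_ge0; exact: ltW.
  have [Q1 Q2] := truncS_bounds y0.
  have Q0 : (0 < (Num.truncn y).+1)%N by [].
  move: Q1 Q2 Q0; move: (_.+1) => Q Q1 Q2 Q0.
  have Qs : 144 * eps ^+ 2 * (Q%:R - 1) <= sigma2.
    by rewrite mulrC -ler_pdivlMr// lerBlDr.
  apply: le_trans (sampling_bound n1 Dh0 Dhn e0 p2 a0 lam0 a_lam aL aD B0 Q0 Qs inM).
  have nB : 0 < n%:R * B%:R :> R by rewrite mulr_gt0 ?ltr0n// ltnW.
  have nB4 : 0 < 4 * (n%:R * B%:R) :> R by lra.
  rewrite lee_fin (ler_pdivlMr _ _ nB4).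
  apply: (@le_trans _ _ (x / 2 * y)); last first.
    by apply: ler_pM => //; [rewrite divr_ge0|lra].
  have r1E : r1 * (n%:R * B%:R) = Delta * L * sigma2 * ((eps ^+ 2)^-1 * (eps ^+ 2)^-1).
    rewrite /r1 (_ : eps ^+ 4 = eps ^+ 2 * eps ^+ 2); last by rewrite -exprD.
    move: (n%:R * B%:R) nB (eps ^+ 2) => u u0 v; rewrite !invfM.
    transitivity (Delta * L * sigma2 * (v^-1 * v^-1) * (u * u^-1)); first by lra.
    by rewrite divff ?lt0r_neq0// mulr1.
  rewrite (_ : r1 / _ * _ = 4 * (r1 * (n%:R * B%:R)) / (1152 * (6 * k))); last by lra.
  rewrite r1E /x /y !invfM; move: (eps ^+ 2)^-1 => v; lra.
have h2 : ((r2 / (9 * (6 * k)))%:E <= worst_instance Dh Delta L sigma2 eps M)%E.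
  apply: le_trans (communication_bound n1 Dh0 Dhn s0 e0 p2 a0 lam0 a_lam aL aD inM).
  have dD : Dh%:R <= 3 * (band_sep Dh)%:R :> R.
    by rewrite -(natrM R 3) ler_nat; exact: (band_sep_ge n1 Dh0 Dhn).
  rewrite lee_fin; apply: (@le_trans _ _ (x / 3 * (Dh%:R / 3))).
    by rewrite /r2 /x invfM; lra.
  by apply: ler_pM; rewrite ?divr_ge0//; lra.
have r2_0 : 0 <= r2 by rewrite divr_ge0 ?(ltW e2)// mulr_ge0.
have r1_0 : 0 <= r1.
  by rewrite divr_ge0//; apply: mulr_ge0 => //; [exact: ltW|rewrite exprn_ge0// ltW].
have ki : 0 < (6 * k)^-1 by rewrite invr_gt0; lra.
have [r12|r12] := leP r1 r2; [apply: le_trans h2|apply: le_trans h1];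
  rewrite lee_fin !(invfM _ (6 * k)).
  by move: (6 * k)^-1 ki => u u0; have := ler_wpM2r (ltW u0) r12; have := mulr_ge0 r2_0 (ltW u0); lra.
by move: (6 * k)^-1 ki => u u0; have := ler_wpM2r (ltW u0) (ltW r12); lra.
Qed.

End lower_bound.

(** * The minimax rate and uniform optimality *)

Section optimality.
Context {R : realType}.

Lemma minimax_rate : exists c C : R, [/\ 0 < c, 0 < C & forall n Dh B (Delta L sigma2 eps : R),
  (1 < n)%N -> (1 <= Dh <= n.-1)%N -> (0 < B)%N -> 0 < Delta -> 0 < L -> 0 < sigma2 ->
  0 < eps <= 125^-1 * Num.sqrt (Delta * L) ->
  forall rate, rate = Delta * L * sigma2 / (n%:R * B%:R * eps ^+ 4)
                      + Delta * L * Dh%:R / eps ^+ 2 ->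
  ((c * rate)%:E <= minimax n Dh B Delta L sigma2 eps <= (C * rate)%:E)%E].
Proof.
have [c c0 lower] := @minimax_ge R; exists c, 197; split=> //.
move=> n Dh B Delta L sigma2 eps n1 DhB B0 De0 L0 s0 /andP[e0 he] rate ->.
have DL0 : 0 < Delta * L by rewrite mulr_gt0.
have he2 : (125 * eps) ^+ 2 <= Delta * L.
  rewrite -[leRHS](sqr_sqrtr (ltW DL0)) lerXn2r ?nnegrE ?sqrtr_ge0//.
    by rewrite mulr_ge0// ltW.
  by rewrite mulrC -ler_pdivlMr// mulrC.
have e2 : 0 < eps ^+ 2 by rewrite exprn_gt0.
rewrite exprMn in he2; apply/andP; split.
  by apply: lower => //; lra.
by apply: minimax_le => //; [case/andP: DhB|lra].
Qed.

Lemma treeRGT_uniformly_optimal : uniformly_optimal (@treeRGT R).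
Proof.
have [c [C [c0 C0 bounds]]] := minimax_rate; split.
  by move=> n hn Dh B Df L sigma2 _ _ _ _ _; exact: treeRGT_in_class.
move=> Df Delta L sigma2 H /andP[Df0 DfD] L0 s0 H0.
have De0 := lt_le_trans Df0 DfD.
have DL0 : 0 < Delta * L by rewrite mulr_gt0.
have DLs0 : 0 < Delta * L * sigma2 by rewrite mulr_gt0.
have C10 := round_const_gt0 Df0 L0 s0 H0; set C1 := round_const _ _ _ _ in C10.
(* The problem-dependent factors of the two terms of the minimax rate lie between
   m and m'. *)
pose m := Num.min (Delta * L * sigma2) (Delta * L).
pose m' := Num.max (Delta * L * sigma2) (Delta * L).
have m0 : 0 < m by rewrite lt_min DLs0.
have m'0 : 0 < m' by rewrite lt_max DLs0.
exists (fun n Dh B eps => C1 * ((n%:R * B%:R * eps ^+ 4)^-1 + Dh%:R / eps ^+ 2)).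
exists (c * m / C1), (C * m' / C1).
exists (Num.min 1 (125^-1 * Num.sqrt (Delta * L))).
split.
- by rewrite divr_gt0// mulr_gt0.
- by rewrite divr_gt0// mulr_gt0.
- by rewrite lt_min ltr01 mulr_gt0 ?invr_gt0 ?sqrtr_gt0.
move=> n hn Dh B eps DhB B0 /andP[e0]; rewrite le_min => /andP[e1 he].
have [Dh0 _] := andP DhB; split.
  move=> I G adm gI HI GG.
  by apply: (treeRGT_round_complexity hn Df0 L0 s0 H0 Dh0 B0) => //; rewrite e0.
have r1_0 : 0 <= (n%:R * B%:R * eps ^+ 4)^-1.
  by rewrite invr_ge0 mulr_ge0 ?exprn_ge0 ?(ltW e0)// mulr_ge0.
have r2_0 : 0 <= Dh%:R / eps ^+ 2 by rewrite divr_ge0// exprn_ge0// ltW.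
have heps : 0 < eps <= 125^-1 * Num.sqrt (Delta * L) by rewrite e0.
have := bounds _ _ _ _ _ _ _ hn DhB B0 De0 L0 s0 heps _ erefl => /andP[lo up].
move: lo up r1_0 r2_0; rewrite -!(mulrA (Delta * L)); set r1 := _^-1; set r2 := Dh%:R / _.
move=> lo up r1_0 r2_0.
apply/andP; split.
  apply: le_trans lo; rewrite lee_fin.
  rewrite -(mulrA (c * m)) mulKf ?lt0r_neq0// -(mulrA c m).
  apply: (ler_wpM2l (ltW c0)); rewrite mulrDr [Delta * L * (sigma2 * _)]mulrA.
  by apply: lerD; apply: ler_wpM2r => //; rewrite ge_min lexx ?orbT.
apply: (le_trans up); rewrite lee_fin.
rewrite -(mulrA (C * m')) mulKf ?lt0r_neq0// -(mulrA C m').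
apply: (ler_wpM2l (ltW C0)); rewrite mulrDr [Delta * L * (sigma2 * _)]mulrA.
by apply: lerD; apply: ler_wpM2r => //; rewrite le_max lexx ?orbT.
Qed.

End optimality.

Theorem mainTheorem12 (R : realType) :
  (forall Df L sigma2 H : R, 0 < Df -> 0 < L -> 0 < sigma2 -> 0 <= H ->
   exists C eps0 : R, 0 < C /\ 0 < eps0 /\
   forall (n : nat) (hn : (1 < n)%N) (Dh B : nat) (I : problem R n) (eps : R),
     (1 <= Dh <= n.-1)%N -> (0 < B)%N ->
     admissible I L sigma2 -> gap I = Df -> grad_energy I = H ->
     0 < eps <= eps0 ->
     (worst_case (treeRGT hn B Df L sigma2) Dh I eps
        <= (C * ((n%:R * B%:R * eps ^+ 4)^-1 + Dh%:R / eps ^+ 2))%:E)%E)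
  /\
  (exists c C kappa : R, 0 < c /\ 0 < C /\ 0 < kappa /\
   forall (n Dh B : nat) (Delta L sigma2 eps : R),
     (1 < n)%N -> (1 <= Dh <= n.-1)%N -> (0 < B)%N ->
     0 < Delta -> 0 < L -> 0 < sigma2 ->
     0 < eps <= kappa * Num.sqrt (Delta * L) ->
     let rate := Delta * L * sigma2 / (n%:R * B%:R * eps ^+ 4)
                 + Delta * L * Dh%:R / eps ^+ 2 in
     ((c * rate)%:E <= minimax n Dh B Delta L sigma2 eps
        <= (C * rate)%:E)%E)
  /\
  uniformly_optimal (@treeRGT R).
Proof.
split; [|split]; last exact: treeRGT_uniformly_optimal.
  move=> Df L sigma2 H Df0 L0 s0 H0.
  exists (round_const Df L sigma2 H), 1; split; first exact: round_const_gt0.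
  split=> // n hn Dh B I eps /andP[Dh0 _] B0 adm gI HI he.
  apply: ge_ereal_sup => _ [G GG <-].
  exact: (treeRGT_round_complexity hn Df0 L0 s0 H0 Dh0 B0).
have [c [C [c0 C0 bounds]]] := @minimax_rate R.
exists c, C, 125^-1; split=> //; split=> //; split; first by rewrite invr_gt0.
move=> n Dh B Delta L sigma2 eps n1 DhB B0 De0 L0 s0 he.
exact: (bounds _ _ _ _ _ _ _ n1 DhB B0 De0 L0 s0 he _ erefl).
Qed.
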